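(* Let $G$ be a finitely generated group and let $\lambda\colon G\to U(\ell^2 G)$ be its left regular representation. If $H^2(G,\ell^2(G))=0$, then for every $n\ge1$ every $n$-tuple $(c_1,\dots,c_n)$ of skew-adjoint elements of $Z^1(G,\mathrm{HS}(\ell^2G)_{\mathrm{Ad}\,\lambda})$ integrates to an analytic unitary Hilbert–Schmidt deformation of $\lambda$.
   Context: $\ell^2(G)$ is a $G$-module via $\lambda$. For a $G$-module $V$, $C^k(G,V)=V^{G^k}$ are the inhomogeneous cochains with the usual differential $d_k$, $Z^k(G,V)=\ker d_k$, and $H^k(G,V)=Z^k(G,V)/d_{k-1}C^{k-1}(G,V)$ is unreduced cohomology. $\mathrm{HS}(\ell^2G)_{\mathrm{Ad}\,\lambda}$ is the Hilbert space of Hilbert–Schmidt operators on $\ell^2G$ (norm $\|T\|_2^2=\operatorname{Tr}(T^*T)$) with the action $g\cdot T=\lambda(g)T\lambda(g)^{-1}$. A 1-cochain $c$ is skew-adjoint if $c(g)^*=-c(g)$ for all $g\in G$. $(c_1,\dots,c_n)$ integrates to an analytic unitary Hilbert–Schmidt deformation of $\lambda$ if there are unitary representations $\lambda_t$ of $G$ on $\ell^2G$, for $t$ in an open neighbourhood of $0\in\mathbb R^n$, of the form $\lambda_t(g)=u_t(g)\lambda(g)$, $u_t(g)=1+\sum_{|\alpha|\ge1}c_\alpha(g)t^\alpha$ with $\alpha\in\mathbb N^n$ multi-indices, $c_\alpha(g)\in\mathrm{HS}(\ell^2G)$, the series converging absolutely in $\|\cdot\|_2$ for each $g$ on that neighbourhood,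 and with $c_{e_i}=c_i$ for $1\le i\le n$ ($e_i$ the standard basis multi-indices). *)

(* Defs.v *)
From HB Require Import structures.
From mathcomp Require Import all_boot all_order all_algebra finmap.
From mathcomp Require Import complex ring lra.
From mathcomp Require Import all_classical all_reals all_analysis.

Set Implicit Arguments.
Unset Strict Implicit.
Unset Printing Implicit Defensive.

Import Order.TTheory GRing.Theory Num.Theory.
Import numFieldNormedType.Exports.

Local Open Scope classical_set_scope.
Local Open Scope ring_scope.

Definition finitely_generated (G : groupType) : Prop :=
  exists s : seq G, forall H : {pred G},
    group_closed H -> {subset s <= H} -> forall g, g \in H.

(* [N] is meant to be a norm on [V]: the finite partial sums of [F] over [D]
   converge to [s] along the net of finite subsets of [D]. *)
Definition has_sum (R : realType) (I : choiceType) (V : zmodType) (N : V -> R)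
    (D : set I) (F : I -> V) (s : V) : Prop :=
  forall e : R, 0 < e -> exists2 A0, fsets D A0 &
    forall A, fsets D A -> A0 `<=` A -> N (s - \sum_(i \in A) F i) < e.

Definition normc2 (R : realType) (z : R[i]) : R := Normc.normc z ^+ 2.

Section esum_scale.
Variables (R : realType) (I : choiceType).
Local Open Scope ereal_scope.

Lemma le_esumZ (D : set I) (k : R) (f : I -> R) :
  (0 <= k)%R -> (forall i, 0 <= f i)%R ->
  \esum_(i in D) (k * f i)%:E <= k%:E * \esum_(i in D) (f i)%:E.
Proof.
move=> k0 f0; apply: ge_ereal_sup => _ [A AD <-].
under eq_fsbigr do rewrite EFinM.
rewrite -ge0_mule_fsumr; last by move=> i; rewrite lee_fin.
apply: lee_wpmul2l; first by rewrite lee_fin.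
by apply: ereal_sup_ubound; exists A.
Qed.

Lemma esum_comb_lty (D : set I) (k l : R) (f g h : I -> R) :
  (0 <= k)%R -> (0 <= l)%R -> (forall i, 0 <= f i)%R -> (forall i, 0 <= g i)%R ->
  (forall i, h i <= k * f i + l * g i)%R ->
  \esum_(i in D) (h i)%:E <=
  k%:E * (\esum_(i in D) (f i)%:E) + l%:E * (\esum_(i in D) (g i)%:E).
Proof.
move=> k0 l0 f0 g0 hfg.
apply: (@le_trans _ _ (\esum_(i in D) ((k * f i)%:E + (l * g i)%:E))).
  by apply: le_esum => i _; rewrite -EFinD lee_fin.
rewrite esumD; first by apply: leeD; apply: le_esumZ.
- by move=> i _; rewrite lee_fin mulr_ge0.
- by move=> i _; rewrite lee_fin mulr_ge0.
Qed.

End esum_scale.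

Section absolute_sums.
Variables (R : realType) (I : choiceType) (D : set I).

Lemma has_sum_ge0 (f : I -> R) : (forall i, 0 <= f i) ->
  (\esum_(i in D) (f i)%:E < +oo)%E ->
  has_sum (fun x : R => `|x|) D f (fine (\esum_(i in D) (f i)%:E)%E).
Proof.
move=> f0 foo e e0.
have s0 : (0 <= \esum_(i in D) (f i)%:E)%E.
  by apply: esum_ge0 => i _; rewrite lee_fin.
have sfin : (\esum_(i in D) (f i)%:E)%E \is a fin_num by rewrite ge0_fin_numE.
have sub A B : finite_set B -> A `<=` B ->
    \sum_(i \in A) f i <= \sum_(i \in B) f i.
  move=> Bfin AB; rewrite -lee_fin -!fsumEFin //; last exact: sub_finite_set AB _.
  by apply: lee_fsum_nneg_subset; rewrite ?inE //; [exact: sub_finite_set AB _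
    | move=> i; rewrite !inE; exact: AB | move=> i _; rewrite lee_fin].
have [_ [A0 DA0 <-] A0e] := ub_ereal_sup_adherent e0 sfin.
exists A0 => // A DA A0A.
have [Afin AD] := DA.
have leA : \sum_(i \in A) f i <= fine (\esum_(i in D) (f i)%:E)%E.
  rewrite -lee_fin fineK // -fsumEFin //.
  by apply: ereal_sup_ubound; exists A.
rewrite ger0_norm ?subr_ge0 // ltrBlDl -ltrBlDr.
apply: lt_le_trans (sub _ _ Afin A0A).
rewrite -lte_fin EFinB fineK //.
by move: A0e; rewrite fsumEFin //; case: DA0.
Qed.

Lemma has_sum_complex (z : I -> R[i]) :
  (\esum_(i in D) (Normc.normc (z i))%:E < +oo)%E ->
  exists s, has_sum (@Normc.normc R) D z s.
Proof.
move=> zoo.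
have dom (f : I -> R) : (forall i, 0 <= f i) ->
    (forall i, f i <= Normc.normc (z i)) -> (\esum_(i in D) (f i)%:E < +oo)%E.
  move=> f0 fz; apply: le_lt_trans zoo.
  by apply: le_esum => i _; rewrite lee_fin.
have nRe (w : R[i]) : `|complex.Re w| <= Normc.normc w.
  case: w => a b /=; rewrite -sqrtr_sqr ler_wsqrtr // lerDl; exact: sqr_ge0.
have nIm (w : R[i]) : `|complex.Im w| <= Normc.normc w.
  case: w => a b /=; rewrite -sqrtr_sqr ler_wsqrtr // lerDr; exact: sqr_ge0.
have real (f : I -> R) : (forall i, `|f i| <= Normc.normc (z i)) ->
    exists s, has_sum (fun x : R => `|x|) D f s.
  move=> fz.
  pose p i := (`|f i| + f i) / 2; pose m i := (`|f i| - f i) / 2.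
  have pm i : f i = p i - m i by rewrite /p /m; field.
  have [p0 m0] : (forall i, 0 <= p i) /\ (forall i, 0 <= m i).
    split=> i; rewrite divr_ge0 //.
      by have := ler_norm (- f i); rewrite normrN; lra.
    by rewrite subr_ge0 ler_norm.
  have ppm i : p i + m i = `|f i| by rewrite /p /m; field.
  have [pz mz] : (forall i, p i <= Normc.normc (z i)) /\
                 (forall i, m i <= Normc.normc (z i)).
    by split=> i; apply: le_trans (fz i); rewrite -ppm ?lerDl ?lerDr.
  have hp := has_sum_ge0 p0 (dom _ p0 pz).
  have hm := has_sum_ge0 m0 (dom _ m0 mz).
  set sp := fine _ in hp; set sm := fine _ in hm.
  exists (sp - sm) => e e0.
  have e20 : 0 < e / 2 by rewrite divr_gt0.
  have [A [Afin AD] hA] := hp _ e20; have [B [Bfin BD] hB] := hm _ e20.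
  exists (A `|` B); first by split; [rewrite finite_setU | rewrite subUset].
  move=> E [Efin ED]; rewrite subUset => -[AE BE].
  have {}hA := hA _ (conj Efin ED) AE; have {}hB := hB _ (conj Efin ED) BE.
  have -> : \sum_(i \in E) f i = \sum_(i \in E) p i - \sum_(i \in E) m i.
    by rewrite !fsbig_finite //= -sumrB; apply: eq_bigr.
  rewrite [X in `|X|](_ : _ = (sp - \sum_(i \in E) p i)
    - (sm - \sum_(i \in E) m i)); last by ring.
  by apply: le_lt_trans (ler_normB _ _) _; rewrite [e]splitr; exact: ltrD.
have [a ha] := real _ (fun i => nRe (z i)).
have [b hb] := real _ (fun i => nIm (z i)).
exists (a +i* b)%C => e e0.
have e20 : 0 < e / 2 by rewrite divr_gt0.
have [A [Afin AD] hA] := ha _ e20; have [B [Bfin BD] hB] := hb _ e20.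
exists (A `|` B); first by split; [rewrite finite_setU | rewrite subUset].
move=> E [Efin ED]; rewrite subUset => -[AE BE].
have {}hA := hA _ (conj Efin ED) AE; have {}hB := hB _ (conj Efin ED) BE.
have -> : (a +i* b)%C - \sum_(i \in E) z i =
    (a - \sum_(i \in E) complex.Re (z i))%:C%C +
    (0 +i* (b - \sum_(i \in E) complex.Im (z i)))%C.
  rewrite !fsbig_finite //= -!raddf_sum.
  case: (\sum_(_ <- _) _) => u v.
  by apply/eqP; rewrite eq_complex /= addr0 add0r !eqxx.
rewrite (le_lt_trans (le_normcD _ _)) // [e]splitr ltrD //=.
  by rewrite expr0n addr0 sqrtr_sqr.
by rewrite expr0n add0r sqrtr_sqr.
Qed.

End absolute_sums.

Section ell2.
Variables (R : realType) (G : groupType).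
Implicit Types f : G -> R[i].

Definition sqsum f : \bar R := (\esum_(g in [set: G]) (normc2 (f g))%:E)%E.

Lemma normc2_ge0 (z : R[i]) : 0 <= normc2 z.
Proof. exact: sqr_ge0. Qed.

Lemma sqsum_ge0 f : (0 <= sqsum f)%E.
Proof. by apply: esum_ge0 => g _; rewrite lee_fin normc2_ge0. Qed.

Lemma normc2_comb (a x y : R[i]) :
  normc2 (a * x + y) <= 2 * normc2 a * normc2 x + 2 * normc2 y.
Proof.
rewrite /normc2.
have h := le_normcD (a * x) y.
have h0 (z : R[i]) : 0 <= Normc.normc z by case: z => u v; exact: sqrtr_ge0.
rewrite -mulrA -exprMn -Normc.normcM.
set p := Normc.normc (a * x) in h *.
set q := Normc.normc y in h *.
apply: (@le_trans _ _ ((p + q) ^+ 2)).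
  by rewrite ler_sqr ?nnegrE ?addr_ge0 ?h0.
rewrite -mulrDr -subr_ge0.
have -> : 2 * (p ^+ 2 + q ^+ 2) - (p + q) ^+ 2 = (p - q) ^+ 2 by ring.
exact: sqr_ge0.
Qed.

Lemma sqsum_comb (a : R[i]) f f' : (sqsum (a *: f + f')%R <=
  (2 * normc2 a)%:E * sqsum f + 2%:E * sqsum f')%E.
Proof.
apply: esum_comb_lty => //.
- by rewrite mulr_ge0 // normc2_ge0.
- by move=> i; exact: normc2_ge0.
- by move=> i; exact: normc2_ge0.
- by move=> i; exact: normc2_comb.
Qed.

Definition square_summable : {pred G -> R[i]} := [pred f | (sqsum f < +oo)%E].

Lemma square_summable_submod : submod_closed square_summable.
Proof.
split.
  rewrite inE /sqsum esum1 // => g _.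
  by rewrite /normc2 Normc.normc0 expr0n.
move=> a f f'; rewrite !inE => hf hf'.
apply: (le_lt_trans (sqsum_comb a f f')).
apply: lte_add_pinfty; apply: lte_mul_pinfty => //.
by rewrite lee_fin mulr_ge0 // normc2_ge0.
Qed.

HB.instance Definition _ :=
  GRing.isSubmodClosed.Build _ _ square_summable square_summable_submod.

Record ell2 := Ell2 {
  ell2_val :> G -> R[i];
  ell2_valP : ell2_val \in square_summable }.

HB.instance Definition _ := [isSub for ell2_val].
HB.instance Definition _ := [Choice of ell2 by <:].
HB.instance Definition _ := [SubChoice_isSubLmodule of ell2 by <:].

Definition l2norm (x : ell2) : R := Num.sqrt (fine (sqsum x)).

Lemma sqsum_lty (x : ell2) : (sqsum x < +oo)%E.
Proof. by have := ell2_valP x; rewrite inE. Qed.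

Lemma l2norm_sqE (x : ell2) : (l2norm x ^+ 2)%:E = sqsum x.
Proof.
rewrite /l2norm sqr_sqrtr; last exact/fine_ge0/sqsum_ge0.
by rewrite fineK // ge0_fin_numE ?sqsum_lty // sqsum_ge0.
Qed.

Lemma l2norm_ge0 (x : ell2) : 0 <= l2norm x.
Proof. exact: sqrtr_ge0. Qed.

Lemma l2norm_comb (a : R[i]) (x y : ell2) : l2norm (a *: x + y) ^+ 2 <=
  2 * normc2 a * l2norm x ^+ 2 + 2 * l2norm y ^+ 2.
Proof.
rewrite -lee_fin l2norm_sqE; apply: (le_trans (sqsum_comb _ _ _)).
by rewrite -!l2norm_sqE -!EFinM -EFinD.
Qed.

Lemma delta_subproof (g : G) :
  (fun h => (h == g)%:R : R[i]) \in square_summable.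
Proof.
rewrite inE /= /sqsum.
have -> : (\esum_(h in [set: G]) (normc2 ((h == g)%:R : R[i]))%:E =
           \esum_(h in [set g]) (1 : R)%:E)%E.
  rewrite [RHS]esum_mkcond; apply: eq_esum => h _.
  have [->|/eqP hg] := eqVneq h g.
    by rewrite mem_set //= /normc2 [Normc.normc _]Normc.normc1 expr1n.
  by rewrite memNset //= /normc2 [Normc.normc _]Normc.normc0 expr0n.
by rewrite esum_set1 ?ltry // lee_fin.
Qed.

Definition delta (g : G) : ell2 := Ell2 (delta_subproof g).

Definition inner (x y : ell2) : R[i] :=
  xget 0 [set s | has_sum (@Normc.normc R) [set: G] (fun g => x g * (y g)^*)%C s].

Lemma has_sum_inner (x y : ell2) :
  has_sum (@Normc.normc R) [set: G] (fun g => x g * (y g)^*)%C (inner x y).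
Proof.
suff [s hs] : exists s,
    has_sum (@Normc.normc R) [set: G] (fun g => x g * (y g)^*)%C s.
  exact: (@xgetPex _ 0 _ (ex_intro _ s hs)).
apply: has_sum_complex.
apply: (@le_lt_trans _ _ (sqsum x + sqsum y)%E); last first.
  by rewrite lte_add_pinfty ?sqsum_lty.
rewrite -[sqsum x]mul1e -[sqsum y]mul1e.
apply: esum_comb_lty => // g; try exact: normc2_ge0.
rewrite !mul1r Normc.normcM /normc2.
have -> : Normc.normc (y g)^*%C = Normc.normc (y g).
  by case: (y g) => u v /=; rewrite sqrrN.
set p := Normc.normc _; set q := Normc.normc _.
have := sqr_ge0 p; have := sqr_ge0 q; have := sqr_ge0 (p - q).
rewrite sqrrB; lra.
Qed.

Definition bounded_op (T : ell2 -> ell2) : Prop :=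
  exists M : R, forall x, l2norm (T x) <= M * l2norm x.

(* [is_adjoint T S] reads T^* = S. *)
Definition is_adjoint (T S : ell2 -> ell2) : Prop :=
  forall x y, inner (T x) y = inner x (S y).

Definition unitary_op (U : ell2 -> ell2) : Prop :=
  [/\ linear U, bijective U & forall x y, inner (U x) (U y) = inner x y].

Definition unitary_rep (pi : G -> ell2 -> ell2) : Prop :=
  [/\ forall g, unitary_op (pi g), pi 1%g = id
    & forall g h, pi (g * h)%g = pi g \o pi h].

(* Tr (T^* T) computed in the orthonormal basis [delta]:
   the g-th diagonal entry of T^* T is the squared norm of T (delta g). *)
Definition hs_sqsum (T : ell2 -> ell2) : \bar R :=
  (\esum_(g in [set: G]) (l2norm (T (delta g)) ^+ 2)%:E)%E.

Definition hilbert_schmidt : {pred ell2 -> ell2} :=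
  [pred T | `[< [/\ linear T, bounded_op T & (hs_sqsum T < +oo)%E] >]].

Lemma hilbert_schmidt_submod : submod_closed hilbert_schmidt.
Proof.
have n0 : l2norm (0 : ell2) = 0.
  rewrite /l2norm /sqsum esum1 /= ?sqrtr0 // => g _.
  by rewrite /normc2 Normc.normc0 expr0n.
split.
  rewrite inE /=; split.
  - move=> a x y; have E z : (0 : ell2 -> ell2) z = 0 by [].
    by rewrite !E scaler0 addr0.
  - by exists 0 => x; rewrite n0 mul0r.
  - by rewrite /hs_sqsum esum1 // => g _; rewrite n0 expr0n.
move=> a T S; rewrite !inE /= => -[Tl [M TM] Th] [Sl [N SN] Sh].
have a0 : 0 <= 2 * normc2 a by rewrite mulr_ge0 // normc2_ge0.
have E z : (a *: T + S) z = a *: T z + S z by [].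
split.
- move=> b x y; rewrite !E Tl Sl !scalerDr !scalerA [a * b]mulrC.
  by rewrite addrACA.
- pose K := 2 * normc2 a * M ^+ 2 + 2 * N ^+ 2.
  have K0 : 0 <= K by rewrite addr_ge0 // mulr_ge0 // sqr_ge0.
  exists (Num.sqrt K) => x.
  rewrite -ler_sqr ?nnegrE ?mulr_ge0 ?sqrtr_ge0 ?l2norm_ge0 //.
  rewrite exprMn [X in _ <= X * _]sqr_sqrtr // E.
  apply: (le_trans (l2norm_comb a (T x) (S x))).
  rewrite /K [leRHS]mulrDl -[_ * M ^+ 2 * _]mulrA
    -[_ * N ^+ 2 * _]mulrA -[M ^+ 2 * _]exprMn -[N ^+ 2 * _]exprMn.
  apply: lerD; apply: ler_wpM2l => //.
  + by rewrite ler_sqr ?nnegrE ?l2norm_ge0 // (le_trans (l2norm_ge0 _) (TM x)).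
  + by rewrite ler_sqr ?nnegrE ?l2norm_ge0 // (le_trans (l2norm_ge0 _) (SN x)).
- apply: le_lt_trans.
    apply: (@esum_comb_lty _ _ _ (2 * normc2 a) 2
      (fun g => l2norm (T (delta g)) ^+ 2)
      (fun g => l2norm (S (delta g)) ^+ 2)) => //.
    + by move=> g; exact: sqr_ge0.
    + by move=> g; exact: sqr_ge0.
    + by move=> g; exact: l2norm_comb.
  by apply: lte_add_pinfty; apply: lte_mul_pinfty.
Qed.

HB.instance Definition _ :=
  GRing.isSubmodClosed.Build _ _ hilbert_schmidt hilbert_schmidt_submod.

Record HS := MkHS {
  HS_val :> ell2 -> ell2;
  HS_valP : HS_val \in hilbert_schmidt }.

HB.instance Definition _ := [isSub for HS_val].
HB.instance Definition _ := [Choice of HS by <:].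
HB.instance Definition _ := [SubChoice_isSubLmodule of HS by <:].

Definition hsnorm (T : HS) : R := Num.sqrt (fine (hs_sqsum T)).

Lemma sqsum_translate f (g : G) : sqsum (fun h => f (g * h)%g) = sqsum f.
Proof.
rewrite /sqsum [RHS](@reindex_esum _ _ _ [set: G] [set: G]
  (fun h => g * h)%g) //.
by rewrite setTT_bijective; exists (fun h => g^-1 * h)%g => h;
  rewrite ?mulKg ?mulVKg.
Qed.

Lemma lambda_subproof (g : G) (x : ell2) :
  (fun h => x (g^-1 * h)%g) \in square_summable.
Proof. by rewrite inE /= sqsum_translate sqsum_lty. Qed.

Definition lambda (g : G) (x : ell2) : ell2 := Ell2 (lambda_subproof g x).

Lemma ell2P (x y : ell2) : (forall h, x h = y h) -> x = y.
Proof. by move=> xy; apply/val_inj/funext. Qed.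

Lemma HSP (S T : HS) : (forall x, S x = T x) -> S = T.
Proof. by move=> ST; apply/val_inj/funext. Qed.

Lemma lambda_linear (g : G) : linear (lambda g).
Proof. by move=> a x y; apply: ell2P. Qed.

Lemma l2norm_lambda (g : G) (x : ell2) : l2norm (lambda g x) = l2norm x.
Proof. by rewrite /l2norm sqsum_translate. Qed.

Lemma lambda1 (x : ell2) : lambda 1%g x = x.
Proof. by apply: ell2P => h /=; rewrite invg1 mul1g. Qed.

Lemma lambdaM (g h : G) (x : ell2) :
  lambda (g * h)%g x = lambda g (lambda h x).
Proof. by apply: ell2P => k /=; rewrite invgM mulgA. Qed.

Lemma lambda_delta (g h : G) : lambda g (delta h) = delta (g * h)%g.
Proof.
by apply: ell2P => k /=; rewrite -(inj_eq (mulgI g)) mulVKg.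
Qed.

Lemma ad_lambda_subproof (g : G) (T : HS) :
  lambda g \o T \o lambda g^-1%g \in hilbert_schmidt.
Proof.
have := HS_valP T; rewrite !inE /= => -[Tl [M TM] Th].
split.
- by move=> a x y; rewrite /= lambda_linear Tl lambda_linear.
- by exists M => x; rewrite /= l2norm_lambda -(l2norm_lambda g^-1%g x).
- apply: le_lt_trans Th; rewrite le_eqVlt; apply/orP; left; apply/eqP.
  rewrite /hs_sqsum [RHS](@reindex_esum _ _ _ [set: G] [set: G]
    (fun h => g^-1 * h)%g).
    by apply: eq_esum => h _; rewrite /= l2norm_lambda lambda_delta.
  by rewrite setTT_bijective; exists (fun h => g * h)%g => h;
    rewrite ?mulKg ?mulVKg.
Qed.

Definition ad_lambda (g : G) (T : HS) : HS := MkHS (ad_lambda_subproof g T).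

End ell2.

Arguments delta {R G} g.
Arguments lambda {R G} g x.

Record gmodule (G : groupType) := GModule {
  gmodule_sort :> zmodType;
  gact : G -> gmodule_sort -> gmodule_sort;
  gactD : forall g, {morph gact g : x y / x + y};
  gact1 : forall x, gact 1%g x = x;
  gactM : forall g h x, gact (g * h)%g x = gact g (gact h x) }.

Section gmodules.
Variables (R : realType) (G : groupType).

Lemma lambdaD (g : G) : {morph (@lambda R G g) : x y / x + y}.
Proof. by move=> x y; apply: ell2P. Qed.

Definition ell2_lambda : gmodule G :=
  GModule lambdaD (@lambda1 R G) (@lambdaM R G).

Lemma ad_lambdaD (g : G) : {morph (@ad_lambda R G g) : S T / S + T}.
Proof. by move=> S T; apply: HSP => x; exact: lambdaD. Qed.

Lemma ad_lambda1 (T : HS R G) : ad_lambda 1%g T = T.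
Proof. by apply: HSP => x /=; rewrite invg1 !lambda1. Qed.

Lemma ad_lambdaM (g h : G) (T : HS R G) :
  ad_lambda (g * h)%g T = ad_lambda g (ad_lambda h T).
Proof. by apply: HSP => x /=; rewrite invgM !lambdaM. Qed.

Definition HS_Ad_lambda : gmodule G :=
  GModule ad_lambdaD ad_lambda1 ad_lambdaM.

End gmodules.

Section cohomology.
Variables (G : groupType) (V : gmodule G).

Definition cochain (k : nat) : Type := k.-tuple G -> V.

(* (g_0, ..., g_k) |-> (g_0, ..., g_i * g_(i+1), ..., g_k) *)
Definition merge k (i : 'I_k) (gs : k.+1.-tuple G) : k.-tuple G :=
  [tuple let gj := tnth gs (widen_ord (leqnSn k) j) in
         let gj1 := tnth gs (lift ord0 j) in
         if (j < i)%N then gj else if j == i then (gj * gj1)%g else gj1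
  | j < k].

Definition drop_last k (gs : k.+1.-tuple G) : k.-tuple G :=
  [tuple tnth gs (widen_ord (leqnSn k) j) | j < k].

Definition diff k (f : cochain k) : cochain k.+1 := fun gs =>
  gact (thead gs) (f (behead_tuple gs))
  + \sum_(i < k) f (merge i gs) *~ (-1) ^+ i.+1
  + f (drop_last gs) *~ (-1) ^+ k.+1.

Definition cocycles k : set (cochain k) := [set f | diff f = 0].

Definition coboundaries k : set (cochain k) :=
  match k return set (cochain k) with
  | 0 => [set 0]
  | k'.+1 => range (@diff k')
  end.

(* H^k as the set of cosets c + B^k with c in Z^k; B^k is its zero element *)
Definition cohomology k : set (set (cochain k)) :=
  [set [set c + b | b in @coboundaries k] | c in @cocycles k].

Definition cohomology_zero k : Prop := @cohomology k = [set @coboundaries k].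

End cohomology.

Arguments cocycles {G} V k _.
Arguments coboundaries {G} V k _.
Arguments cohomology {G} V k _.

Section deformation.
Variables (R : realType) (G : groupType) (n : nat).

Definition multi_index := {ffun 'I_n -> nat}.

Definition mdeg (a : multi_index) : nat := (\sum_(i < n) a i)%N.

Definition munit (i : 'I_n) : multi_index := [ffun j => (j == i : nat)].

Definition mpow (t : 'rV[R]_n) (a : multi_index) : R :=
  \prod_(i < n) t ord0 i ^+ a i.

Definition skew_adjoint (c : cochain (HS_Ad_lambda R G) 1) : Prop :=
  forall g, is_adjoint (c [tuple g] : HS R G) (- c [tuple g] : HS R G).

(* The coefficient [ca] at the zero multi-index is not used. *)
Definition integrates (c : 'I_n -> cochain (HS_Ad_lambda R G) 1) : Prop :=
  exists (U : set 'rV[R]_n) (ca : multi_index -> G -> HS R G)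
         (lambda_ : 'rV[R]_n -> G -> ell2 R G -> ell2 R G),
    let D := [set a : multi_index | (0 < mdeg a)%N] in
    [/\ open U, U 0,
        forall t, U t -> unitary_rep (lambda_ t),
        forall t g, U t ->
          (\esum_(a in D) (hsnorm (ca a g) * `|mpow t a|)%:E < +oo)%E /\
          exists2 S : HS R G,
            has_sum (@hsnorm R G) D (fun a => (mpow t a)%:C%C *: ca a g) S
            & forall x, lambda_ t g x = lambda g x + S (lambda g x)
      & forall i g, ca (munit i) g = c i [tuple g]].

End deformation.

(* Main.v *)
(* Order by order in [t], write [u_t(g) = 1 + sum_a x_a(g) t^a].  If multiplicativity
   and unitarity hold below degree [k], then [x_a := - w_a / 2], where [w_a] is the
   defect of unitarity, restores unitarity in degree [k], and the remaining defect of
   multiplicativity is a skew-adjoint 2-cocycle with values in the Hilbert-Schmidt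
   operators; the skew part of a primitive of it corrects [x_a].
   The Hilbert-Schmidt operators are an l2-direct sum of copies of l2(G), so primitives
   exist provided those in l2(G) are bounded uniformly: an open mapping argument gives,
   on a finite ball [F] of [G], |b|_F <= C |z|_F.  Since a 2-cocycle in degree [a] is
   quadratic in lower degrees, |x_a|_F is then dominated by a sequence [M_a] with
   [M * M <= eta M], hence by a convergent power series; multiplicativity propagates
   absolute convergence from [F] to all of [G], on the same neighbourhood of 0. *)
From mathcomp Require Import all_boot all_order all_algebra finmap.
From mathcomp Require Import complex ring lra.
From mathcomp Require Import all_classical all_reals all_analysis.
Require Import Defs.

Set Implicit Arguments.
Unset Strict Implicit.
Unset Printing Implicit Defensive.

Import Order.TTheory GRing.Theory Num.Theory.
Import numFieldNormedType.Exports.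

Local Open Scope classical_set_scope.
Local Open Scope ring_scope.

(** * Unconditional sums *)

Section has_sum_theory.
Variable R : realType.

(** Vanishing of H^2 by itself yields, in each degree and on each diagonal of the Hilbert-Schmidt
    matrices, some primitive of unknown size. Size matters twice: the primitives on the diagonals
    must be square-summable to form an operator, and the resulting series must converge. The
    2-cocycles carry only the topology of pointwise convergence on G x G, so an open mapping
    argument can compare finitely many values of a primitive with finitely many values of the
    cocycle, and nothing better. All estimates are therefore kept on one word ball, chosen so that
    the bound for the primitive on it reads the cocycle only at pairs g, h for which g, h and g h
    lie in it; otherwise the induction on the degree would need ever larger balls. The order of the
    two corrections is forced: the defect of multiplicativity in degree k is skew only once
    unitarity holds in degree k itself, and the later correction, being skew, leaves unitarity
    intact. *)

Record is_norm (V : zmodType) (N : V -> R) : Prop := IsNorm {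
  is_norm0 : N 0 = 0;
  is_normN : forall x, N (- x) = N x;
  is_normD : forall x y, N (x + y) <= N x + N y;
  is_norm_eq0 : forall x, N x = 0 -> x = 0 }.

Definition norm_complete (V : zmodType) (N : V -> R) : Prop :=
  forall x : nat -> V,
    (forall e, 0 < e -> exists n0, forall k l, (n0 <= k)%N -> (n0 <= l)%N ->
       N (x k - x l) < e) ->
    exists s, forall e, 0 < e -> exists n0, forall k, (n0 <= k)%N -> N (s - x k) < e.

Section one_norm.
Variables (V : zmodType) (N : V -> R).
Hypothesis Nn : is_norm N.

Lemma is_norm_ge0 x : 0 <= N x.
Proof.
have := is_normD Nn x (- x).
by rewrite subrr (is_norm0 Nn) (is_normN Nn) -mulr2n pmulrn_lge0.
Qed.

Lemma is_normB x y : N (x - y) <= N x + N y.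
Proof. by rewrite -(is_normN Nn y); exact: is_normD. Qed.

Lemma is_norm_distC x y : N (x - y) = N (y - x).
Proof. by rewrite -(is_normN Nn) opprB. Qed.

Lemma is_norm_sub_le x y z : N (x - z) <= N (x - y) + N (y - z).
Proof. by rewrite -[x - z](subrKA y); exact: is_normD. Qed.

Lemma is_norm_small x : (forall e, 0 < e -> N x < e) -> x = 0.
Proof.
move=> h; apply: (is_norm_eq0 Nn); apply/eqP.
rewrite eq_le is_norm_ge0 andbT leNgt; apply/negP => /h.
by rewrite ltxx.
Qed.

Lemma is_norm_sum (I : Type) (r : seq I) (P : pred I) (F : I -> V) :
  N (\sum_(i <- r | P i) F i) <= \sum_(i <- r | P i) N (F i).
Proof.
elim/big_ind2: _ => [|x a y b xa yb|//]; first by rewrite (is_norm0 Nn).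
by apply: le_trans (is_normD Nn _ _) _; exact: lerD.
Qed.

Lemma is_norm_fsum (I : choiceType) (A : set I) (F : I -> V) : finite_set A ->
  N (\sum_(i \in A) F i) <= \sum_(i \in A) N (F i).
Proof. by move=> fA; rewrite !fsbig_finite//; exact: is_norm_sum. Qed.

Section sums.
Variables (I : choiceType) (D : set I).
Implicit Types F : I -> V.

Lemma has_sum_eq F F' s : (forall i, D i -> F i = F' i) ->
  has_sum N D F s -> has_sum N D F' s.
Proof.
move=> FF' h e /h[A0 DA0 hA0]; exists A0 => // A [fA AD] A0A.
rewrite -(@eq_fsbigr _ _ _ _ F) ?hA0//.
by move=> i; rewrite inE => /AD; exact: FF'.
Qed.

Lemma has_sum_uniq F s s' : has_sum N D F s -> has_sum N D F s' -> s = s'.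
Proof.
move=> h h'; apply/subr0_eq/is_norm_small => e e0.
have e20 : 0 < e / 2 by rewrite divr_gt0.
have [A [fA AD] hA] := h _ e20; have [B [fB BD] hB] := h' _ e20.
have DAB : fsets D (A `|` B) by split; [rewrite finite_setU | rewrite subUset].
apply: le_lt_trans (is_norm_sub_le _ (\sum_(i \in A `|` B) F i) _) _.
rewrite [e]splitr ltrD//; first exact: hA.
by rewrite is_norm_distC; apply: hB.
Qed.

Lemma has_sumD F F' s s' : has_sum N D F s -> has_sum N D F' s' ->
  has_sum N D (fun i => F i + F' i) (s + s').
Proof.
move=> h h' e e0.
have e20 : 0 < e / 2 by rewrite divr_gt0.
have [A [fA AD] hA] := h _ e20; have [B [fB BD] hB] := h' _ e20.
exists (A `|` B); first by split; [rewrite finite_setU | rewrite subUset].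
move=> E [fE ED]; rewrite subUset => -[AE BE].
rewrite fsbig_finite//= big_split/= -!fsbig_finite// opprD addrACA.
apply: le_lt_trans (is_normD Nn _ _) _.
by rewrite [e]splitr ltrD//; [apply: hA | apply: hB].
Qed.

Lemma has_sum_le F s B : has_sum N D F s ->
  (forall A, fsets D A -> \sum_(i \in A) N (F i) <= B) -> N s <= B.
Proof.
move=> h hB; apply/ler_addgt0Pr => e /h[A DA hA].
have {}hA := hA _ DA (@subset_refl _ _).
rewrite -[s](subrK (\sum_(i \in A) F i)).
apply: le_trans (is_normD Nn _ _) _; rewrite addrC lerD//; last exact: ltW.
apply: le_trans (hB _ DA); apply: is_norm_fsum; exact: DA.1.
Qed.

End sums.
End one_norm.

Lemma has_sum_map (V V' : zmodType) (N : V -> R) (N' : V' -> R)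
    (I : choiceType) (D : set I) (F : I -> V) (s : V) (L : V -> V') (M : R) :
  is_norm N -> L 0 = 0 -> (forall x y, L (x + y) = L x + L y) ->
  (forall x, N' (L x) <= M * N x) ->
  has_sum N D F s -> has_sum N' D (fun i => L (F i)) (L s).
Proof.
move=> Nn L0 LD LM h e e0.
(* [M] need not be positive; the maximum with 1 makes the tolerance [e / K] positive. *)
pose K := Num.max M 1.
have K0 : 0 < K by rewrite lt_max ltr01 orbT.
have [|A DA hA] := h (e / K); first by rewrite divr_gt0.
exists A => // B DB AB; have {}hA := hA _ DB AB.
have LN x : L (- x) = - L x.
  by apply/eqP; rewrite -subr_eq0 opprK -LD addNr L0.
have -> : L s - \sum_(i \in B) L (F i) = L (s - \sum_(i \in B) F i).
  rewrite LD LN !fsbig_finite//=; try exact: DB.1.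
  by rewrite (big_morph L LD L0).
apply: le_lt_trans (LM _) _.
apply: (@le_lt_trans _ _ (K * N (s - \sum_(i \in B) F i))).
  by rewrite ler_wpM2r ?is_norm_ge0// le_max lexx.
by rewrite mulrC -ltr_pdivlMr.
Qed.

Section real_sums.
Variables (I : choiceType) (D : set I).
Implicit Types f : I -> R.

Lemma esum_le_bound f (B : R) :
  (forall A, fsets D A -> \sum_(i \in A) f i <= B) ->
  (\esum_(i in D) (f i)%:E <= B%:E)%E.
Proof.
move=> h; apply: ge_ereal_sup => _ [A DA <-].
by rewrite fsumEFin ?lee_fin ?h//; exact: DA.1.
Qed.

Lemma esum_bound_lty f (B : R) :
  (forall A, fsets D A -> \sum_(i \in A) f i <= B) ->
  (\esum_(i in D) (f i)%:E < +oo)%E.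
Proof. by move=> /esum_le_bound/le_lt_trans; apply; rewrite ltry. Qed.

Lemma fsum_le_esum f (A : set I) : fsets D A ->
  ((\sum_(i \in A) f i)%:E <= \esum_(i in D) (f i)%:E)%E.
Proof.
move=> DA; rewrite -fsumEFin; last exact: DA.1.
by apply: ereal_sup_ubound; exists A.
Qed.

Lemma ler_fsum_subset f (A B : set I) : (forall i, 0 <= f i) -> finite_set B ->
  A `<=` B -> \sum_(i \in A) f i <= \sum_(i \in B) f i.
Proof.
move=> f0 fB AB; have fA := sub_finite_set AB fB.
rewrite -lee_fin -!fsumEFin//; apply: lee_fsum_nneg_subset => //.
- by move=> i; rewrite !inE; exact: AB.
- by move=> i _; rewrite lee_fin.
Qed.

(** Some finite [A0] already captures the total up to e/2, and adjoining a disjoint [A] cannot leave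
    that margin. *)
Lemma esum_tail f e : (forall i, 0 <= f i) ->
  (\esum_(i in D) (f i)%:E < +oo)%E -> 0 < e ->
  exists2 A0, fsets D A0 &
    forall A, fsets D A -> A `&` A0 = set0 -> \sum_(i \in A) f i < e.
Proof.
move=> f0 foo e0.
have e20 : 0 < e / 2 by rewrite divr_gt0.
have [A0 DA0 hA0] := has_sum_ge0 f0 foo e20.
exists A0 => // A DA AA0.
have h0 := hA0 _ DA0 (@subset_refl _ _).
have DU : fsets D (A `|` A0).
  split; first by rewrite finite_setU; split; [exact: DA.1|exact: DA0.1].
  by rewrite subUset; split; [exact: DA.2|exact: DA0.2].
have := hA0 _ DU (@subsetUr _ _ _).
rewrite fsbigU0 ?AA0//=; [|exact: DA.1|exact: DA0.1].
set s := fine _ in h0 *; set a := \sum_(i \in A) f i; set b := \sum_(i \in A0) f i.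
move: h0; rewrite -/b !ltr_norml => /andP[h1 h2] /andP[h3 h4].
lra.
Qed.

End real_sums.

(** Completeness is available for sequences only, so the net of finite sets is replaced by an
    increasing sequence of finite sets [U n], outside which the norms have small sum. *)
Lemma has_sum_exists (V : zmodType) (N : V -> R) (I : choiceType) (D : set I)
    (F : I -> V) : is_norm N -> norm_complete N ->
  (\esum_(i in D) (N (F i))%:E < +oo)%E -> exists s, has_sum N D F s.
Proof.
move=> Nn Nc Foo.
have N0 i : 0 <= N (F i) by exact: is_norm_ge0.
have /choice[A hA] : forall n : nat, exists A0, fsets D A0 /\
    forall A, fsets D A -> A `&` A0 = set0 -> \sum_(i \in A) N (F i) < n.+1%:R^-1.
  move=> n; have [|A0 DA0 h] := @esum_tail _ _ _ n.+1%:R^-1 N0 Foo; last by exists A0.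
  by rewrite invr_gt0 ltr0n.
have tail n B : fsets D B -> A n `<=` B ->
    N (\sum_(i \in B) F i - \sum_(i \in A n) F i) < n.+1%:R^-1.
  move=> DB AB; have [[fA AD] h] := hA n.
  have fBA : finite_set (B `\` A n) by apply: finite_setD; exact: DB.1.
  have -> : \sum_(i \in B) F i - \sum_(i \in A n) F i = \sum_(i \in B `\` A n) F i.
    rewrite [X in X - _](fsbigID (A n)); last exact: DB.1.
    rewrite [X in X + _ - _](_ : _ = \sum_(i \in A n) F i).
      by rewrite addrAC subrr add0r.
    by congr (\sum_(i \in _) _); apply/setIidr.
  apply: le_lt_trans (is_norm_fsum Nn _ fBA) _; apply: h.
    by split => // i [Bi _]; exact: DB.2.
  by apply/seteqP; split => // i [[_ ?]].
have small (e : R) : 0 < e -> exists n, n.+1%:R^-1 < e.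
  move=> e0; exists (Num.truncn e^-1).
  by rewrite invf_plt ?posrE// truncnS_gt.
(* The sets [A n] need not be nested; their unions are, and [U k] contains [A n] as soon as n <=
   k. *)
pose U n := \big[setU/set0]_(k < n.+1) A k.
have DU n : fsets D (U n).
  rewrite /U; elim/big_ind: _ => //; first exact: fsets_set0.
    move=> X Y [fX XD] [fY YD]; split; first by rewrite finite_setU.
    by rewrite subUset.
  by move=> i _; exact: (hA i).1.
have hU n k : (n <= k)%N ->
    N (\sum_(i \in U k) F i - \sum_(i \in A n) F i) < n.+1%:R^-1.
  move=> nk; apply: tail => //.
  by rewrite /U -(bigcup_mkord k.+1 A) => x; exists n.
have [|s hs] := Nc (fun n => \sum_(i \in U n) F i).
  move=> e e0; have [n hn] := small (e / 2) ltac:(by rewrite divr_gt0).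
  exists n => k l nk nl.
  apply: le_lt_trans (is_norm_sub_le Nn _ (\sum_(i \in A n) F i) _) _.
  rewrite [e]splitr ltrD ?(lt_trans (hU _ _ _) hn)//.
  by rewrite (is_norm_distC Nn) (lt_trans (hU _ _ _) hn).
exists s => e e0.
have e30 : 0 < e / 3 by rewrite divr_gt0.
have [n hn] := small _ e30.
have [n0 hn0] := hs _ e30.
exists (A n); first exact: (hA n).1.
move=> B DB AB; pose k := maxn n n0.
have h1 := hn0 k (leq_maxr _ _).
have h2 := lt_trans (hU n k (leq_maxl _ _)) hn.
have h3 := lt_trans (tail n B DB AB) hn; rewrite (is_norm_distC Nn) in h3.
have h4 := is_norm_sub_le Nn s (\sum_(i \in U k) F i) (\sum_(i \in B) F i).
have h5 := is_norm_sub_le Nn (\sum_(i \in U k) F i) (\sum_(i \in A n) F i)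
  (\sum_(i \in B) F i).
move: h1 h2 h3 h4 h5.
set a := N _; set b := N _; set c := N _; set d := N _; set f := N _.
by move=> *; lra.
Qed.

End has_sum_theory.

(** * The Hilbert space l2(G) *)

Section complex_norm.
Variable R : realType.

Lemma normc_ge0 (z : R[i]) : 0 <= Normc.normc z.
Proof. by case: z => a b; exact: sqrtr_ge0. Qed.

Lemma normc_is_norm : is_norm (@Normc.normc R).
Proof.
split; [exact: Normc.normc0|exact: normcN|exact: le_normcD|exact: Normc.eq0_normc].
Qed.

Lemma normc_conj (z : R[i]) : Normc.normc (z^*)%C = Normc.normc z.
Proof. by case: z => u v /=; rewrite sqrrN. Qed.

Lemma normc_real (a : R) : Normc.normc a%:C%C = `|a|.
Proof. by rewrite /= expr0n addr0 sqrtr_sqr. Qed.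

Lemma normRe_le (w : R[i]) : `|complex.Re w| <= Normc.normc w.
Proof. by case: w => a b /=; rewrite -sqrtr_sqr ler_wsqrtr // lerDl; exact: sqr_ge0. Qed.

Lemma normIm_le (w : R[i]) : `|complex.Im w| <= Normc.normc w.
Proof. by case: w => a b /=; rewrite -sqrtr_sqr ler_wsqrtr // lerDr; exact: sqr_ge0. Qed.

Lemma normc_le_ReIm (w : R[i]) :
  Normc.normc w <= `|complex.Re w| + `|complex.Im w|.
Proof.
case: w => a b /=; rewrite -[leRHS]ger0_norm ?addr_ge0// -sqrtr_sqr ler_wsqrtr//.
by rewrite sqrrD !real_normK ?num_real// [_ + _ + b ^+ 2]addrAC lerDl mulrn_wge0// mulr_ge0.
Qed.

Lemma real_complete : norm_complete (fun x : R => `|x|).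
Proof.
move=> x xC.
have cx : cvg (x @ \oo).
  apply/cauchy_cvgP/cauchy_exP => e e0.
  have [n0 hn0] := xC _ e0.
  exists (x n0); exists n0 => // k nk; exact: hn0.
exists (lim (x @ \oo)) => e e0.
have /cvgrPdist_lt/(_ _ e0)[n0 _ hn0] := cx.
by exists n0 => k nk; exact: hn0.
Qed.

Lemma normc_complete : norm_complete (@Normc.normc R).
Proof.
move=> z zC.
have [|a ha] := @real_complete (fun n => complex.Re (z n)).
  move=> e /zC[n0 h]; exists n0 => k l nk nl.
  by rewrite -raddfB; apply: le_lt_trans (normRe_le _) (h _ _ nk nl).
have [|b hb] := @real_complete (fun n => complex.Im (z n)).
  move=> e /zC[n0 h]; exists n0 => k l nk nl.
  by rewrite -raddfB; apply: le_lt_trans (normIm_le _) (h _ _ nk nl).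
exists (a +i* b)%C => e e0.
have e20 : 0 < e / 2 by rewrite divr_gt0.
have [n hn] := ha _ e20; have [m hm] := hb _ e20.
exists (maxn n m) => k; rewrite geq_max => /andP[nk mk].
apply: le_lt_trans (normc_le_ReIm _) _; rewrite [e]splitr.
by case: (z k) (hn _ nk) (hm _ mk) => c d /= h1 h2; rewrite ltrD.
Qed.

End complex_norm.

(** * Norm, completeness and basis expansion in l2(G) *)

Section ell2_norm.
Variable R : realType.

Lemma ler_sq (a b : R) : 0 <= a -> a <= b -> a ^+ 2 <= b ^+ 2.
Proof. by move=> a0 ab; rewrite ler_sqr// nnegrE// (le_trans a0). Qed.

(** Summing (b f_i - a g_i)^2 >= 0 gives the claim multiplied by 2ab. The cases a = 0 and b = 0 are
    separate because this factor then says nothing. *)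
Lemma sum_CS (I : choiceType) (s : seq I) (f g : I -> R) (a b : R) :
  0 <= a -> 0 <= b ->
  \sum_(i <- s) f i ^+ 2 <= a ^+ 2 -> \sum_(i <- s) g i ^+ 2 <= b ^+ 2 ->
  \sum_(i <- s) f i * g i <= a * b.
Proof.
move=> a0 b0 sf sg.
have [a00|an0] := eqVneq a 0.
  rewrite a00 expr0n /= in sf; rewrite a00 mul0r.
  have : \sum_(i <- s) f i ^+ 2 == 0.
    by rewrite eq_le sf sumr_ge0// => i _; exact: sqr_ge0.
  rewrite psumr_eq0; last by move=> i _; exact: sqr_ge0.
  move=> /allP fz; rewrite big_seq big1// => i /fz /=.
  by rewrite sqrf_eq0 => /eqP ->; rewrite mul0r.
have [b00|bn0] := eqVneq b 0.
  rewrite b00 expr0n /= in sg; rewrite b00 mulr0.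
  have : \sum_(i <- s) g i ^+ 2 == 0.
    by rewrite eq_le sg sumr_ge0// => i _; exact: sqr_ge0.
  rewrite psumr_eq0; last by move=> i _; exact: sqr_ge0.
  move=> /allP fz; rewrite big_seq big1// => i /fz /=.
  by rewrite sqrf_eq0 => /eqP ->; rewrite mulr0.
have ap : 0 < a by rewrite lt_def an0.
have bp : 0 < b by rewrite lt_def bn0.
rewrite -(ler_pM2l (_ : 0 < 2 * (a * b))); last by rewrite !mulr_gt0.
rewrite mulr_sumr.
apply: (@le_trans _ _ (\sum_(i <- s) (b ^+ 2 * f i ^+ 2 + a ^+ 2 * g i ^+ 2))).
  apply: ler_sum => i _; rewrite -subr_ge0.
  rewrite [X in 0 <= X](_ : _ = (b * f i - a * g i) ^+ 2); last by ring.
  exact: sqr_ge0.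
rewrite big_split/= -!mulr_sumr.
apply: (@le_trans _ _ (b ^+ 2 * a ^+ 2 + a ^+ 2 * b ^+ 2)).
  by rewrite lerD// ler_wpM2l// sqr_ge0.
by rewrite le_eqVlt; apply/orP; left; apply/eqP; ring.
Qed.

(** Phrased with bounds on finite partial sums, so that it applies before [h] is known to be
    square-summable; completeness and the assembly of operators from their diagonals use it in this
    way. *)
Lemma l2_minkowski (I : choiceType) (D : set I) (f g h : I -> R) (a b : R) :
  0 <= a -> 0 <= b -> (forall i, 0 <= f i) -> (forall i, 0 <= g i) ->
  (forall i, 0 <= h i) -> (forall i, h i <= f i + g i) ->
  (forall A, fsets D A -> \sum_(i \in A) f i ^+ 2 <= a ^+ 2) ->
  (forall A, fsets D A -> \sum_(i \in A) g i ^+ 2 <= b ^+ 2) ->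
  forall A, fsets D A -> \sum_(i \in A) h i ^+ 2 <= (a + b) ^+ 2.
Proof.
move=> a0 b0 f0 g0 h0 hfg fa gb A DA; have fA := DA.1.
have {fa} := fa _ DA; have {gb} := gb _ DA.
rewrite !fsbig_finite//; move: (fset_set A : seq I) => s sg sf.
have hsq i : h i ^+ 2 <= (f i + g i) ^+ 2 by rewrite ler_sqr ?nnegrE ?addr_ge0.
apply: (le_trans (ler_sum _ (fun i _ => hsq i))).
under eq_bigr do rewrite sqrrD.
have CS := sum_CS a0 b0 sf sg.
by rewrite !big_split/= sqrrD !lerD// -sumrMnl.
Qed.

Variable G : groupType.
Implicit Types x y : ell2 R G.

Lemma l2norm_le x (B : R) : 0 <= B ->
  (forall A, finite_set A -> \sum_(g \in A) normc2 (x g) <= B ^+ 2) ->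
  l2norm x <= B.
Proof.
move=> B0 h; rewrite -ler_sqr ?nnegrE ?l2norm_ge0//.
rewrite -lee_fin l2norm_sqE; apply: esum_le_bound => A [fA _]; exact: h.
Qed.

Lemma l2norm_fsum x A : finite_set A ->
  \sum_(g \in A) normc2 (x g) <= l2norm x ^+ 2.
Proof. by move=> fA; rewrite -lee_fin l2norm_sqE; apply: fsum_le_esum. Qed.

Lemma l2norm_coord x g : Normc.normc (x g) <= l2norm x.
Proof.
rewrite -ler_sqr ?nnegrE ?normc_ge0 ?l2norm_ge0//.
by have := l2norm_fsum x (finite_set1 g); rewrite fsbig_set1.
Qed.

Lemma l2norm_triangle x y : l2norm (x + y) <= l2norm x + l2norm y.
Proof.
apply: l2norm_le => [|A fA]; first by rewrite addr_ge0 ?l2norm_ge0.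
apply: (@l2_minkowski _ setT (fun g => Normc.normc (x g)) (fun g => Normc.normc (y g))
   (fun g => Normc.normc ((x + y) g))) => //; rewrite ?l2norm_ge0//.
- by move=> g; exact: normc_ge0.
- by move=> g; exact: normc_ge0.
- by move=> g; exact: normc_ge0.
- by move=> g; exact: le_normcD.
- by move=> E [fE _]; exact: l2norm_fsum.
- by move=> E [fE _]; exact: l2norm_fsum.
Qed.

Lemma l2normZ (a : R[i]) x : l2norm (a *: x) = Normc.normc a * l2norm x.
Proof.
have le (c : R[i]) (z : ell2 R G) : l2norm (c *: z) <= Normc.normc c * l2norm z.
  apply: l2norm_le => [|A fA]; first by rewrite mulr_ge0 ?normc_ge0 ?l2norm_ge0.
  rewrite (eq_fsbigr (fun g => Normc.normc c ^+ 2 * normc2 (z g))).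
    by rewrite -mulr_fsumr exprMn ler_wpM2l ?sqr_ge0// l2norm_fsum.
  by move=> g _; rewrite /normc2 -exprMn -Normc.normcM.
apply/eqP; rewrite eq_le le/=.
have [->|a0] := eqVneq a 0.
  by rewrite Normc.normc0 mul0r l2norm_ge0.
have na : 0 < Normc.normc a.
  rewrite lt_def normc_ge0 andbT; apply: contra_neq a0; exact: Normc.eq0_normc.
have := le a^-1 (a *: x).
by rewrite scalerA mulVf// scale1r Normc.normcV mulrC ler_pdivlMr// mulrC.
Qed.

Lemma l2norm_is_norm : is_norm (@l2norm R G).
Proof.
split.
- by rewrite -(scale0r (0 : ell2 R G)) l2normZ Normc.normc0 mul0r.
- by move=> x; rewrite -scaleN1r l2normZ normcN Normc.normc1 mul1r.
- exact: l2norm_triangle.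
- move=> x x0; apply: ell2P => g; apply: Normc.eq0_normc; apply/eqP.
  by rewrite eq_le normc_ge0 andbT -x0 l2norm_coord.
Qed.

Lemma l2norm_complete : norm_complete (@l2norm R G).
Proof.
move=> x xC.
have /choice[f hf] : forall g, exists z : R[i], forall e, 0 < e ->
    exists n0, forall k, (n0 <= k)%N -> Normc.normc (z - x k g) < e.
  move=> g; apply: normc_complete => e /xC[n0 h]; exists n0 => k l nk nl.
  by apply: le_lt_trans (h _ _ nk nl); exact: (l2norm_coord (x k - x l) g).
(* Coordinatewise convergence is not uniform in the coordinate, but on a finite list it gives
   l2-closeness for some late [x l]. The Cauchy property then removes the dependence on the list. *)
have unif n0 (r : seq G) d : 0 < d -> exists2 l, (n0 <= l)%N &
    \sum_(g <- r) Normc.normc (f g - x l g) ^+ 2 <= d ^+ 2.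
  move=> d0; suff [m hm] : exists m, forall l, (m <= l)%N ->
      \sum_(g <- r) Normc.normc (f g - x l g) ^+ 2 <= d ^+ 2.
    by exists (maxn n0 m); rewrite ?leq_maxl// hm// leq_maxr.
  elim: r d d0 => [|g r IH] d d0.
    by exists 0%N => l _; rewrite big_nil sqr_ge0.
  have d20 : 0 < d / 2 by rewrite divr_gt0.
  have [m hm] := IH _ d20; have [m' hm'] := hf g _ d20.
  exists (maxn m m') => l; rewrite geq_max => /andP[ml ml'].
  rewrite big_cons; have h1 := hm _ ml.
  have h2 : Normc.normc (f g - x l g) ^+ 2 <= (d / 2) ^+ 2.
    by rewrite ler_sqr ?nnegrE ?normc_ge0 ?(ltW d20)// ltW// hm'.
  apply: le_trans (lerD h2 h1) _; rewrite -subr_ge0.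
  rewrite [X in 0 <= X](_ : _ = d ^+ 2 / 2); last by field.
  by rewrite divr_ge0 ?sqr_ge0.
have bound e k n0 : 0 < e -> (forall l, (n0 <= l)%N -> l2norm (x l - x k) < e) ->
    forall A, finite_set A ->
    \sum_(g \in A) Normc.normc (f g - x k g) ^+ 2 <= (e + e) ^+ 2.
  move=> e0 h A fA; have [l nl hl] := unif n0 (fset_set A) e e0.
  apply: (@l2_minkowski _ A (fun g => Normc.normc (f g - x l g))
    (fun g => Normc.normc (x l g - x k g))
    (fun g => Normc.normc (f g - x k g))); rewrite ?(ltW e0)//.
  - by move=> g; exact: normc_ge0.
  - by move=> g; exact: normc_ge0.
  - by move=> g; exact: normc_ge0.
  - by move=> g; exact: (is_norm_sub_le (@normc_is_norm R)).
  - move=> B [fB BA]; apply: le_trans hl; rewrite -fsbig_finite//.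
    by apply: ler_fsum_subset => // g; exact: sqr_ge0.
  - move=> B [fB BA]; apply: le_trans (l2norm_fsum (x l - x k) fB) _.
    by rewrite ler_sqr ?nnegrE ?l2norm_ge0 ?ltW// h.
  - by split.
have sf : f \in @square_summable R G.
  have [n0 hn0] := xC 1 ltr01.
  have fs : (fun g => f g - x n0 g) \in @square_summable R G.
    rewrite inE /=; apply: (@esum_bound_lty _ _ _ _ ((1 + 1) ^+ 2)) => A [fA _].
    by apply: (bound 1 n0 n0 ltr01 _ A fA) => l nl; exact: hn0.
  rewrite (_ : f = (fun g => f g - x n0 g) + x n0); last first.
    by apply/funext => g; rewrite -[RHS]/(f g - x n0 g + x n0 g) subrK.
  by rewrite rpredD// ell2_valP.
exists (Ell2 sf) => e e0.
have e40 : 0 < e / 4 by rewrite divr_gt0.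
have [n0 hn0] := xC _ e40; exists n0 => k nk.
apply: (@le_lt_trans _ _ (e / 4 + e / 4)); last by lra.
apply: l2norm_le => [|A fA]; first by rewrite addr_ge0// ltW.
by apply: (bound _ k n0 e40 _ A fA) => l nl; exact: hn0.
Qed.

(** The remainder is [x] cut off outside [A], so its squared norm is a tail of a convergent sum. *)
Lemma basis_expansion x :
  has_sum (@l2norm R G) setT (fun g => x g *: delta g) x.
Proof.
move=> e e0.
have e20 : 0 < (e / 2) ^+ 2 by rewrite exprn_gt0// divr_gt0.
have [|A0 A0T hA0] := @esum_tail R _ setT (fun g => normc2 (x g)) _ _ (sqsum_lty x) e20.
  by move=> g; exact: normc2_ge0.
exists A0 => // A [fA _] A0A.
have coord h : (x - \sum_(g \in A) x g *: delta g) h = if h \in A then 0 else x h.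
  rewrite -[LHS]/(x h - ell2_val (\sum_(g \in A) x g *: delta g) h).
  rewrite fsbig_finite//=.
  have -> (s : seq G) : uniq s -> ell2_val (\sum_(g <- s) x g *: delta g) h =
      if h \in s then x h else 0.
    elim: s => [|g s IH]; first by rewrite big_nil.
    rewrite big_cons /= => /andP[gs us].
    rewrite -[LHS]/(x g * (h == g)%:R + ell2_val (\sum_(g <- s) x g *: delta g) h).
    rewrite IH// inE; have [->|hg] := eqVneq h g.
      by rewrite (negbTE gs) mulr1 addr0.
    by rewrite mulr0 add0r.
  - by rewrite in_fset_set//; case: ifP => _; rewrite ?subrr ?subr0.
  - exact: fset_uniq.
apply: (@le_lt_trans _ _ (e / 2)); last by lra.
apply: l2norm_le => [|B fB]; first by rewrite divr_ge0// ltW.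
rewrite (eq_fsbigr (fun h => if h \in ~` A then normc2 (x h) else 0)); last first.
  move=> h _; rewrite coord in_setC; case: ifP => //= _.
  by rewrite /normc2 Normc.normc0 expr0n.
rewrite -fsbig_mkcondr; apply/ltW/hA0.
  by split => //; apply: finite_setIl.
by apply/seteqP; split => // h [[_ nA] /A0A].
Qed.

End ell2_norm.

(** * The inner product of l2(G) *)

Section inner_theory.
Variables (R : realType) (G : groupType).
Implicit Types x y z : ell2 R G.

Lemma has_sum_reindex (V : zmodType) (N : V -> R) (I : choiceType) (F : I -> V)
    (s : V) (h h' : I -> I) : cancel h h' -> cancel h' h ->
  has_sum N setT F s -> has_sum N setT (fun i => F (h i)) s.
Proof.
move=> hK h'K hs e /hs[A [fA _] hA].
exists (h' @` A); first by split => //; exact: finite_image.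
move=> B [fB _] AB.
have -> : \sum_(i \in B) F (h i) = \sum_(i \in h @` B) F i.
  by rewrite fsbig_image// => i j _ _; exact: (can_inj hK).
apply: hA; first by split => //; exact: finite_image.
by move=> i Ai; exists (h' i); [apply: AB; exists i | rewrite h'K].
Qed.

Lemma inner_uniq x y s :
  has_sum (@Normc.normc R) setT (fun g => x g * (y g)^*)%C s -> inner x y = s.
Proof. exact: (has_sum_uniq (@normc_is_norm R) (has_sum_inner x y)). Qed.

Lemma innerDl x y z : inner (x + y) z = inner x z + inner y z.
Proof.
apply: inner_uniq.
apply: has_sum_eq (has_sumD (@normc_is_norm R) (has_sum_inner x z) (has_sum_inner y z)).
by move=> g _; rewrite -[(x + y) g]/(x g + y g) mulrDl.
Qed.

Lemma innerZl (a : R[i]) x z : inner (a *: x) z = a * inner x z.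
Proof.
apply: inner_uniq.
apply: (@has_sum_eq _ _ _ _ _ (fun g => a * (x g * (z g)^*%C))).
  by move=> g _; rewrite -[(a *: x) g]/(a * x g) mulrA.
apply: (has_sum_map (L := fun w => a * w) (M := Normc.normc a) (@normc_is_norm R)).
- by rewrite mulr0.
- by move=> u v; rewrite mulrDr.
- by move=> u; rewrite Normc.normcM.
- exact: has_sum_inner.
Qed.

Lemma inner_conj x y : inner y x = (inner x y)^*%C.
Proof.
apply: inner_uniq.
apply: (@has_sum_eq _ _ _ _ _ (fun g => (x g * (y g)^*)^*%C)).
  by move=> g _; rewrite rmorphM/= conjcK mulrC.
apply: (has_sum_map (L := fun w => w^*%C) (M := 1) (@normc_is_norm R)).
- exact: conjc0.
- by move=> u v; rewrite rmorphD.
- by move=> u; rewrite normc_conj mul1r.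
- exact: has_sum_inner.
Qed.

Lemma innerDr x y z : inner x (y + z) = inner x y + inner x z.
Proof. by rewrite inner_conj innerDl rmorphD/= -!inner_conj. Qed.

Lemma innerZr (a : R[i]) x z : inner x (a *: z) = (a^*)%C * inner x z.
Proof. by rewrite inner_conj innerZl rmorphM/= -!inner_conj. Qed.

Lemma inner_xx x : inner x x = ((l2norm x ^+ 2)%:C)%C.
Proof.
have sfin := sqsum_lty x.
have h := has_sum_ge0 (fun g => normc2_ge0 (x g)) sfin.
apply: inner_uniq.
apply: (@has_sum_eq _ _ _ _ _ (fun g => (normc2 (x g))%:C%C)).
  move=> g _; rewrite /normc2; case: (x g) => a b.
  rewrite /= sqr_sqrtr ?addr_ge0 ?sqr_ge0//.
  by apply/eqP; rewrite eq_complex /=; apply/andP; split; apply/eqP; ring.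
have -> : l2norm x ^+ 2 = fine (\esum_(g in [set: G]) (normc2 (x g))%:E)%E.
  by rewrite -[X in fine X]l2norm_sqE.
apply: (has_sum_map (L := fun w : R => w%:C%C) (M := 1) _ _ _ _ h).
- by split => //; [exact: normr0|exact: normrN|exact: ler_normD|exact: normr0_eq0].
- by [].
- by move=> u v; rewrite rmorphD.
- by move=> u; rewrite normc_real mul1r.
Qed.

Lemma inner_CS x y : Normc.normc (inner x y) <= l2norm x * l2norm y.
Proof.
apply: (has_sum_le (@normc_is_norm R) (has_sum_inner x y)) => A [fA _].
have -> : \sum_(g \in A) Normc.normc (x g * ((y g)^*)%C) =
    \sum_(g <- fset_set A) Normc.normc (x g) * Normc.normc (y g).
  by rewrite fsbig_finite//; apply: eq_bigr => g _; rewrite Normc.normcM normc_conj.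
by apply: sum_CS; rewrite ?l2norm_ge0// -fsbig_finite//; exact: l2norm_fsum.
Qed.

Lemma inner_deltal x g : inner (delta g) x = ((x g)^*)%C.
Proof.
apply: inner_uniq => e e0; exists [set g]; first by split => //; exact: finite_set1.
move=> A [fA _] gA.
have -> : \sum_(h \in A) (delta g : ell2 R G) h * ((x h)^*)%C = ((x g)^*)%C.
  rewrite (fsbigD1 g)//=; last exact: gA.
  rewrite eqxx mul1r fsbig1 ?addr0// => h [_ /= /eqP hg].
  by rewrite (negbTE hg) mul0r.
by rewrite subrr Normc.normc0.
Qed.

Lemma inner_delta x g : inner x (delta g) = x g.
Proof. by rewrite inner_conj inner_deltal conjcK. Qed.

Lemma l2norm_delta g : l2norm (delta g : ell2 R G) = 1.
Proof.
apply/eqP; rewrite -(@pexpr_eq1 _ _ 2) ?l2norm_ge0//; apply/eqP.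
have := inner_xx (delta g); rewrite inner_delta /= eqxx => -[<-].
by [].
Qed.

Lemma inner_lambda g x y : inner (lambda g x) (lambda g y) = inner x y.
Proof.
apply: inner_uniq => /=.
apply: (@has_sum_reindex _ _ _ (fun h => x h * (y h)^*)%C _
  (fun h => g^-1 * h)%g (fun h => g * h)%g).
- by move=> h; rewrite mulVKg.
- by move=> h; rewrite mulKg.
- exact: has_sum_inner.
Qed.

(** Only additivity is assumed, so that the conjugate-linear maps [inner x] are covered; this is why
    vanishing is required on all scalar multiples of the basis vectors. *)
Lemma bounded_additive_ext (V : zmodType) (N : V -> R) (L : ell2 R G -> V) (M : R) :
  is_norm N -> (forall x y, L (x + y) = L x + L y) ->
  (forall x, N (L x) <= M * l2norm x) ->
  (forall a g, L (a *: delta g) = 0) -> forall x, L x = 0.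
Proof.
move=> Nn LD LM Ld x.
have L0 : L 0 = 0 by apply: (addrI (L 0)); rewrite -LD !addr0.
have h := has_sum_map (@l2norm_is_norm R G) L0 LD LM (basis_expansion x).
apply: (has_sum_uniq Nn h) => e e0; exists set0; first exact: fsets_set0.
by move=> A DA _; rewrite fsbig1 ?subrr ?(is_norm0 Nn)// => g _; rewrite Ld.
Qed.

End inner_theory.

(** * Hilbert-Schmidt operators *)

Lemma esum_pair (R : realType) (I J : choiceType) (a : I -> J -> R) :
  (forall i j, 0 <= a i j) ->
  (\esum_(i in [set: I]) \esum_(j in [set: J]) (a i j)%:E =
   \esum_(p in [set: I * J]) (a p.1 p.2)%:E)%E.
Proof.
move=> a0; rewrite esum_esum; last by move=> i j _ _; rewrite lee_fin.
by congr esum; apply/seteqP; split.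
Qed.

(** * Hilbert-Schmidt operators as square-summable matrices *)

Section HS_matrix.
Variables (R : realType) (G : groupType).
Implicit Types (S T : HS R G) (x y z : ell2 R G) (K : ell2 R (G * G)%type).

Lemma HS_linear T : linear T.
Proof. by have := HS_valP T; rewrite inE /= => -[]. Qed.

Lemma HS_bounded T : bounded_op T.
Proof. by have := HS_valP T; rewrite inE /= => -[]. Qed.

Lemma hs_sqsum_lty T : (hs_sqsum T < +oo)%E.
Proof. by have := HS_valP T; rewrite inE /= => -[]. Qed.

Lemma HS0E x : (0 : HS R G) x = 0. Proof. by []. Qed.
Lemma HSDE S T x : (S + T) x = S x + T x. Proof. by []. Qed.
Lemma HSNE T x : (- T) x = - T x. Proof. by []. Qed.
Lemma HSZE (a : R[i]) T x : (a *: T) x = a *: T x. Proof. by []. Qed.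

Lemma HS_D T x y : T (x + y) = T x + T y.
Proof. by have := HS_linear T 1 x y; rewrite !scale1r. Qed.

Lemma HS_0 T : T 0 = 0.
Proof. by apply: (addrI (T 0)); rewrite -HS_D !addr0. Qed.

Lemma HS_Z T (a : R[i]) x : T (a *: x) = a *: T x.
Proof. by have := HS_linear T a x 0; rewrite !addr0 HS_0 addr0. Qed.

Lemma HS_N T x : T (- x) = - T x.
Proof. by rewrite -scaleN1r HS_Z scaleN1r. Qed.

Lemma HS_ext S T : (forall g, S (delta g) = T (delta g)) -> S = T.
Proof.
move=> ST; apply: HSP => x; apply/subr0_eq.
have [M hM] := HS_bounded (S - T).
apply: (@bounded_additive_ext _ _ _ (@l2norm R G) (S - T) M) hM _ x.
- exact: l2norm_is_norm.
- exact: HS_D.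
- by move=> a g; rewrite HS_Z HSDE HSNE ST subrr scaler0.
Qed.

(** Matrix entry in column [p.1] and row [p.2]. Viewing matrices as vectors of l2(G x G) transfers
    the norm axioms and completeness from [ell2]. *)
Definition hsmat_fun T (p : (G * G)%type) : R[i] := T (delta p.1) p.2.

Lemma hsmat_sqsum T : sqsum (hsmat_fun T) = hs_sqsum T.
Proof.
rewrite /hs_sqsum [RHS](_ : _ = \esum_(g in [set: G]) \esum_(h in [set: G])
    (normc2 (T (delta g) h))%:E)%E; last first.
  by apply: eq_esum => g _; rewrite l2norm_sqE.
by rewrite esum_pair// => i j; rewrite normc2_ge0.
Qed.

Lemma hsmat_subproof T : hsmat_fun T \in @square_summable R (G * G)%type.
Proof. by rewrite inE /= hsmat_sqsum hs_sqsum_lty. Qed.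

Definition hsmat T : ell2 R (G * G)%type := Ell2 (hsmat_subproof T).

Lemma hsnormE T : hsnorm T = l2norm (hsmat T).
Proof. by rewrite /hsnorm -hsmat_sqsum. Qed.

Lemma hsmatD S T : hsmat (S + T) = hsmat S + hsmat T.
Proof. by apply: ell2P. Qed.

Lemma hsmatN T : hsmat (- T) = - hsmat T.
Proof. by apply: ell2P. Qed.

Lemma hsmatZ (a : R[i]) T : hsmat (a *: T) = a *: hsmat T.
Proof. by apply: ell2P. Qed.

Lemma hsmat_inj : injective hsmat.
Proof.
move=> S T ST; apply: HS_ext => g; apply: ell2P => h.
exact: (congr1 (fun K : ell2 R (G * G)%type => K (g, h)) ST).
Qed.

Lemma pair_sqsum K : sqsum K =
  (\esum_(h in [set: G]) \esum_(g in [set: G]) (normc2 (K (g, h)))%:E)%E.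
Proof.
rewrite (@esum_pair _ _ _ (fun h g => normc2 (K (g, h)))); last first.
  by move=> h g; exact: normc2_ge0.
rewrite /sqsum (@reindex_esum _ _ _ [set: (G * G)%type] _ (fun p => (p.2, p.1))).
  by apply: eq_esum => -[].
by rewrite setTT_bijective; exists (fun p => (p.2, p.1)) => -[].
Qed.

Lemma hscol_subproof K h : (fun g => (K (g, h))^*%C) \in @square_summable R G.
Proof.
rewrite inE /= /sqsum; apply: le_lt_trans (sqsum_lty K); rewrite pair_sqsum.
rewrite [leRHS](esumID [set h])//; last first.
  by move=> i _; apply: esum_ge0 => j _; rewrite lee_fin normc2_ge0.
rewrite setTI esum_set1; last by apply: esum_ge0 => j _; rewrite lee_fin normc2_ge0.
apply: (@le_trans _ _ (\esum_(g in [set: G]) (normc2 (K (g, h)))%:E)%E).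
  by apply: le_esum => g _; rewrite /normc2 normc_conj.
rewrite leeDl//; apply: esum_ge0 => i _.
by apply: esum_ge0 => j _; rewrite lee_fin normc2_ge0.
Qed.

(** Conjugated so that [inner x (hscol K h)] is the coordinate sum_g K(g,h) x_g of the image of
    [x]. *)
Definition hscol K h : ell2 R G := Ell2 (hscol_subproof K h).

Lemma hscol_sum K A : finite_set A ->
  \sum_(h \in A) l2norm (hscol K h) ^+ 2 <= l2norm K ^+ 2.
Proof.
move=> fA; rewrite -lee_fin l2norm_sqE pair_sqsum.
rewrite [leRHS](_ : _ = \esum_(h in [set: G]) (l2norm (hscol K h) ^+ 2)%:E)%E.
  exact: fsum_le_esum.
apply: eq_esum => h _; rewrite l2norm_sqE; apply: eq_esum => g _.
by rewrite /normc2 /= normc_conj.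
Qed.

(** Cauchy-Schwarz in each coordinate, then summation over the coordinates: the operator norm is at
    most the Hilbert-Schmidt norm. *)
Lemma hsop_sum K x A : finite_set A ->
  \sum_(h \in A) normc2 (inner x (hscol K h)) <= (l2norm K * l2norm x) ^+ 2.
Proof.
move=> fA; rewrite exprMn.
apply: (@le_trans _ _ (\sum_(h \in A) l2norm (hscol K h) ^+ 2 * l2norm x ^+ 2)).
  rewrite !fsbig_finite//; apply: ler_sum => h _.
  rewrite -exprMn mulrC ler_sqr ?nnegrE ?normc_ge0 ?mulr_ge0 ?l2norm_ge0//.
  exact: inner_CS.
by rewrite -mulr_fsuml ler_wpM2r ?sqr_ge0// hscol_sum.
Qed.

Lemma hsop_subproof K x : (fun h => inner x (hscol K h)) \in @square_summable R G.
Proof.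
rewrite inE /=; apply: (@esum_bound_lty _ _ _ _ ((l2norm K * l2norm x) ^+ 2)).
by move=> A [fA _]; exact: hsop_sum.
Qed.

Definition hsop_fun K x : ell2 R G := Ell2 (hsop_subproof K x).

Lemma hsop_norm K x : l2norm (hsop_fun K x) <= l2norm K * l2norm x.
Proof.
by apply: l2norm_le => [|A fA]; [rewrite mulr_ge0 ?l2norm_ge0 | exact: hsop_sum].
Qed.

Lemma hsop_delta K g h : hsop_fun K (delta g) h = K (g, h).
Proof. by rewrite /= inner_deltal /= conjcK. Qed.

Lemma hsop_HS K : hsop_fun K \in @hilbert_schmidt R G.
Proof.
rewrite inE /=; split.
- by move=> a x y; apply: ell2P => h; rewrite /= innerDl innerZl.
- by exists (l2norm K) => x; exact: hsop_norm.
- rewrite /hs_sqsum; apply: le_lt_trans (sqsum_lty K).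
  rewrite [leRHS](_ : _ = \esum_(p in [set: G * G]) (normc2 (K (p.1, p.2)))%:E)%E;
    last by apply: eq_esum => -[].
  rewrite -(@esum_pair _ _ _ (fun g h => normc2 (K (g, h)))); last first.
    by move=> g h; exact: normc2_ge0.
  apply: le_esum => g _; rewrite l2norm_sqE; apply: le_esum => h _.
  by rewrite hsop_delta.
Qed.

Definition hsop K : HS R G := MkHS (hsop_HS K).

Lemma hsopK K : hsmat (hsop K) = K.
Proof. by apply: ell2P => -[g h]; exact: hsop_delta. Qed.

Lemma hsmatK T : hsop (hsmat T) = T.
Proof. by apply: hsmat_inj; rewrite hsopK. Qed.

Lemma hsnorm_op T x : l2norm (T x) <= hsnorm T * l2norm x.
Proof. by rewrite hsnormE -{1}(hsmatK T); exact: hsop_norm. Qed.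

Lemma hsnorm_ge0 T : 0 <= hsnorm T.
Proof. by rewrite hsnormE l2norm_ge0. Qed.

Lemma hsnormZ (a : R[i]) T : hsnorm (a *: T) = Normc.normc a * hsnorm T.
Proof. by rewrite !hsnormE hsmatZ l2normZ. Qed.

Lemma hsnorm_is_norm : is_norm (@hsnorm R G).
Proof.
have Nn := @l2norm_is_norm R (G * G)%type.
split.
- by rewrite -(scale0r (0 : HS R G)) hsnormZ Normc.normc0 mul0r.
- by move=> T; rewrite !hsnormE hsmatN (is_normN Nn).
- by move=> S T; rewrite !hsnormE hsmatD (is_normD Nn).
- move=> T; rewrite hsnormE => /(is_norm_eq0 Nn) T0; apply: hsmat_inj.
  by rewrite T0; apply: ell2P.
Qed.

Lemma hsnorm_complete : norm_complete (@hsnorm R G).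
Proof.
move=> T TC.
have [|K hK] := @l2norm_complete R (G * G)%type (fun n => hsmat (T n)).
  move=> e /TC[n0 h]; exists n0 => k l nk nl.
  by have := h _ _ nk nl; rewrite hsnormE hsmatD hsmatN.
exists (hsop K) => e /hK[n0 h]; exists n0 => k nk.
by rewrite hsnormE hsmatD hsmatN hsopK h.
Qed.

End HS_matrix.

(** * Composition, adjoint and conjugation on Hilbert-Schmidt operators *)

Section HS_algebra.
Variables (R : realType) (G : groupType).
Implicit Types (S T U : HS R G) (x y z : ell2 R G).

Lemma hsnorm_delta_sum T A : finite_set A ->
  \sum_(g \in A) l2norm (T (delta g)) ^+ 2 <= hsnorm T ^+ 2.
Proof.
move=> fA; rewrite -lee_fin /hsnorm sqr_sqrtr; last first.
  by apply: fine_ge0; apply: esum_ge0 => g _; rewrite lee_fin sqr_ge0.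
rewrite fineK; first by apply: fsum_le_esum.
rewrite ge0_fin_numE ?hs_sqsum_lty//.
by apply: esum_ge0 => g _; rewrite lee_fin sqr_ge0.
Qed.

Lemma hsnorm_le T (B : R) : 0 <= B ->
  (forall A, finite_set A -> \sum_(g \in A) l2norm (T (delta g)) ^+ 2 <= B ^+ 2) ->
  hsnorm T <= B.
Proof.
move=> B0 h; rewrite -ler_sqr ?nnegrE ?hsnorm_ge0// -lee_fin /hsnorm.
have h0 : (0 <= hs_sqsum T)%E by apply: esum_ge0 => g _; rewrite lee_fin sqr_ge0.
rewrite sqr_sqrtr ?fine_ge0// fineK ?ge0_fin_numE ?hs_sqsum_lty//.
by apply: esum_le_bound => A [fA _]; exact: h.
Qed.

Lemma hs_comp_sum S T A : finite_set A ->
  \sum_(g \in A) l2norm (S (T (delta g))) ^+ 2 <= (hsnorm S * hsnorm T) ^+ 2.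
Proof.
move=> fA; rewrite exprMn.
apply: (@le_trans _ _ (\sum_(g \in A) hsnorm S ^+ 2 * l2norm (T (delta g)) ^+ 2)).
  rewrite !fsbig_finite//; apply: ler_sum => g _.
  rewrite -exprMn; apply: ler_sq; [exact: l2norm_ge0|exact: hsnorm_op].
by rewrite -mulr_fsumr ler_wpM2l ?sqr_ge0// hsnorm_delta_sum.
Qed.

Lemma hs_mul_subproof S T : S \o T \in @hilbert_schmidt R G.
Proof.
rewrite inE /=; split.
- by move=> a x y /=; rewrite HS_D HS_Z HS_D HS_Z.
- exists (hsnorm S * hsnorm T) => x /=; apply: le_trans (hsnorm_op _ _) _.
  by rewrite -mulrA ler_wpM2l ?hsnorm_ge0// hsnorm_op.
- apply: (@esum_bound_lty _ _ _ _ ((hsnorm S * hsnorm T) ^+ 2)) => A [fA _].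
  exact: hs_comp_sum.
Qed.

(** The identity is Hilbert-Schmidt only when G is finite, so this algebra has in general no unit; a
    series 1 + f is later represented by f. *)
Definition hs_mul S T : HS R G := MkHS (hs_mul_subproof S T).

Lemma hs_mulE S T x : hs_mul S T x = S (T x). Proof. by []. Qed.

Lemma hsnormM S T : hsnorm (hs_mul S T) <= hsnorm S * hsnorm T.
Proof.
by apply: hsnorm_le => [|A fA]; [rewrite mulr_ge0 ?hsnorm_ge0|exact: hs_comp_sum].
Qed.

Lemma hs_mulA S T U : hs_mul S (hs_mul T U) = hs_mul (hs_mul S T) U.
Proof. by apply: HSP. Qed.

Lemma hs_mulDl S T U : hs_mul (S + T) U = hs_mul S U + hs_mul T U.
Proof. by apply: HSP. Qed.

Lemma hs_mulDr S T U : hs_mul S (T + U) = hs_mul S T + hs_mul S U.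
Proof. by apply: HSP => x; rewrite HSDE !hs_mulE HSDE HS_D. Qed.

Lemma hs_mulZl (a : R[i]) S T : hs_mul (a *: S) T = a *: hs_mul S T.
Proof. by apply: HSP. Qed.

Lemma hs_mulZr (a : R[i]) S T : hs_mul S (a *: T) = a *: hs_mul S T.
Proof. by apply: HSP => x; rewrite HSZE !hs_mulE HSZE HS_Z. Qed.

Lemma hs_mul0l T : hs_mul 0 T = 0.
Proof. by apply: HSP. Qed.

Lemma hs_mul0r T : hs_mul T 0 = 0.
Proof. by apply: HSP => x; rewrite hs_mulE !HS0E HS_0. Qed.

Lemma hs_star_subproof T :
  (fun p => (hsmat T (p.2, p.1))^*%C) \in @square_summable R (G * G)%type.
Proof.
rewrite inE /= /sqsum; apply: le_lt_trans (sqsum_lty (hsmat T)).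
rewrite /sqsum [leRHS](@reindex_esum _ _ _ [set: (G * G)%type] _ (fun p => (p.2, p.1))).
  by apply: le_esum => p _; rewrite /normc2 normc_conj.
by rewrite setTT_bijective; exists (fun p => (p.2, p.1)) => -[].
Qed.

Definition hs_star T : HS R G := hsop (Ell2 (hs_star_subproof T)).

Lemma hs_star_delta T g h : hs_star T (delta g) h = ((T (delta h) g)^*)%C.
Proof. exact: hsop_delta. Qed.

(** The difference of the two sides is additive and bounded in each variable, so it suffices to
    compare them on basis vectors, where [hs_star] was defined as the conjugate transpose. *)
Lemma hs_star_adjoint T : is_adjoint T (hs_star T).
Proof.
move=> x y; apply/subr0_eq; move: x.
have Nn := @normc_is_norm R.
apply: (@bounded_additive_ext _ _ _ (@Normc.normc R)
  (fun x => inner (T x) y - inner x (hs_star T y))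
  (hsnorm T * l2norm y + l2norm (hs_star T y))) => //.
- by move=> x x'; rewrite HS_D !innerDl opprD addrACA.
- move=> x; apply: le_trans (is_normB Nn _ _) _.
  rewrite mulrDl lerD//; last by rewrite mulrC inner_CS.
  apply: le_trans (inner_CS _ _) _.
  by rewrite mulrAC ler_wpM2r ?l2norm_ge0// hsnorm_op.
- move=> a g; rewrite HS_Z !innerZl -mulrBr.
  suff -> : inner (T (delta g)) y - inner (delta g) (hs_star T y) = 0 by rewrite mulr0.
  move: y; apply: (@bounded_additive_ext _ _ _ (@Normc.normc R)
    (fun y => inner (T (delta g)) y - inner (delta g) (hs_star T y))
    (l2norm (T (delta g)) + hsnorm (hs_star T))) => //.
  + by move=> y y'; rewrite HS_D !innerDr opprD addrACA.
  + move=> y; apply: le_trans (is_normB Nn _ _) _.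
    rewrite mulrDl lerD ?inner_CS//; apply: le_trans (inner_CS _ _) _.
    by rewrite l2norm_delta mul1r hsnorm_op.
  + move=> b h; rewrite HS_Z !innerZr inner_delta inner_deltal hs_star_delta conjcK.
    by rewrite subrr.
Qed.

Lemma inner_ext x x' : (forall y, inner y x = inner y x') -> x = x'.
Proof.
move=> h; apply: ell2P => g; have := h (delta g); rewrite !inner_deltal.
exact: (can_inj (@conjcK R)).
Qed.

Lemma adjoint_uniq T S S' : is_adjoint T S -> is_adjoint T S' -> S = S'.
Proof.
by move=> TS TS'; apply: HSP => x; apply: inner_ext => y; rewrite -TS -TS'.
Qed.

Lemma hs_star_eq T S : is_adjoint T S -> hs_star T = S.
Proof. by move=> TS; exact: adjoint_uniq (hs_star_adjoint T) TS. Qed.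

Lemma hs_starD S T : hs_star (S + T) = hs_star S + hs_star T.
Proof.
apply: hs_star_eq => x y.
by rewrite !HSDE innerDl innerDr !hs_star_adjoint.
Qed.

Lemma hs_starZ (a : R[i]) T : hs_star (a *: T) = (a^*)%C *: hs_star T.
Proof.
apply: hs_star_eq => x y.
by rewrite !HSZE innerZl innerZr conjcK hs_star_adjoint.
Qed.

Lemma hs_star0 : hs_star 0 = 0.
Proof. by rewrite -(scale0r (0 : HS R G)) hs_starZ conjc0 !scale0r. Qed.

Lemma hs_starN T : hs_star (- T) = - hs_star T.
Proof. by rewrite -scaleN1r hs_starZ rmorphN rmorph1 scaleN1r. Qed.

Lemma hs_starK T : hs_star (hs_star T) = T.
Proof.
apply: hs_star_eq => x y.
by rewrite inner_conj -hs_star_adjoint -inner_conj.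
Qed.

Lemma hs_starM S T : hs_star (hs_mul S T) = hs_mul (hs_star T) (hs_star S).
Proof. by apply: hs_star_eq => x y; rewrite !hs_mulE -!hs_star_adjoint. Qed.

Lemma hsnorm_star T : hsnorm (hs_star T) = hsnorm T.
Proof.
rewrite !hsnormE hsopK /l2norm; congr (Num.sqrt (fine _)).
rewrite /sqsum [RHS](@reindex_esum _ _ _ [set: (G * G)%type] _ (fun p => (p.2, p.1))).
  by apply: eq_esum => p _; rewrite /normc2 normc_conj.
by rewrite setTT_bijective; exists (fun p => (p.2, p.1)) => -[].
Qed.

Implicit Type g : G.

Lemma lambdaK g x : lambda g^-1%g (lambda g x) = x.
Proof. by rewrite -lambdaM mulVg lambda1. Qed.

Lemma lambdaVK g x : lambda g (lambda g^-1%g x) = x.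
Proof. by rewrite -lambdaM mulgV lambda1. Qed.

Lemma ad_lambdaE g T x : ad_lambda g T x = lambda g (T (lambda g^-1%g x)).
Proof. by []. Qed.

Lemma ad_lambdaZ g (a : R[i]) T : ad_lambda g (a *: T) = a *: ad_lambda g T.
Proof. by apply: HSP => x; apply: ell2P. Qed.

Lemma ad_lambda0 g : ad_lambda g (0 : HS R G) = 0.
Proof. by rewrite -(scale0r (0 : HS R G)) ad_lambdaZ !scale0r. Qed.

Lemma ad_lambdaN g T : ad_lambda g (- T) = - ad_lambda g T.
Proof. by rewrite -scaleN1r ad_lambdaZ scaleN1r. Qed.

Lemma ad_lambda_mul g S T :
  ad_lambda g (hs_mul S T) = hs_mul (ad_lambda g S) (ad_lambda g T).
Proof. by apply: HSP => x; rewrite hs_mulE !ad_lambdaE hs_mulE lambdaK. Qed.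

Lemma ad_lambda_star g T : hs_star (ad_lambda g T) = ad_lambda g (hs_star T).
Proof.
apply: hs_star_eq => x y; rewrite !ad_lambdaE.
rewrite -[y in LHS](lambdaVK g) inner_lambda hs_star_adjoint.
by rewrite -[RHS](inner_lambda g^-1%g) lambdaK.
Qed.

Lemma hsnorm_ad g T : hsnorm (ad_lambda g T) = hsnorm T.
Proof.
have le h S : hsnorm (ad_lambda h S) <= hsnorm S.
  rewrite /hsnorm; apply: ler_wsqrtr; rewrite fine_le//.
  - rewrite ge0_fin_numE ?hs_sqsum_lty//.
    by apply: esum_ge0 => k _; rewrite lee_fin sqr_ge0.
  - rewrite ge0_fin_numE ?hs_sqsum_lty//.
    by apply: esum_ge0 => k _; rewrite lee_fin sqr_ge0.
  rewrite /hs_sqsum [leRHS](@reindex_esum _ _ _ [set: G] _ (fun k => h^-1 * k)%g).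
    by apply: le_esum => k _; rewrite ad_lambdaE l2norm_lambda lambda_delta.
  by rewrite setTT_bijective; exists (fun k => h * k)%g => k; rewrite ?mulKg ?mulVKg.
apply/eqP; rewrite eq_le le/=.
by rewrite -{1}(ad_lambda1 T) -(mulVg g) ad_lambdaM le.
Qed.

End HS_algebra.

(** * Primitives of 2-cocycles with uniform bounds *)

Section low_degree_cochains.
Variables (G : groupType) (V : gmodule G).

Lemma diff1E (f : cochain V 1) g h :
  diff f [tuple g; h] = gact g (f [tuple h]) - f [tuple (g * h)%g] + f [tuple g].
Proof.
rewrite /diff big_ord_recl big_ord0 addr0 /= expr1 expr2 mulrN1 opprK.
rewrite mulrN1z mulr1z; congr (gact _ (f _) - f _ + f _).
- exact: val_inj.
- by apply: eq_from_tnth => i; rewrite tnth_mktuple !(tnth_nth 1%g); case: i => [[|[|[]]] ?].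
- by apply: eq_from_tnth => i; rewrite tnth_mktuple !(tnth_nth 1%g); case: i => [[|[|[]]] ?].
Qed.

Lemma diff2E (f : cochain V 2) g h k :
  diff f [tuple g; h; k] = gact g (f [tuple h; k]) - f [tuple (g * h)%g; k]
    + f [tuple g; (h * k)%g] - f [tuple g; h].
Proof.
rewrite /diff 2!big_ord_recl big_ord0 addr0 /= /bump /= !exprS expr0 !mulr1 !mulrN1 opprK.
rewrite !mulrN1z mulr1z addrA; congr (gact _ (f _) - f _ + f _ - f _).
- exact: val_inj.
- by apply: eq_from_tnth => i; rewrite tnth_mktuple !(tnth_nth 1%g); case: i => [[|[|[]]] ?].
- by apply: eq_from_tnth => i; rewrite tnth_mktuple !(tnth_nth 1%g); case: i => [[|[|[]]] ?].
- by apply: eq_from_tnth => i; rewrite tnth_mktuple !(tnth_nth 1%g); case: i => [[|[|[]]] ?].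
Qed.

Definition cocycle1 (c : G -> V) := forall g h, c (g * h)%g = c g + gact g (c h).

Definition cocycle2 (z : G -> G -> V) := forall g h k,
  gact g (z h k) + z g (h * k)%g = z (g * h)%g k + z g h.

(** Bounding in the homological sense: [z] is the coboundary of [b]. No norm is involved. *)
Definition bounds (z : G -> G -> V) (b : G -> V) := forall g h,
  z g h = b g + gact g (b h) - b (g * h)%g.

Lemma gact0 g : gact g (0 : V) = 0.
Proof. by apply: (addrI (gact g 0)); rewrite -gactD !addr0. Qed.

Lemma cocycles1P (c : cochain V 1) :
  cocycles V 1 c -> cocycle1 (fun g => c [tuple g]).
Proof.
move=> dc g h; have := congr1 (fun f : cochain V 2 => f [tuple g; h]) dc.
rewrite diff1E => /eqP; rewrite addrAC subr_eq0 => /eqP <-.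
by rewrite addrC.
Qed.

(** Elements of H^2 are cosets. The coset of a cocycle contains the cocycle, and by hypothesis it
    equals the set of coboundaries. *)
Lemma cohomology_zero2P : cohomology_zero V 2 ->
  forall z, cocycle2 z -> exists b, bounds z b.
Proof.
move=> H z zz; pose f : cochain V 2 := fun t => z (tnth t ord0) (tnth t ord_max).
have Zf : cocycles V 2 f.
  apply/funext => -[[|g [|h [|k []]]] // ht].
  rewrite (_ : Tuple ht = [tuple g; h; k]); last exact: val_inj.
  rewrite diff2E /f !(tnth_nth 1%g) /=.
  by rewrite [_ - _ + _]addrAC zz -addrA -opprD subrr.
have : cohomology V 2 [set f + b | b in coboundaries V 2] by exists f.
rewrite H => /= E.
have C0 : coboundaries V 2 0.
  exists (fun=> 0) => //; apply/funext => t.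
  rewrite /diff gact0 mul0rz addr0 add0r big1// => i _.
  by rewrite mul0rz.
have : [set f + b | b in coboundaries V 2] f by exists 0; rewrite ?addr0.
rewrite E => -[b _ bf]; exists (fun g => b [tuple g]) => g h.
have := congr1 (fun c : cochain V 2 => c [tuple g; h]) bf.
rewrite diff1E /f !(tnth_nth 1%g) /= => <-.
by rewrite addrAC [_ + b [tuple g]]addrC.
Qed.

End low_degree_cochains.

(** * Word balls in a finitely generated group *)

Section word_balls.
Variable G : groupType.
Implicit Types (S : seq G) (g h : G).

Fixpoint word_ball S n : seq G :=
  if n is m.+1 then
    word_ball S m ++ [seq (s * g)%g | s <- S, g <- word_ball S m]
  else [:: 1%g].

Lemma word_ball_le S m n : (m <= n)%N -> {subset word_ball S m <= word_ball S n}.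
Proof.
elim: n => [|n IH]; first by rewrite leqn0 => /eqP ->.
rewrite leq_eqVlt => /orP[/eqP -> //|]; rewrite ltnS => /IH mn g /mn gn.
by rewrite /= mem_cat gn.
Qed.

Lemma word_ballS S n s g : s \in S -> g \in word_ball S n ->
  (s * g)%g \in word_ball S n.+1.
Proof. by move=> sS gn; rewrite /= mem_cat orbC allpairs_f. Qed.

Lemma word_ball_ind S (P : G -> Prop) : P 1%g ->
  (forall s g, s \in S -> P g -> P (s * g)%g) ->
  forall n g, g \in word_ball S n -> P g.
Proof.
move=> P1 PS; elim=> [|n IH] g /=; first by rewrite inE => /eqP ->.
rewrite mem_cat => /orP[/IH //|/allpairsP[[s h]/= [sS hn ->]]].
by apply: PS => //; exact: IH.
Qed.

Lemma word_ballM S m n g h : g \in word_ball S m -> h \in word_ball S n ->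
  (g * h)%g \in word_ball S (m + n).
Proof.
elim: m g => [|m IH] g; first by rewrite inE => /eqP ->; rewrite mul1g.
rewrite [X in g \in X -> _]/= mem_cat => /orP[gm hn|/allpairsP[[s k]/= [sS km ->]] hn].
  by apply: (@word_ball_le _ (m + n)); rewrite ?leq_add2r ?IH.
by rewrite -mulgA; apply: (@word_ballS S (m + n)) => //; exact: IH.
Qed.

(** Adding the inverses to the generators makes the union of the word balls a subgroup, to which the
    definition of generation applies. *)
Lemma finitely_generated_ball : finitely_generated G ->
  exists S, forall g, exists n, g \in word_ball S n.
Proof.
move=> [s hs]; pose S := s ++ [seq x^-1%g | x <- s].
have SV : {in S, forall s, s^-1%g \in S}.
  move=> x; rewrite !mem_cat => /orP[xs|/mapP[y ys ->]].
    by rewrite map_f// orbT.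
  by rewrite invgK ys.
exists S => g.
pose H := [pred x : G | `[< exists n, x \in word_ball S n >]].
have HV x n : x \in word_ball S n -> x^-1%g \in word_ball S n.
  elim: n x => [|n IH] x; first by rewrite !inE => /eqP ->; rewrite invg1.
  rewrite /= !mem_cat => /orP[/IH -> //|/allpairsP[[t k]/= [tS /IH kn ->]]].
  rewrite -mem_cat -/(word_ball S n.+1) invgM -addn1; apply: word_ballM => //.
  by rewrite -[t^-1%g]mulg1; apply: word_ballS; [exact: SV|rewrite inE].
suff /asboolP : g \in H by [].
apply: hs.
  split; first by apply/asboolP; exists 0%N; rewrite inE.
  move=> x y /asboolP[m xm] /asboolP[n yn]; apply/asboolP; exists (m + n)%N.
  by apply: word_ballM => //; exact: HV.
move=> x xs; apply/asboolP; exists 1%N.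
by rewrite -[x]mulg1; apply: word_ballS; rewrite ?mem_cat ?xs ?inE.
Qed.

End word_balls.

Lemma sub_combine (V : zmodType) (a b c d e f : V) :
  (a + b - c) - (d + e - f) = (a - d) + (b - e) - (c - f).
Proof.
rewrite [a - d + _]addrACA -opprD; move: (a + b) (d + e) => x y.
by rewrite (opprD c) addrACA -opprD.
Qed.

Section norm_limits.
Variables (R : realType) (V : zmodType) (N : V -> R).
Hypothesis Nn : is_norm N.

Definition norm_cvg (x : nat -> V) (s : V) : Prop :=
  forall e, 0 < e -> exists n0, forall k, (n0 <= k)%N -> N (s - x k) < e.

Lemma norm_cvgD x y s t : norm_cvg x s -> norm_cvg y t ->
  norm_cvg (fun k => x k + y k) (s + t).
Proof.
move=> xs yt e e0; have e20 : 0 < e / 2 by rewrite divr_gt0.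
have [m hm] := xs _ e20; have [n hn] := yt _ e20.
exists (maxn m n) => k; rewrite geq_max => /andP[mk nk].
rewrite opprD addrACA [e]splitr.
by apply: le_lt_trans (is_normD Nn _ _) _; rewrite ltrD ?hm ?hn.
Qed.

Lemma norm_cvg_uniq x s t : norm_cvg x s -> norm_cvg x t -> s = t.
Proof.
move=> xs xt; apply/subr0_eq/(is_norm_small Nn) => e e0.
have e20 : 0 < e / 2 by rewrite divr_gt0.
have [m hm] := xs _ e20; have [n hn] := xt _ e20.
apply: le_lt_trans (is_norm_sub_le Nn _ (x (maxn m n)) _) _.
by rewrite [e]splitr (is_norm_distC Nn _ t) ltrD ?hm ?hn ?leq_maxl ?leq_maxr.
Qed.

Lemma norm_cvg_le x s y B n0 : norm_cvg x s ->
  (forall k, (n0 <= k)%N -> N (x k - y) <= B) -> N (s - y) <= B.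
Proof.
move=> xs h; apply/ler_addgt0Pr => e /xs[m hm].
pose k := maxn m n0; apply: le_trans (is_norm_sub_le Nn _ (x k) _) _.
by rewrite addrC lerD ?h ?leq_maxr// ltW// hm// leq_maxl.
Qed.

Lemma norm_cvg_isom x s (L : V -> V) : (forall u v, L (u - v) = L u - L v) ->
  (forall u, N (L u) = N u) -> norm_cvg x s -> norm_cvg (fun k => L (x k)) (L s).
Proof.
by move=> LB LN xs e /xs[n hn]; exists n => k /hn; rewrite -LB LN.
Qed.

Lemma norm_cvg_eq x y s : (forall k, x k = y k) -> norm_cvg x s -> norm_cvg y s.
Proof. by move=> /funext ->. Qed.

End norm_limits.

(** * The open mapping argument for isometric actions *)

Section open_mapping.
Variables (R : realType) (G : groupType) (V : lmodType R[i]) (N : V -> R).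
Variables (act : G -> V -> V) (S : seq G).
Hypothesis Nn : is_norm N.
Hypothesis Nc : norm_complete N.
Hypothesis NZ : forall a x, N (a *: x) = Normc.normc a * N x.
Hypothesis actD : forall g x y, act g (x + y) = act g x + act g y.
Hypothesis actZ : forall g a x, act g (a *: x) = a *: act g x.
Hypothesis actN : forall g x, N (act g x) = N x.
Hypothesis fgS : forall g, exists n, g \in word_ball S n.

Implicit Types (z w : G -> G -> V) (b : G -> V).

Let cocyc z := forall g h k,
  act g (z h k) + z g (h * k)%g = z (g * h)%g k + z g h.

Let bdry z b := forall g h, z g h = b g + act g (b h) - b (g * h)%g.

Hypothesis H2 : forall z, cocyc z -> exists b, bdry z b.

Let actNx g x : act g (- x) = - act g x.
Proof. by rewrite -scaleN1r actZ scaleN1r. Qed.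

Let actB g x y : act g (x - y) = act g x - act g y.
Proof. by rewrite actD actNx. Qed.

Let cocycB z w : cocyc z -> cocyc w -> cocyc (z - w).
Proof.
move=> cz cw g h k.
have E u v : (z - w) u v = z u v - w u v by [].
by rewrite !E actB addrACA -opprD cz cw opprD addrACA.
Qed.

Let cocycD z w : cocyc z -> cocyc w -> cocyc (z + w).
Proof.
move=> cz cw g h k.
have E u v : (z + w) u v = z u v + w u v by [].
by rewrite !E actD addrACA cz cw addrACA.
Qed.

Let cocycZ (a : R[i]) z : cocyc z -> cocyc (a *: z).
Proof.
move=> cz g h k.
have E u v : (a *: z) u v = a *: z u v by [].
by rewrite !E actZ -!scalerDr cz.
Qed.

Let cocyc0 : cocyc 0.
Proof.
move=> g h k; have E u v : (0 : G -> G -> V) u v = 0 by [].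
by rewrite !E addr0 -(scale0r (0 : V)) actZ !scale0r addr0.
Qed.

Let half : R := 2^-1.
Let half0 : 0 < half. Proof. by rewrite invr_gt0. Qed.
Let halfn0 n : 0 < half ^+ n. Proof. by rewrite exprn_gt0. Qed.
Let halfD n : half ^+ n.+1 + half ^+ n.+1 = half ^+ n.
Proof. by rewrite exprS -mulrDl -mulr2n -[half *+ 2]mulr_natr mulVf ?mul1r ?pnatr_eq0. Qed.
Let half_le m n : (m <= n)%N -> half ^+ n <= half ^+ m.
Proof.
move=> mn; apply: ler_wiXn2l => //; first exact: ltW half0.
by rewrite invf_le1 ?ler1n// ltr0n.
Qed.
Let half_small e : 0 < e -> exists n, half ^+ n < e.
Proof.
move=> e0; exists (Num.truncn e^-1).+1.
rewrite exprVn invf_plt ?posrE ?exprn_gt0//.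
apply: lt_le_trans (truncnS_gt _) _.
by rewrite -natrX ler_nat ltnW// ltn_expl.
Qed.

(** These sets are basic neighbourhoods of 0 for pointwise convergence; a single index governs both
    the finite set of pairs and the tolerance. *)
Let nearz m z : Prop := forall g h, g \in word_ball S m -> h \in word_ball S m ->
  N (z g h) <= half ^+ m.

(** A bound on [S] is enough: the relation b(sg) = b(s) + s b(g) - z(s,g) controls the other values
    of [b] through [z]. *)
Let solv z (r : R) : Prop :=
  exists2 b, bdry z b & forall s, s \in S -> N (b s) <= r.

Let solvB z w r t : solv z r -> solv w t -> solv (z - w) (r + t).
Proof.
move=> [b zb br] [c wc ct]; exists (b - c) => [g h|s sS]; last first.
  by apply: le_trans (is_normB Nn _ _) _; rewrite lerD ?br ?ct.
have E u v : (z - w) u v = z u v - w u v by [].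
have F u : (b - c) u = b u - c u by [].
by rewrite E !F zb wc actB sub_combine.
Qed.

Let ex_bound z : cocyc z -> exists n : nat, solv z n%:R.
Proof.
move=> /H2[b zb].
suff [n hn] : exists n : nat, forall s, s \in S -> N (b s) <= n%:R by exists n, b.
elim: (S) => [|s r [n hn]]; first by exists 0%N.
exists (n + (Num.truncn (N (b s))).+1)%N => t; rewrite inE natrD => /orP[/eqP ->|/hn tn].
  by apply: le_trans (ltW (truncnS_gt _)) _; rewrite lerDr.
by apply: le_trans tn _; rewrite lerDl.
Qed.

(* Baire category, as a nested sequence of neighbourhoods: otherwise the limit
   cocycle would have no primitive bounded on [S]. *)
Let baire : exists (n : nat) z0 m, cocyc z0 /\ forall z, cocyc z -> nearz m (z - z0) ->
  forall m', exists z', [/\ cocyc z', solv z' n%:R & nearz m' (z' - z)].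
Proof.
apply: contrapT => hN.
have step (q : nat * (G -> G -> V) * nat) : exists p : (G -> G -> V) * nat,
    cocyc q.1.2 -> [/\ cocyc p.1, nearz q.2 (p.1 - q.1.2) &
      forall z', cocyc z' -> nearz p.2 (z' - p.1) -> ~ solv z' q.1.1%:R].
  case: q => [[n z0] m] /=; apply: contrapT => h; apply: hN; exists n, z0, m.
  split; first by apply: contrapT => cz; apply: h; exists (0, 0%N).
  move=> z cz zm m'; apply: contrapT => h'; apply: h; exists (z, m') => _.
  by split => // z' cz' zz' sz'; apply: h'; exists z'.
have /choice[f hf] := step.
(* Stage n chooses a cocycle and a neighbourhood of it free of cocycles solvable with bound n. The
   maximum makes the indices strictly increase, which forces convergence. *)
pose st := fix st n := if n is k.+1 then
    let p := f (k, (st k).1, (st k).2.+1) in (p.1, maxn p.2 (st k).2.+1)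
  else ((0 : G -> G -> V), 0%N).
pose zn n := (st n).1; pose mn n := (st n).2.
have czn n : cocyc (zn n).
  by elim: n => [|n IH]; [exact: cocyc0|case: (hf (n, zn n, (mn n).+1) IH)].
have mnS n : ((mn n).+1 <= mn n.+1)%N by rewrite leq_maxr.
have mn_ge n : (n <= mn n)%N by elim: n => // n IH; exact: leq_ltn_trans IH (mnS n).
have mn_le k l : (k <= l)%N -> (mn k <= mn l)%N.
  elim: l => [|l IH]; first by rewrite leqn0 => /eqP ->.
  rewrite leq_eqVlt => /orP[/eqP -> //|/IH kl].
  exact: leq_trans kl (ltnW (mnS l)).
have znear n : nearz (mn n).+1 (zn n.+1 - zn n).
  by have [_ + _] := hf (n, zn n, (mn n).+1) (czn n).
have avoid n z' : cocyc z' -> nearz (mn n.+1) (z' - zn n.+1) -> ~ solv z' n%:R.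
  move=> cz' zz'; have [_ _] := hf (n, zn n, (mn n).+1) (czn n); apply => //.
  move=> g h gm hm; have le := leq_maxl (f (n, zn n, (mn n).+1)).2 (mn n).+1.
  apply: le_trans (zz' _ _ _ _) _; rewrite ?half_le//.
  - exact: word_ball_le gm.
  - exact: word_ball_le hm.
(* One stage moves by at most 2^-(m+1) = 2^-m - 2^-(m+1), so the moves telescope and the limit stays
   in every chosen neighbourhood. *)
have tele k l g h : g \in word_ball S (mn k) -> h \in word_ball S (mn k) -> (k <= l)%N ->
    N (zn l g h - zn k g h) <= half ^+ mn k - half ^+ mn l.
  move=> gk hk; elim: l => [|l IH].
    by rewrite leqn0 => /eqP ->; rewrite !subrr (is_norm0 Nn).
  rewrite leq_eqVlt => /orP[/eqP ->|]; first by rewrite !subrr (is_norm0 Nn).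
  rewrite ltnS => kl; have kl' := leq_trans (mn_le _ _ kl) (leqnSn _).
  apply: le_trans (is_norm_sub_le Nn _ (zn l g h) _) _.
  have h1 := znear l g h (word_ball_le kl' gk) (word_ball_le kl' hk).
  rewrite -[N _]/(N (zn l.+1 g h - zn l g h)) in h1.
  have h2 := IH kl; have h3 := half_le (mnS l); have h4 := halfD (mn l).
  by move: h1 h2 h3 h4; set A := N _; set B := N _ => *; lra.
have lim g h : exists x, norm_cvg N (fun n => zn n g h) x.
  have [i gi] := fgS g; have [j hj] := fgS h.
  have gm k : (maxn i j <= k)%N -> g \in word_ball S (mn k).
    by rewrite geq_max => /andP[ik _]; apply: word_ball_le gi; exact: leq_trans ik (mn_ge k).
  have hm k : (maxn i j <= k)%N -> h \in word_ball S (mn k).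
    by rewrite geq_max => /andP[_ jk]; apply: word_ball_le hj; exact: leq_trans jk (mn_ge k).
  apply: Nc => e e0; have [n hn] := half_small e0.
  have key k l : (maxn (maxn i j) n <= k)%N -> (k <= l)%N ->
      N (zn l g h - zn k g h) < e.
    rewrite geq_max => /andP[ijk nk] kl.
    apply: le_lt_trans (tele _ _ _ _ (gm _ ijk) (hm _ ijk) kl) _.
    apply: le_lt_trans hn; apply: le_trans (half_le (leq_trans nk (mn_ge k))).
    by rewrite lerBlDr lerDl ltW.
  exists (maxn (maxn i j) n) => k l nk nl; have [kl|lk] := leqP k l.
    by rewrite (is_norm_distC Nn) key.
  by apply: key => //; exact: ltnW.
have /choice[y hy] := fun p : G * G => lim p.1 p.2.
pose z g h := y (g, h).
have hz g h : norm_cvg N (fun n => zn n g h) (z g h) by exact: (hy (g, h)).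
have cz : cocyc z.
  move=> g h k; apply: (@norm_cvg_uniq _ _ N Nn
     (fun n => zn n (g * h)%g k + zn n g h)).
    apply: (@norm_cvg_eq _ _ _ (fun n => act g (zn n h k) + zn n g (h * k)%g)).
      by move=> n; exact: czn.
    apply: (norm_cvgD Nn) => //.
    exact: (norm_cvg_isom (actB g) (actN g)).
  exact: (norm_cvgD Nn).
(* The limit cocycle has a primitive with some integer bound n on [S], although it lies in the
   neighbourhood that stage n kept free of such cocycles. *)
have [n zs] := ex_bound cz.
apply: (avoid n z cz) => // g h gm hm.
apply: (@norm_cvg_le _ _ _ Nn (fun n => zn n g h) _ _ _ n.+1) => // k nk.
apply: le_trans (tele _ _ _ _ gm hm nk) _.
by rewrite lerBlDr lerDl ltW.
Qed.

(** Translation to the origin: a small [z] is the difference of [z + z0] and [z0], both approximable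
    by cocycles solvable with bound [n]. Each approximation is taken at level m'+1 because the two
    errors add up. *)
Let approx : exists (K : R) m, 0 < K /\ forall z, cocyc z -> nearz m z ->
  forall m', exists z', [/\ cocyc z', solv z' K & nearz m' (z - z')].
Proof.
have [n [z0 [m [cz0 h]]]] := baire.
(* The summand 1 keeps the constant positive when [n] is 0. *)
exists (n%:R + n%:R + 1), m; split; first by rewrite ltr_wpDl// addr_ge0.
move=> z cz zm m'.
have [|z1 [cz1 s1 n1]] := h (z + z0) (cocycD cz cz0) _ m'.+1; first by rewrite addrK.
have [|z2 [cz2 s2 n2]] := h z0 cz0 _ m'.+1.
  by rewrite subrr => g k _ _; rewrite (is_norm0 Nn) ltW.
exists (z1 - z2); split; first exact: cocycB.
  have [b zb hb] := solvB s1 s2; exists b => // s /hb /le_trans; apply.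
  by rewrite lerDl.
move=> g k gm km.
have gm' := word_ball_le (leqnSn m') gm; have km' := word_ball_le (leqnSn m') km.
have E : (z - (z1 - z2)) g k = (z2 - z0) g k - (z1 - (z + z0)) g k.
  rewrite -[LHS]/(z g k - (z1 g k - z2 g k)).
  rewrite -[RHS]/(z2 g k - z0 g k - (z1 g k - (z g k + z0 g k))).
  rewrite !opprB [z g k + z0 g k]addrC.
  move: (z g k) (z1 g k) (z2 g k) (z0 g k) => p q r s.
  by rewrite addrA [RHS]addrA [r - s + _]addrA subrK [p + r]addrC.
rewrite E; apply: le_trans (is_normB Nn _ _) _; rewrite -halfD lerD//.
  exact: n2.
exact: n1.
Qed.

Let N_bounded (x : nat -> V) B n0 : (forall k, (n0 <= k)%N -> N (x k) <= B) ->
  exists C, forall k, N (x k) <= C.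
Proof.
elim: n0 B => [|n0 IH] B h; first by exists B => k; exact: h.
apply: (IH (Num.max B (N (x n0)))) => k; rewrite leq_eqVlt => /orP[/eqP <-|/h xB].
  by rewrite le_max lexx orbT.
by rewrite le_max xB.
Qed.

(** Approximate solvability becomes exact by iteration: w_0 = z and w_(n+1) = 2 (w_n - p_n) with p_n
    a solvable approximation of w_n, so that z = sum 2^-n p_n. Summing the primitives with the same
    coefficients gives the bound 2K on [S]. *)
Let solve : exists (K : R) m, 0 < K /\ forall z, cocyc z -> nearz m z -> solv z K.
Proof.
have [K [m [K0 h]]] := approx.
exists (K + K), m; split; first exact: addr_gt0.
move=> z cz zm.
(* The n-th approximation is required on the ball of radius m+n+1, so that each fixed pair of group
   elements is eventually controlled; otherwise the remainders could grow there. *)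
have /choice[p hp] : forall q : (G -> G -> V) * nat, exists z' : G -> G -> V,
    cocyc q.1 -> nearz m q.1 ->
    [/\ cocyc z', solv z' K & nearz (m + q.2).+1 (q.1 - z')].
  move=> [w k] /=; have [[cw wm]|nw] := pselect (cocyc w /\ nearz m w).
    by have [z' hz'] := h w cw wm (m + k).+1; exists z'.
  by exists 0 => cw wm; case: nw.
pose two : R[i] := (2 : R)%:C%C.
pose w := fix w n := if n is k.+1 then two *: (w k - p (w k, k)) else z.
have nz2 a x : N ((a : R)%:C%C *: x) = `|a| * N x by rewrite NZ normc_real.
have wP n : cocyc (w n) /\ nearz m (w n).
  elim: n => [//|n [cw wm]]; have [cp _ np] := hp (w n, n) cw wm.
  split; first by apply: cocycZ; exact: cocycB.
  move=> g k gm km; rewrite -[X in N X]/(two *: ((w n - p (w n, n)) g k)).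
  rewrite nz2 ger0_norm//.
  have mle : (m <= (m + n).+1)%N by rewrite leqW// leq_addr.
  apply: le_trans (ler_wpM2l _ (np _ _ (word_ball_le mle gm) (word_ball_le mle km))) _ => //.
  rewrite mulr_natl mulr2n halfD; apply: half_le; exact: leq_addr.
have pP n : [/\ cocyc (p (w n, n)), solv (p (w n, n)) K &
    nearz (m + n).+1 (w n - p (w n, n))] by have [cw wm] := wP n; exact: hp.
have /choice[b hb] : forall n, exists b, bdry (p (w n, n)) b /\
    forall s, s \in S -> N (b s) <= K.
  by move=> n; have [_ [b hb1 hb2] _] := pP n; exists b.
(* Once the pair lies in the controlled balls, the remainder w has norm at most 2 and w - p at most
   1, whence 3; finitely many earlier terms only change the constant. *)
have pbound g k : exists C, forall n, N (p (w n, n) g k) <= C.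
  have [i gi] := fgS g; have [j kj] := fgS k.
  apply: (@N_bounded _ 3 (maxn i j).+1) => -[//|n]; rewrite ltnS geq_max => /andP[iN jN].
  have gn l : (n <= l)%N -> g \in word_ball S (m + l).+1.
    by move=> nl; apply: word_ball_le gi; rewrite (leq_trans iN)// (leq_trans nl)// leqW// leq_addl.
  have kn l : (n <= l)%N -> k \in word_ball S (m + l).+1.
    by move=> nl; apply: word_ball_le kj; rewrite (leq_trans jN)// (leq_trans nl)// leqW// leq_addl.
  have h1 l : (n <= l)%N -> N ((w l - p (w l, l)) g k) <= 1.
    move=> nl; have [_ _ np] := pP l.
    by apply: le_trans (np _ _ (gn _ nl) (kn _ nl)) _; exact: (@half_le 0).
  have h2 : N (w n.+1 g k) <= 2.
    rewrite -[X in N X]/(two *: ((w n - p (w n, n)) g k)) nz2 ger0_norm//.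
    by have := h1 n (leqnn n); set A := N _ => *; lra.
  have E : p (w n.+1, n.+1) g k = w n.+1 g k - (w n.+1 - p (w n.+1, n.+1)) g k.
    by rewrite -[(_ - _) g k]/(w n.+1 g k - p (w n.+1, n.+1) g k) opprB addrC subrK.
  rewrite E; apply: le_trans (is_normB Nn _ _) _.
  have := h1 n.+1 (leqnSn n); move: h2; set A := N _; set B := N _ => *; lra.
(* The bound on [S] is uniform in n. Induction on word length extends it to every [g], with a
   constant depending on [g]; this suffices for convergence at [g]. *)
have bbound g : exists C, forall n, N (b n g) <= C.
  have [l] := fgS g; move: l g; apply: word_ball_ind.
    have [C hC] := pbound 1%g 1%g; exists C => n; have := hC n.
    by rewrite (hb n).1 mulg1 addrAC subrr add0r actN.
  move=> s g sS [C hC]; have [D hD] := pbound s g; exists (K + C + D) => n.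
  have -> : b n (s * g)%g = b n s + act s (b n g) - p (w n, n) s g.
    by rewrite (hb n).1 opprB addrC subrK.
  apply: le_trans (is_normB Nn _ _) _; rewrite lerD//.
  by apply: le_trans (is_normD Nn _ _) _; rewrite actN lerD// (hb n).2.
(* Partial sums of the primitive; by [Bbdry] the coboundary of [B n] misses [z] by exactly 2^-n
   w_n. *)
pose B n g := \sum_(i < n) (half ^+ i)%:C%C *: b i g.
have BS n g : B n.+1 g = B n g + (half ^+ n)%:C%C *: b n g.
  by rewrite /B big_ord_recr.
have Bbdry n g k : z g k - (half ^+ n)%:C%C *: w n g k =
    B n g + act g (B n k) - B n (g * k)%g.
  elim: n => [|n IH].
    by rewrite /B !big_ord0 expr0 scale1r subrr subr0 add0r -(scale0r (0 : V)) actZ !scale0r.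
  rewrite !BS actD actZ.
  have -> : (half ^+ n.+1)%:C%C *: w n.+1 g k =
      (half ^+ n)%:C%C *: w n g k - (half ^+ n)%:C%C *: p (w n, n) g k.
    rewrite -[w n.+1 g k]/(two *: (w n g k - p (w n, n) g k)) scalerA.
    rewrite /two -rmorphM/= exprSr -mulrA mulVf ?pnatr_eq0// mulr1.
    by rewrite scalerBr.
  rewrite opprB addrCA IH addrC (hb n).1 scalerBr scalerDr.
  by rewrite [B n g + _ *: _ + _]addrACA opprD [RHS]addrACA.
have tele C g k l : (forall n, N (b n g) <= C) -> (k <= l)%N ->
    N (B l g - B k g) <= C * (2 * half ^+ k - 2 * half ^+ l).
  move=> hC; elim: l => [|l IH].
    by rewrite leqn0 => /eqP ->; rewrite !subrr mulr0 (is_norm0 Nn).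
  rewrite leq_eqVlt => /orP[/eqP ->|]; first by rewrite !subrr mulr0 (is_norm0 Nn).
  rewrite ltnS => kl; apply: le_trans (is_norm_sub_le Nn _ (B l g) _) _.
  rewrite BS [B l g + _]addrC addrK nz2 ger0_norm ?(ltW (halfn0 _))//.
  have := IH kl; have := ler_wpM2l (ltW (halfn0 l)) (hC l).
  by have := halfD l; set A := N _; set D := N _ => *; nra.
have lim g : exists x, norm_cvg N (fun n => B n g) x.
  have [C0 hC0] := bbound g; pose C := Num.max C0 1.
  have hC n : N (b n g) <= C by rewrite le_max hC0.
  have Cpos : 0 < C by rewrite lt_max ltr01 orbT.
  apply: Nc => e e0; have [|n hn] := @half_small (e / (2 * C)).
    by rewrite divr_gt0// mulr_gt0.
  have key k l : (n <= k)%N -> (k <= l)%N -> N (B l g - B k g) < e.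
    move=> nk kl; apply: le_lt_trans (tele _ _ _ _ hC kl) _.
    apply: (@le_lt_trans _ _ (2 * C * half ^+ n)).
      by have h1 := half_le nk; have h2 := halfn0 l; nra.
    by rewrite mulrC -ltr_pdivlMr// mulr_gt0.
  exists n => k l nk nl; have [kl|lk] := leqP k l.
    by rewrite (is_norm_distC Nn) key.
  by apply: key => //; exact: ltnW.
have /choice[y hy] := lim.
exists y => [g k|s sS].
  apply: (@norm_cvg_uniq _ _ N Nn (fun n => B n g + act g (B n k) - B n (g * k)%g)).
    apply: (@norm_cvg_eq _ _ _ (fun n => z g k - (half ^+ n)%:C%C *: w n g k)) => //.
    have [i gi] := fgS g; have [j kj] := fgS k.
    move=> e e0; have [n hn] := half_small e0.
    exists (maxn n (maxn i j)).+1 => -[//|l]; rewrite ltnS !geq_max => /and3P[nl il jl].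
    rewrite opprB addrC subrK nz2 ger0_norm ?(ltW (halfn0 _))//.
    rewrite -[w l.+1 g k]/(two *: ((w l - p (w l, l)) g k)) nz2 ger0_norm//.
    have [_ _ np] := pP l.
    have gl : g \in word_ball S (m + l).+1.
      by apply: word_ball_le gi; rewrite (leq_trans il)// leqW// leq_addl.
    have kl : k \in word_ball S (m + l).+1.
      by apply: word_ball_le kj; rewrite (leq_trans jl)// leqW// leq_addl.
    have h1 := np _ _ gl kl; have h2 := @half_le 0 (m + l).+1 isT; rewrite expr0 in h2.
    have h3 := half_le nl; have h4 := halfD l; have h5 := halfn0 l.+1.
    move: h1; set A := N _ => h1; have A1 : A <= 1 by exact: le_trans h1 h2.
    by nra.
  apply: (norm_cvgD Nn); last first.
    have NN u : N (- u) = N u by exact: is_normN.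
    apply: (norm_cvg_isom (L := fun u => - u)) => // u v; exact: opprD.
  apply: (norm_cvgD Nn) => //; exact: (norm_cvg_isom (actB g) (actN g)).
(* Telescoping from B_0 = 0 gives K (2 - 2 * 2^-k) for the k-th partial sum, hence at most 2K in the
   limit. *)
rewrite -[y s]subr0; apply: (@norm_cvg_le _ _ _ Nn (fun n => B n s) _ _ _ 0%N) => // k _.
have := tele K s 0%N k (fun n => (hb n).2 s sS) isT.
rewrite /B big_ord0 !subr0 expr0 mulr1; have := halfn0 k.
by set A := N _ => *; nra.
Qed.

(** Rescaling by 2^-m / r moves the cocycle into the neighbourhood where [solve] applies. The bound
    [r] is any positive number because the maximum of the norms on the ball may be 0. *)
Lemma bounded_primitive : exists (K : R) m, 0 < K /\
  forall z, cocyc z -> forall r, 0 < r ->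
    (forall g h, g \in word_ball S m -> h \in word_ball S m -> N (z g h) <= r) ->
  exists2 b, bdry z b & forall s, s \in S -> N (b s) <= K * r.
Proof.
have [K [m [K0 h]]] := solve.
exists (K / half ^+ m), m; split; first by rewrite divr_gt0.
move=> z cz r r0 zr.
have nz2 a x : N ((a : R)%:C%C *: x) = `|a| * N x by rewrite NZ normc_real.
pose c : R := half ^+ m / r; have c0 : 0 < c by rewrite divr_gt0.
have [||b zb hb] := h (c%:C%C *: z); first exact: cocycZ.
  move=> g k gm km; rewrite -[X in N X]/(c%:C%C *: z g k) nz2 gtr0_norm//.
  by rewrite /c mulrAC ler_pdivrMr// ler_pM2l// zr.
exists (fun g => (c^-1)%:C%C *: b g) => [g k|s sS].
  rewrite actZ -scalerDr -scalerBr -zb -[(_ *: z) g k]/(c%:C%C *: z g k) scalerA.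
  by rewrite -rmorphM/= mulVf ?gt_eqF// scale1r.
rewrite nz2 gtr0_norm ?invr_gt0// /c invf_div mulrC -mulrA.
by rewrite [_^-1 * r]mulrC ler_wpM2r ?hb// divr_ge0// ltW.
Qed.

End open_mapping.

Lemma sum_half_le1 (R : realType) (B : set nat) : finite_set B ->
  \sum_(i \in B) (2^-1 : R) ^+ i.+1 <= 1.
Proof.
move=> fB; have [n Bn] : exists n, B `<=` `I_n.
  exists (\max_(i <- fset_set B) i).+1 => i Bi /=; rewrite ltnS.
  by apply: (@leq_bigmax_seq _ _ xpredT id) => //; rewrite in_fset_set// inE.
have f0 i : 0 <= (2^-1 : R) ^+ i.+1 by rewrite exprn_ge0// invr_ge0.
apply: le_trans (ler_fsum_subset f0 (finite_II n) Bn) _.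
rewrite -(@fsbig_ord _ _ _ n (fun i => (2^-1 : R) ^+ i.+1)) /=.
suff -> : \sum_(i < n) (2^-1 : R) ^+ i.+1 = 1 - 2^-1 ^+ n.
  by rewrite gerBl exprn_ge0// invr_ge0.
elim: n {Bn} => [|n IH]; first by rewrite big_ord0 expr0 subrr.
by rewrite big_ord_recr /= IH exprS; lra.
Qed.

Lemma ler_sum_mem (R : realType) (I : eqType) (s : seq I) (F : I -> R) x :
  x \in s -> (forall i, 0 <= F i) -> F x <= \sum_(i <- s) F i.
Proof. by move=> xs F0; rewrite (big_rem x)//= lerDl sumr_ge0. Qed.

(** * Diagonals of a Hilbert-Schmidt matrix *)

Section HS_components.
Variables (R : realType) (G : groupType).
Implicit Types (S T : HS R G) (g h k : G).

Lemma hscomp_subproof T :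
  (fun p : G * G => (T (delta (p.1 * p.2)%g) p.1)^*%C) \in @square_summable R (G * G)%type.
Proof.
rewrite inE /= /sqsum; apply: le_lt_trans (sqsum_lty (hsmat T)).
rewrite /sqsum [leRHS](@reindex_esum _ _ _ [set: (G * G)%type] _
  (fun p => ((p.1 * p.2)%g, p.1))).
  by apply: le_esum => p _; rewrite /normc2 normc_conj.
rewrite setTT_bijective; exists (fun p => (p.2, (p.2^-1 * p.1)%g)) => -[a b] /=.
  by rewrite mulKg.
by rewrite mulVKg.
Qed.

(* The diagonals [h |-> <T (delta (h k)), delta h>] of [T] identify [HS_Ad_lambda]
   with an l2-direct sum over [k : G] of copies of [ell2_lambda]. *)
Definition hscomp k T : ell2 R G := hscol (Ell2 (hscomp_subproof T)) k.

Lemma hscompE k T h : hscomp k T h = T (delta (h * k)%g) h.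
Proof. exact: conjcK. Qed.

Lemma hscomp_sum T A : finite_set A ->
  \sum_(k \in A) l2norm (hscomp k T) ^+ 2 <= hsnorm T ^+ 2.
Proof.
move=> fA; apply: le_trans (hscol_sum _ fA) _; apply: ler_sq; first exact: l2norm_ge0.
rewrite hsnormE /l2norm; apply: ler_wsqrtr; rewrite fine_le//.
- by rewrite ge0_fin_numE ?sqsum_lty// sqsum_ge0.
- by rewrite ge0_fin_numE ?sqsum_lty// sqsum_ge0.
rewrite /sqsum [leRHS](@reindex_esum _ _ _ [set: (G * G)%type] _
  (fun p => ((p.1 * p.2)%g, p.1))).
  by apply: le_esum => p _; rewrite /normc2 normc_conj.
rewrite setTT_bijective; exists (fun p => (p.2, (p.2^-1 * p.1)%g)) => -[a b] /=.
  by rewrite mulKg.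
by rewrite mulVKg.
Qed.

Lemma hscompD k S T : hscomp k (S + T) = hscomp k S + hscomp k T.
Proof.
apply: ell2P => h; rewrite -[RHS]/(hscomp k S h + hscomp k T h).
by rewrite !hscompE.
Qed.

Lemma hscompN k T : hscomp k (- T) = - hscomp k T.
Proof. by apply: ell2P => h; rewrite -[RHS]/(- hscomp k T h) !hscompE. Qed.

(** Conjugation by [lambda g] moves the entry in column a and row h to column g a and row g h. The
    label h^-1 a of its diagonal is unchanged, so each diagonal is translated within itself. *)
Lemma hscomp_ad k g T : hscomp k (ad_lambda g T) = lambda g (hscomp k T).
Proof.
apply: ell2P => h; rewrite -[RHS]/(hscomp k T (g^-1 * h)%g) !hscompE.
by rewrite ad_lambdaE lambda_delta mulgA.
Qed.

Lemma hscomp_ext S T : (forall k, hscomp k S = hscomp k T) -> S = T.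
Proof.
move=> ST; apply: HS_ext => a; apply: ell2P => h.
have := congr1 (fun x : ell2 R G => x h) (ST (h^-1 * a)%g).
by rewrite !hscompE mulVKg.
Qed.

(** The entry in column a and row h lies on the diagonal labelled h^-1 a, which dictates the matrix
    [K]; reindexing turns its square sum into that of the family. *)
Lemma hs_of_comp (f : G -> ell2 R G) (B : R) : 0 <= B ->
  (forall A, finite_set A -> \sum_(k \in A) l2norm (f k) ^+ 2 <= B ^+ 2) ->
  exists2 T, forall k, hscomp k T = f k & hsnorm T <= B.
Proof.
move=> B0 fB; pose K (p : G * G) := f (p.2^-1 * p.1)%g p.2.
have Ksum : (sqsum K <= (B ^+ 2)%:E)%E.
  rewrite /sqsum (@reindex_esum _ _ _ [set: (G * G)%type] _
    (fun p => ((p.2 * p.1)%g, p.2))); last first.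
    rewrite setTT_bijective; exists (fun p => ((p.2^-1 * p.1)%g, p.2)) => -[a b] /=.
      by rewrite mulKg.
    by rewrite mulVKg.
  rewrite (@eq_esum _ _ _ _ (fun p => (normc2 (f p.1 p.2))%:E)); last first.
    by move=> [a b] _; rewrite /K /= mulKg.
  rewrite -(@esum_pair _ _ _ (fun a b => normc2 (f a b))); last first.
    by move=> a b; exact: normc2_ge0.
  rewrite (@eq_esum _ _ _ _ (fun k => (l2norm (f k) ^+ 2)%:E)); last first.
    by move=> k _; rewrite l2norm_sqE.
  by apply: esum_le_bound => A [fA _]; exact: fB.
have KS : K \in @square_summable R (G * G)%type.
  by rewrite inE /=; apply: le_lt_trans Ksum _; rewrite ltry.
exists (hsop (Ell2 KS)) => [k|].
  by apply: ell2P => h; rewrite hscompE hsop_delta /= /K /= mulKg.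
rewrite hsnormE hsopK -ler_sqr ?nnegrE//; last exact: l2norm_ge0.
by rewrite -lee_fin l2norm_sqE.
Qed.

End HS_components.

(** * Bounded primitives with Hilbert-Schmidt values *)

Section HS_primitive.
Variables (R : realType) (G : groupType) (S : seq G).
Hypothesis fgS : forall g, exists n, g \in word_ball S n.
Hypothesis H2 : cohomology_zero (ell2_lambda R G) 2.

(** Word length and position in a word ball enumerate G injectively, so powers of 1/2 can be
    distributed over it. The weights will make norm bounds on the diagonals strictly positive
    without spoiling summability. *)
Lemma countable_weights : exists eps : G -> R, (forall k, 0 < eps k) /\
  forall A, finite_set A -> \sum_(k \in A) eps k <= 1.
Proof.
have /choice[n hn] := fgS.
pose f g := choice.pickle (n g, index g (word_ball S (n g))).
have f_inj : injective f.
  move=> g h /(pcan_inj choice.pickleK)[ngh].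
  rewrite ngh => /(congr1 (nth 1%g (word_ball S (n h)))).
  by rewrite !nth_index// -ngh.
exists (fun k => 2^-1 ^+ (f k).+1); split=> [k|A fA].
  by rewrite exprn_gt0// invr_gt0.
rewrite -(@fsbig_image _ _ _ _ _ A f (fun i => (2^-1 : R) ^+ i.+1)); last first.
  by move=> g h _ _; exact: f_inj.
by apply: sum_half_le1; exact: finite_image.
Qed.

(** Each diagonal is a 2-cocycle in l2(G) and is solved separately. Since the constant [K] is the
    same for all diagonals, the squared bounds add up to a finite total. *)
Lemma HS_bounded_primitive : exists (K : R) m, 0 < K /\
  forall z : G -> G -> HS R G,
    (forall g h k, ad_lambda g (z h k) + z g (h * k)%g = z (g * h)%g k + z g h) ->
  forall r, 0 < r ->
    (forall g h, g \in word_ball S m -> h \in word_ball S m -> hsnorm (z g h) <= r) ->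
  exists2 b : G -> HS R G,
    (forall g h, z g h = b g + ad_lambda g (b h) - b (g * h)%g) &
    forall s, s \in S -> hsnorm (b s) <= K * r.
Proof.
have [||K [m [K0 hK]]] := @bounded_primitive R G (ell2 R G) (@l2norm R G)
  lambda S (@l2norm_is_norm R G) (@l2norm_complete R G) (@l2normZ R G)
  (@lambdaD R G) _ (@l2norm_lambda R G) fgS.
- by move=> g a x; apply: ell2P.
- exact: (cohomology_zero2P H2).
(* One r^2 for each pair in the ball, and one more for the weights. *)
pose W := word_ball S m; pose M : R := (size W * size W)%:R + 1.
have M0 : 0 < M by rewrite ltr_wpDl.
exists (K * Num.sqrt M), m; split; first by rewrite mulr_gt0// sqrtr_gt0.
move=> z cz r r0 zr.
have [eps [eps0 epsA]] := countable_weights.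
(* Squared bound for the k-th diagonal on the ball. The weight makes it positive even where the
   diagonal vanishes, as [bounded_primitive] demands. *)
pose q k : R := \sum_(g <- W) \sum_(h <- W) l2norm (hscomp k (z g h)) ^+ 2 +
  r ^+ 2 * eps k.
have q0 k : 0 < q k.
  rewrite ltr_wpDl//; last by rewrite mulr_gt0// exprn_gt0.
  by apply: sumr_ge0 => g _; apply: sumr_ge0 => h _; exact: sqr_ge0.
have qA A : finite_set A -> \sum_(k \in A) q k <= M * r ^+ 2.
  move=> fA; rewrite fsbig_finite//= big_split/= -mulr_sumr.
  rewrite /M mulrDl mul1r lerD//; last first.
    by rewrite ler_piMr ?sqr_ge0// -fsbig_finite// epsA.
  rewrite exchange_big/=.
  apply: (@le_trans _ _ (\sum_(g <- W) \sum_(h <- W) r ^+ 2)); last first.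
    by rewrite !big_const_seq !count_predT !iter_addr_0 -mulrnA mulr_natl.
  rewrite big_seq [leRHS]big_seq; apply: ler_sum => g gW.
  rewrite exchange_big/= big_seq [leRHS]big_seq; apply: ler_sum => h hW.
  rewrite -fsbig_finite//; apply: le_trans (hscomp_sum _ fA) _.
  by apply: ler_sq; [exact: hsnorm_ge0|exact: zr].
have /choice[b hb] : forall k, exists b : G -> ell2 R G,
    (forall g h, hscomp k (z g h) = b g + lambda g (b h) - b (g * h)%g) /\
    forall s, s \in S -> l2norm (b s) <= K * Num.sqrt (q k).
  move=> k; have [||g h gW hW|b hb1 hb2] := hK (fun g h => hscomp k (z g h)) _ (Num.sqrt (q k)).
  - by move=> g h l; rewrite -hscomp_ad -!hscompD cz.
  - by rewrite sqrtr_gt0.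
  - rewrite -(ger0_norm (l2norm_ge0 _)) -sqrtr_sqr ler_wsqrtr//.
    apply: (@le_trans _ _ (\sum_(g <- W) \sum_(h <- W) l2norm (hscomp k (z g h)) ^+ 2)).
      apply: le_trans (ler_sum_mem gW _) => [|x]; last by apply: sumr_ge0 => *; exact: sqr_ge0.
      by apply: (ler_sum_mem (F := fun h => l2norm (hscomp k (z g h)) ^+ 2) hW) => x;
        exact: sqr_ge0.
    by rewrite lerDl mulr_ge0 ?sqr_ge0// ltW.
  - by exists b.
have bS s A : s \in S -> finite_set A ->
    \sum_(k \in A) l2norm (b k s) ^+ 2 <= (K * Num.sqrt M * r) ^+ 2.
  move=> sS fA.
  apply: (@le_trans _ _ (\sum_(k \in A) K ^+ 2 * q k)).
    rewrite !fsbig_finite//; apply: ler_sum => k _.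
    rewrite -[q k](sqr_sqrtr (ltW (q0 k))) -exprMn.
    by apply: ler_sq; [exact: l2norm_ge0 | exact: (hb k).2].
  have -> : (K * Num.sqrt M * r) ^+ 2 = K ^+ 2 * (M * r ^+ 2).
    by rewrite !exprMn sqr_sqrtr ?mulrA// ltW.
  by rewrite -mulr_fsumr; apply: ler_wpM2l; [exact: sqr_ge0|exact: qA].
have bz k g h : b k (g * h)%g = b k g + lambda g (b k h) - hscomp k (z g h).
  by rewrite (hb k).1 opprB addrC subrK.
(* Square summability over the diagonals is also needed outside [S], else the values would not be
   operators; word induction and Minkowski provide it. *)
have bG g : exists2 B, 0 <= B & forall A, finite_set A ->
    \sum_(k \in A) l2norm (b k g) ^+ 2 <= B ^+ 2.
  have [n] := fgS g; move: n g; apply: word_ball_ind.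
    exists (hsnorm (z 1%g 1%g)) => [|A fA]; first exact: hsnorm_ge0.
    apply: le_trans (hscomp_sum (z 1%g 1%g) fA).
    rewrite !fsbig_finite//; apply: ler_sum => k _.
    by rewrite (hb k).1 mulg1 addrAC subrr add0r l2norm_lambda.
  move=> s g sS [B B0 hB].
  have P0 : 0 <= K * Num.sqrt M * r by rewrite !mulr_ge0 ?sqrtr_ge0// ltW.
  exists (K * Num.sqrt M * r + B + hsnorm (z s g)) => [|A fA].
    by rewrite !addr_ge0//; exact: hsnorm_ge0.
  apply: (@l2_minkowski _ _ setT (fun k => l2norm (b k s) + l2norm (b k g))
    (fun k => l2norm (hscomp k (z s g)))) => //.
  - by rewrite addr_ge0.
  - exact: hsnorm_ge0.
  - by move=> k; rewrite addr_ge0//; exact: l2norm_ge0.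
  - by move=> k; exact: l2norm_ge0.
  - by move=> k; exact: l2norm_ge0.
  - move=> k; rewrite bz; apply: le_trans (is_normB (@l2norm_is_norm R G) _ _) _.
    rewrite lerD// -(l2norm_lambda s (b k g)).
    exact: (is_normD (@l2norm_is_norm R G)).
  - move=> E [fE _].
    apply: (@l2_minkowski _ _ setT (fun k => l2norm (b k s))
      (fun k => l2norm (b k g))) => //.
    + by move=> k; exact: l2norm_ge0.
    + by move=> k; exact: l2norm_ge0.
    + by move=> k; rewrite addr_ge0//; exact: l2norm_ge0.
    + by move=> D [fD _]; exact: bS.
    + by move=> D [fD _]; exact: hB.
  - by move=> E [fE _]; exact: hscomp_sum.
have /choice[T hT] : forall g, exists T : HS R G, (forall k, hscomp k T = b k g) /\
    (g \in S -> hsnorm T <= K * Num.sqrt M * r).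
  move=> g; have [gS|gS] := boolP (g \in S).
    have [||T hT1 hT2] := @hs_of_comp R G (fun k => b k g) (K * Num.sqrt M * r).
    - by rewrite !mulr_ge0 ?sqrtr_ge0// ltW.
    - by move=> A; exact: bS.
    - by exists T.
  have [B B0 hB] := bG g; have [T hT _] := hs_of_comp B0 hB.
  by exists T.
exists T => [g h|s sS]; last exact: (hT s).2.
apply: hscomp_ext => k; rewrite !hscompD hscompN hscomp_ad !(hT _).1.
exact: (hb k).1.
Qed.

End HS_primitive.

(** * Formal power series with operator coefficients *)

Section multi_indices.
Variable n : nat.
Implicit Types a b c : multi_index n.

Definition madd a b : multi_index n := [ffun i => (a i + b i)%N].
Definition mzero : multi_index n := [ffun=> 0%N].

Lemma maddA a b c : madd a (madd b c) = madd (madd a b) c.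
Proof. by apply/ffunP => i; rewrite !ffunE addnA. Qed.

Lemma maddC a b : madd a b = madd b a.
Proof. by apply/ffunP => i; rewrite !ffunE addnC. Qed.

Lemma mdegD a b : mdeg (madd a b) = (mdeg a + mdeg b)%N.
Proof. by rewrite /mdeg -big_split/=; apply: eq_bigr => i _; rewrite ffunE. Qed.

Lemma mdeg_eq0 a : (mdeg a == 0%N) = (a == mzero).
Proof.
rewrite /mdeg sum_nat_eq0; apply/forallP/eqP => [h|-> i]; last by rewrite ffunE.
by apply/ffunP => i; rewrite ffunE; exact/eqP/h.
Qed.

Lemma mdeg0 : mdeg mzero = 0%N.
Proof. by apply/eqP; rewrite mdeg_eq0. Qed.

Lemma coord_le_mdeg a i : (a i <= mdeg a)%N.
Proof. by rewrite /mdeg (bigD1 i)//= leq_addr. Qed.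

Definition box_index N (b : {ffun 'I_n -> 'I_N.+1}) : multi_index n :=
  [ffun i => b i : nat].

Lemma box_index_inj N : injective (@box_index N).
Proof.
move=> b c /ffunP bc; apply/ffunP => i; apply: val_inj.
by have := bc i; rewrite !ffunE.
Qed.

Lemma box_indexP N a : (forall i, a i <= N)%N -> exists b : {ffun 'I_n -> 'I_N.+1}, a = box_index b.
Proof.
move=> aN; exists [ffun i => inord (a i)]; apply/ffunP => i.
by rewrite !ffunE inordK// ltnS.
Qed.

(** Both parts of a decomposition have entries at most [mdeg a], so all decompositions are found in
    a finite box. *)
Definition splits a : seq (multi_index n * multi_index n) :=
  [seq (box_index p.1, box_index p.2) |
     p <- enum {: {ffun 'I_n -> 'I_(mdeg a).+1} * {ffun 'I_n -> 'I_(mdeg a).+1}}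
   & madd (box_index p.1) (box_index p.2) == a].

Lemma splits_uniq a : uniq (splits a).
Proof.
rewrite map_inj_uniq ?filter_uniq// -?enumT ?enum_uniq// => -[b c] [b' c'] /= [].
by move=> /box_index_inj -> /box_index_inj ->.
Qed.

Lemma mem_splits a p : (p \in splits a) = (madd p.1 p.2 == a).
Proof.
apply/mapP/eqP => [[[b c]]|pa].
  by rewrite mem_filter => /andP[/eqP bc _] -> /=.
case: p pa => b c /= pa.
have [b' hb] : exists b' : {ffun 'I_n -> 'I_(mdeg a).+1}, b = box_index b'.
  by apply: box_indexP => i; rewrite -pa (leq_trans _ (coord_le_mdeg _ i))// ffunE leq_addr.
have [c' hc] : exists c' : {ffun 'I_n -> 'I_(mdeg a).+1}, c = box_index c'.
  by apply: box_indexP => i; rewrite -pa (leq_trans _ (coord_le_mdeg _ i))// ffunE leq_addl.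
by exists (b', c'); rewrite ?hb ?hc// mem_filter mem_enum /= -hb -hc pa eqxx.
Qed.

Lemma splits_mdeg a p : p \in splits a -> mdeg a = (mdeg p.1 + mdeg p.2)%N.
Proof. by rewrite mem_splits => /eqP <-; rewrite mdegD. Qed.

End multi_indices.

Arguments mzero {n}.

(** * Series without constant term and their defects *)

Section formal_series.
Variables (n : nat) (A : zmodType) (mul : A -> A -> A).
Hypothesis mulDl : forall x y z, mul (x + y) z = mul x z + mul y z.
Hypothesis mulDr : forall x y z, mul x (y + z) = mul x y + mul x z.
Hypothesis mulA : forall x y z, mul x (mul y z) = mul (mul x y) z.

Implicit Types (f g h : multi_index n -> A) (a : multi_index n).

Definition conv f g a : A := \sum_(p <- splits a) mul (f p.1) (g p.2).

(* [(1 + f) (1 + g) = 1 + cop f g]; series here have no constant term. *)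
Definition cop f g a : A := f a + g a + conv f g a.

Let mul0l x : mul 0 x = 0.
Proof. by apply: (addrI (mul 0 x)); rewrite -mulDl !addr0. Qed.

Let mul0r x : mul x 0 = 0.
Proof. by apply: (addrI (mul x 0)); rewrite -mulDr !addr0. Qed.

Lemma convDl f g h a : conv (fun b => f b + g b) h a = conv f h a + conv g h a.
Proof. by rewrite /conv -big_split/=; apply: eq_bigr => p _; rewrite mulDl. Qed.

Lemma convDr f g h a : conv f (fun b => g b + h b) a = conv f g a + conv f h a.
Proof. by rewrite /conv -big_split/=; apply: eq_bigr => p _; rewrite mulDr. Qed.

(** Both sides run over the triples with sum [a]; the two nested enumerations are duplicate-free
    lists with the same elements. *)
Lemma conv_triples (F : multi_index n -> multi_index n -> multi_index n -> A) a :
  \sum_(p <- splits a) \sum_(q <- splits p.1) F q.1 q.2 p.2 =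
  \sum_(p <- splits a) \sum_(q <- splits p.2) F p.1 q.1 q.2.
Proof.
pose L1 := [seq (q.1, q.2, p.2) | p <- splits a, q <- splits p.1].
pose L2 := [seq (p.1, q.1, q.2) | p <- splits a, q <- splits p.2].
transitivity (\sum_(t <- L1) F t.1.1 t.1.2 t.2); first by rewrite big_allpairs_dep.
transitivity (\sum_(t <- L2) F t.1.1 t.1.2 t.2); last by rewrite big_allpairs_dep.
apply: perm_big; apply: uniq_perm.
- apply: allpairs_uniq_dep => [|p _|]; rewrite ?splits_uniq//.
  move=> [p q] [p' q'] /allpairsPdep[p1 [q1 [_ q1p ->]]] /allpairsPdep[p2 [q2 [_ q2p ->]]].
  rewrite /= => -[e1 e2 e3].
  have E : q1 = q2 by rewrite (surjective_pairing q1) e1 e2 -surjective_pairing.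
  subst q2; move: q1p q2p; rewrite !mem_splits => /eqP h1 /eqP h2.
  have Ep : p1 = p2 by rewrite (surjective_pairing p1) (surjective_pairing p2) -h1 -h2 e3.
  by subst p2.
- apply: allpairs_uniq_dep => [|p _|]; rewrite ?splits_uniq//.
  move=> [p q] [p' q'] /allpairsPdep[p1 [q1 [_ q1p ->]]] /allpairsPdep[p2 [q2 [_ q2p ->]]].
  rewrite /= => -[e1 e2 e3].
  have E : q1 = q2 by rewrite (surjective_pairing q1) e3 e2 -surjective_pairing.
  subst q2; move: q1p q2p; rewrite !mem_splits => /eqP h1 /eqP h2.
  have Ep : p1 = p2 by rewrite (surjective_pairing p1) (surjective_pairing p2) -h1 -h2 e1.
  by subst p2.
- move=> [[x y] z]; apply/allpairsPdep/allpairsPdep => -[p [q [pa qp [-> -> ->]]]].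
  + exists (q.1, madd q.2 p.2), (q.2, p.2); split => //; rewrite mem_splits//=.
    by move: pa qp; rewrite !mem_splits => /eqP <- /eqP <-; rewrite maddA.
  + exists (madd p.1 q.1, q.2), (p.1, q.1); split => //; rewrite mem_splits//=.
    by move: pa qp; rewrite !mem_splits => /eqP <- /eqP <-; rewrite maddA.
Qed.

Lemma convA f g h a : conv (conv f g) h a = conv f (conv g h) a.
Proof.
have mulsl x (r : seq (multi_index n * multi_index n)) F :
    mul (\sum_(p <- r) F p) x = \sum_(p <- r) mul (F p) x.
  by rewrite (big_morph (mul^~ x) (fun u v => mulDl u v x) (mul0l x)).
have mulsr x (r : seq (multi_index n * multi_index n)) F :
    mul x (\sum_(p <- r) F p) = \sum_(p <- r) mul x (F p).
  by rewrite (big_morph (mul x) (mulDr x) (mul0r x)).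
rewrite /conv; under eq_bigr do rewrite mulsl.
rewrite (conv_triples (fun b c d => mul (mul (f b) (g c)) (h d))).
by apply: eq_bigr => p _; rewrite mulsr; apply: eq_bigr => q _; rewrite mulA.
Qed.

Lemma copA f g h a : cop (cop f g) h a = cop f (cop g h) a.
Proof.
have L : conv (cop f g) h a = conv f h a + conv g h a + conv (conv f g) h a.
  by rewrite /cop !convDl.
have M : conv f (cop g h) a = conv f g a + conv f h a + conv f (conv g h) a.
  by rewrite /cop !convDr.
rewrite [LHS]/cop [RHS]/cop L M /cop convA !addrA.
by rewrite [LHS](ACl (1*2*4*6*3*5*7)%AC).
Qed.

(** A factor of full degree is paired with the zero constant term of the other series. Hence a
    convolution in degree [a] does not see the unknown of degree [a], which is what permits a
    construction degree by degree. *)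
Lemma eq_conv_lt f f' g g' a : f mzero = 0 -> f' mzero = 0 -> g mzero = 0 -> g' mzero = 0 ->
  (forall b, (mdeg b < mdeg a)%N -> f b = f' b) ->
  (forall b, (mdeg b < mdeg a)%N -> g b = g' b) -> conv f g a = conv f' g' a.
Proof.
move=> f0 f'0 g0 g'0 ff' gg'; rewrite /conv big_seq [RHS]big_seq.
apply: eq_bigr => p /splits_mdeg pa.
have [p1|p1] := posnP (mdeg p.1).
  by move/eqP: p1; rewrite mdeg_eq0 => /eqP ->; rewrite f0 f'0 !mul0l.
have [p2|p2] := posnP (mdeg p.2).
  by move/eqP: p2; rewrite mdeg_eq0 => /eqP ->; rewrite g0 g'0 !mul0r.
by rewrite ff' ?gg'// pa -[X in (X < _)%N]addn0 ?ltn_add2l// addnC ltn_add2r.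
Qed.

Lemma eq_cop f f' g g' a :
  (forall b, (mdeg b <= mdeg a)%N -> f b = f' b) ->
  (forall b, (mdeg b <= mdeg a)%N -> g b = g' b) -> cop f g a = cop f' g' a.
Proof.
move=> ff' gg'; rewrite /cop ff'// gg'//; congr (_ + _).
rewrite /conv big_seq [RHS]big_seq; apply: eq_bigr => p /splits_mdeg pa.
by rewrite ff' ?gg'// pa ?leq_addl ?leq_addr.
Qed.

Lemma cop0l f g a : (forall b, (mdeg b <= mdeg a)%N -> f b = 0) -> cop f g a = g a.
Proof.
by move=> f0; rewrite (@eq_cop f (fun=> 0) g g)// /cop add0r /conv big1 ?addr0// => p _.
Qed.

Lemma conv_mdeg_le1 f g a : f mzero = 0 -> g mzero = 0 -> (mdeg a <= 1)%N ->
  conv f g a = 0.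
Proof.
move=> f0 g0 a1; rewrite /conv big_seq big1// => p /splits_mdeg pa.
have [p1|p1] := posnP (mdeg p.1).
  by move/eqP: p1; rewrite mdeg_eq0 => /eqP ->; rewrite f0 mul0l.
have [p2|p2] := posnP (mdeg p.2).
  by move/eqP: p2; rewrite mdeg_eq0 => /eqP ->; rewrite g0 mul0r.
by move: a1; rewrite pa leqNgt (leq_add p1 p2).
Qed.

Let cop0 f g : f mzero = 0 -> g mzero = 0 -> cop f g mzero = 0.
Proof. by move=> f0 g0; rewrite /cop f0 g0 !add0r conv_mdeg_le1 ?mdeg0. Qed.

Variables (star : A -> A).
Hypothesis starD : forall x y, star (x + y) = star x + star y.
Hypothesis starM : forall x y, star (mul x y) = mul (star y) (star x).

Lemma star0 : star 0 = 0.
Proof. by apply: (addrI (star 0)); rewrite -starD !addr0. Qed.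

Lemma conv_star f g a : star (conv f g a) = conv (star \o g) (star \o f) a.
Proof.
rewrite /conv (big_morph star starD star0).
rewrite [RHS](perm_big [seq (p.2, p.1) | p <- splits a]) /=.
  by rewrite [RHS]big_map; apply: eq_bigr => p _; rewrite starM.
apply: uniq_perm; first exact: splits_uniq.
  by rewrite map_inj_uniq ?splits_uniq// => -[b c] [b' c'] [-> ->].
move=> [b c]; rewrite mem_splits /=; apply/eqP/mapP => [bc|[[x y]]].
  by exists (c, b) => //; rewrite mem_splits /= maddC bc.
by rewrite mem_splits /= => /eqP <- [-> ->]; rewrite maddC.
Qed.

Lemma cop_star f g a : star (cop f g a) = cop (star \o g) (star \o f) a.
Proof. by rewrite /cop !starD conv_star [star (f a) + _]addrC. Qed.

Variables (G : groupType) (act : G -> A -> A).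
Hypothesis actD : forall u x y, act u (x + y) = act u x + act u y.
Hypothesis actM : forall u x y, act u (mul x y) = mul (act u x) (act u y).
Hypothesis actA : forall u v x, act (u * v)%g x = act u (act v x).
Hypothesis act_star : forall u x, star (act u x) = act u (star x).

Let act0 u : act u 0 = 0.
Proof. by apply: (addrI (act u 0)); rewrite -actD !addr0. Qed.

Lemma conv_act f g u a : act u (conv f g a) = conv (act u \o f) (act u \o g) a.
Proof.
rewrite /conv (big_morph (act u) (actD u) (act0 u)).
by apply: eq_bigr => p _; rewrite actM.
Qed.

Lemma cop_act f g u a : act u (cop f g a) = cop (act u \o f) (act u \o g) a.
Proof. by rewrite /cop !actD conv_act. Qed.

Section defects.
Variable x : G -> multi_index n -> A.
Hypothesis x0 : forall u, x u mzero = 0.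

(* The failures, in each degree, of [1 + x (u v) = (1 + x u) act_u (1 + x v)] and
   of [(1 + x u)^* (1 + x u) = 1]. *)
Definition cop_defect u v a : A := cop (x u) (act u \o x v) a - x (u * v)%g a.

Definition star_defect u a : A := cop (star \o x u) (x u) a.

Let defect_add u v a : cop (x u) (act u \o x v) a = x (u * v)%g a + cop_defect u v a.
Proof. by rewrite /cop_defect addrC subrK. Qed.

(** Associativity in disguise: the triple product for u, v, w is bracketed in two ways. As lower
    defects vanish, each bracketing equals the coefficient for uvw plus two defects in degree
    [a]. *)
Lemma cop_defect_cocycle a :
  (forall b u v, (mdeg b < mdeg a)%N -> cop_defect u v b = 0) ->
  forall u v w, act u (cop_defect v w a) + cop_defect u (v * w)%g a =
    cop_defect (u * v)%g w a + cop_defect u v a.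
Proof.
move=> ea u v w.
have E : cop (cop (x u) (act u \o x v)) (act (u * v)%g \o x w) a =
         cop (x u) (act u \o cop (x v) (act v \o x w)) a.
  rewrite copA; apply: eq_cop => // b _.
  by rewrite [RHS]cop_act; apply: eq_cop => // c _ /=; rewrite actA.
have lt b u' v' : (mdeg b < mdeg a)%N -> cop (x u') (act u' \o x v') b = x (u' * v')%g b.
  by move=> ba; rewrite defect_add ea// addr0.
have L : cop (cop (x u) (act u \o x v)) (act (u * v)%g \o x w) a =
    x (u * v * w)%g a + cop_defect (u * v)%g w a + cop_defect u v a.
  rewrite -defect_add {1}/cop (@eq_conv_lt _ (x (u * v)%g) _ (act (u * v)%g \o x w)) //=.
  - by rewrite defect_add [LHS](ACl (1*3*4*2)%AC).
  - by apply: cop0; rewrite ?x0//= x0 act0.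
  - by rewrite x0 act0.
  - by rewrite x0 act0.
  - by move=> b ba; exact: lt.
have M : cop (x u) (act u \o cop (x v) (act v \o x w)) a =
    x (u * v * w)%g a + cop_defect u (v * w)%g a + act u (cop_defect v w a).
  rewrite -mulgA -defect_add {1}/cop (@eq_conv_lt _ (x u) _ (act u \o x (v * w)%g)) //=.
  - by rewrite defect_add actD addrA [LHS](ACl (1*2*4*3)%AC).
  - by rewrite cop0 ?act0//= x0 act0.
  - by rewrite x0 act0.
  - by move=> b ba; rewrite lt.
move: E; rewrite L M -[LHS]addrA -[RHS]addrA => /addrI ->.
by rewrite addrC.
Qed.

(** The product of the series for u and v is isometric up to degree [a] because its factors are. It
    agrees below that degree with the series for uv, also isometric, and differs in degree [a] by
    the defect e; comparison leaves e + e^* = 0. *)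
Lemma cop_defect_skew a :
  (forall b u v, (mdeg b < mdeg a)%N -> cop_defect u v b = 0) ->
  (forall b u, (mdeg b <= mdeg a)%N -> star_defect u b = 0) ->
  forall u v, star (cop_defect u v a) = - cop_defect u v a.
Proof.
move=> ea wa u v; apply/eqP; rewrite -addr_eq0; apply/eqP.
pose y := cop (x u) (act u \o x v).
have lt b : (mdeg b < mdeg a)%N -> y b = x (u * v)%g b.
  by move=> ba; rewrite /y defect_add ea// addr0.
have star_0 : star (x (u * v)%g mzero) = 0 by rewrite x0 star0.
have y0 : y mzero = 0 by rewrite /y cop0//= x0 act0.
have L : cop (star \o y) y a = star_defect (u * v)%g a +
    (star (cop_defect u v a) + cop_defect u v a).
  rewrite /star_defect {1}/cop.
  rewrite (@eq_conv_lt _ (star \o x (u * v)%g) _ (x (u * v)%g)) //=.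
  - by rewrite /y defect_add starD addrA [LHS](ACl (1*3*5*2*4)%AC) [RHS]addrA.
  - by rewrite y0 star0.
  - by move=> b ba; rewrite lt.
rewrite wa// add0r in L; rewrite -L.
transitivity (cop (star \o (act u \o x v)) (cop (cop (star \o x u) (x u)) (act u \o x v)) a).
  transitivity (cop (cop (star \o (act u \o x v)) (star \o x u)) y a).
    by apply: eq_cop => // b _; rewrite /= /y cop_star.
  rewrite copA; apply: eq_cop => // b _; rewrite /y -copA.
  by apply: eq_cop.
transitivity (cop (star \o (act u \o x v)) (act u \o x v) a).
  apply: eq_cop => // b ba; apply: cop0l => c cb.
  by apply: wa; exact: leq_trans cb ba.
transitivity (act u (star_defect v a)); last by rewrite wa// act0.
by rewrite /star_defect cop_act; apply: eq_cop => // b _ /=; rewrite act_star.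
Qed.

End defects.

Section defect_perturbation.
Variables x y : G -> multi_index n -> A.
Hypotheses (x0 : forall u, x u mzero = 0) (y0 : forall u, y u mzero = 0).
Variables (a : multi_index n) (d : G -> A).
Hypothesis xy : forall b u, (mdeg b < mdeg a)%N -> y u b = x u b.
Hypothesis xya : forall u, y u a = x u a + d u.

(** A change in degree [a] enters linearly, since the convolution sees only lower degrees: the
    defect moves by a coboundary, so a primitive of it can cancel it. *)
Lemma cop_defect_perturb u v : cop_defect y u v a =
  cop_defect x u v a + (d u + act u (d v) - d (u * v)%g).
Proof.
rewrite /cop_defect /cop (@eq_conv_lt (y u) (x u) (act u \o y v) (act u \o x v)) //=.
- rewrite !xya actD opprD !addrA.
  by rewrite [LHS](ACl (1*3*5*6*2*4*7)%AC).
- by rewrite y0 act0.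
- by rewrite x0 act0.
- by move=> b ba; exact: xy.
- by move=> b ba; rewrite xy.
Qed.

Lemma star_defect_perturb u : star_defect y u a =
  star_defect x u a + (star (d u) + d u).
Proof.
rewrite /star_defect /cop (@eq_conv_lt (star \o y u) (star \o x u) (y u) (x u)) //=.
- rewrite !xya starD !addrA.
  by rewrite [LHS](ACl (1*3*5*2*4)%AC).
- by rewrite y0 star0.
- by rewrite x0 star0.
- by move=> b ba; rewrite xy.
- by move=> b ba; exact: xy.
Qed.

End defect_perturbation.

Lemma eq_cop_defect x y a u v :
  (forall b w, (mdeg b <= mdeg a)%N -> x w b = y w b) ->
  cop_defect x u v a = cop_defect y u v a.
Proof.
move=> xy; rewrite /cop_defect xy//; congr (_ - _).
by apply: eq_cop => b ba /=; rewrite xy.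
Qed.

Lemma eq_star_defect (x y : G -> multi_index n -> A) a u :
  (forall b w, (mdeg b <= mdeg a)%N -> x w b = y w b) ->
  star_defect x u a = star_defect y u a.
Proof. by move=> xy; apply: eq_cop => b ba /=; rewrite xy. Qed.

End formal_series.

(** * Order-by-order solution with a convergent majorant *)

Section majorant.
Variables (R : realType) (n : nat).
Implicit Types (a b : multi_index n).

(** Inverse squares are summable and reproduce themselves under convolution up to a constant, which
    a geometric sequence fails to do. *)
Definition wt (k : nat) : R := (k.+1%:R ^+ 2)^-1.

Lemma wt_gt0 k : 0 < wt k.
Proof. by rewrite invr_gt0 exprn_gt0// ltr0n. Qed.

Lemma sum_wt m : \sum_(j < m) wt j <= 2.
Proof.
suff h : \sum_(j < m.+1) wt j <= 2 - m.+1%:R^-1.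
  apply: (@le_trans _ _ (\sum_(j < m.+1) wt j)).
    by rewrite big_ord_recr /= lerDl ltW// wt_gt0.
  by apply: le_trans h _; rewrite gerBl invr_ge0.
elim: m => [|m IH]; first by rewrite big_ord_recl big_ord0 /wt expr1n invr1; lra.
rewrite big_ord_recr /=; apply: le_trans (lerD IH (lexx _)) _.
rewrite /wt; set x : R := m.+1%:R.
have x0 : 0 < x by rewrite ltr0n.
have -> : m.+2%:R = x + 1 :> R by rewrite -natr1.
rewrite -subr_ge0.
have -> : 2 - (x + 1)^-1 - (2 - x^-1 + ((x + 1) ^+ 2)^-1) = (x * (x + 1) ^+ 2)^-1.
  by field; rewrite !gt_eqF// addr_gt0.
by rewrite invr_ge0 mulr_ge0 ?sqr_ge0// ltW.
Qed.

(** Put x = j+1, y = k-j+1 and s = x+y-1 = k+1. From s^2 <= 2x^2 + 2y^2 follows 1/(xy)^2 <=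
    (2/s^2)(1/x^2 + 1/y^2); each of the two sums of weights is at most 2, whence 8. *)
Lemma wt_conv k : \sum_(j < k.+1) wt j * wt (k - j) <= 8 * wt k.
Proof.
apply: (@le_trans _ _ (\sum_(j < k.+1) (2 * wt k * wt j + 2 * wt k * wt (k - j)))).
  apply: ler_sum => j _; rewrite /wt.
  have jk : (j <= k)%N by rewrite -ltnS.
  set x : R := j.+1%:R; set y : R := (k - j).+1%:R.
  have x1 : 1 <= x by rewrite ler1n.
  have y1 : 1 <= y by rewrite ler1n.
  have -> : k.+1%:R = x + y - 1 :> R.
    rewrite /x /y -natrD addSn addnS subnKC// -[in RHS]natr1.
    by rewrite addrK.
  have s0 : 0 < x + y - 1 by lra.
  have x0 : 0 < x by lra.
  have y0 : 0 < y by lra.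
  rewrite -subr_ge0.
  have -> : 2 * ((x + y - 1) ^+ 2)^-1 * (x ^+ 2)^-1 + 2 * ((x + y - 1) ^+ 2)^-1 * (y ^+ 2)^-1
      - (x ^+ 2)^-1 * (y ^+ 2)^-1 =
      ((x - y) ^+ 2 + 2 * (x + y) - 1) / ((x + y - 1) ^+ 2 * x ^+ 2 * y ^+ 2).
    by field; rewrite !gt_eqF.
  apply: divr_ge0; last by apply: ltW; rewrite !mulr_gt0.
  by have := sqr_ge0 (x - y); lra.
rewrite big_split/= -!mulr_sumr.
have -> : \sum_(j < k.+1) wt (k - j) = \sum_(j < k.+1) wt j.
  rewrite (reindex_inj rev_ord_inj) /=; apply: eq_bigr => j _.
  by rewrite subSS subKn// -ltnS.
have := sum_wt k.+1; have := wt_gt0 k; nra.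
Qed.

Definition mwt a : R := \prod_(i < n) wt (a i).

Lemma mwt_gt0 a : 0 < mwt a.
Proof. by apply: prodr_gt0 => i _; exact: wt_gt0. Qed.

(** The product of sums expands into the sum over the whole box, which contains [s]; the terms are
    nonnegative. *)
Lemma sum_box_prod N (F : 'I_n -> nat -> R) (s : seq (multi_index n)) :
  (forall i k, 0 <= F i k) -> uniq s ->
  (forall a, a \in s -> forall i, (a i <= N)%N) ->
  \sum_(a <- s) \prod_(i < n) F i (a i) <= \prod_(i < n) \sum_(j < N.+1) F i j.
Proof.
move=> F0 us sN; pose H a := \prod_(i < n) F i (a i).
have H0 a : 0 <= H a by apply: prodr_ge0 => i _; exact: F0.
pose t := [seq box_index q | q <- enum {: {ffun 'I_n -> 'I_N.+1}}].
have ut : uniq t by rewrite map_inj_uniq -?enumT ?enum_uniq//; exact: box_index_inj.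
have st : [set` s] `<=` [set` t].
  move=> a /= /sN/box_indexP[b ->]; apply/mapP; exists b => //.
  by rewrite -?enumT mem_enum.
apply: (@le_trans _ _ (\sum_(a <- t) H a)).
  rewrite (@fsbig_seq _ _ _ _ s H us) (@fsbig_seq _ _ _ _ t H ut).
  by apply: ler_fsum_subset => //; exact: finite_seq.
rewrite bigA_distr_bigA /= /t big_map big_enum /=.
rewrite le_eqVlt; apply/orP; left; apply/eqP; apply: eq_bigr => b _.
by apply: eq_bigr => i _; rewrite ffunE.
Qed.

Lemma sum_mwt (A : set (multi_index n)) : finite_set A ->
  \sum_(a \in A) mwt a <= 2 ^+ n.
Proof.
move=> fA; rewrite fsbig_finite//=.
pose N := \max_(a <- fset_set A) mdeg a.
apply: (@le_trans _ _ (\prod_(i < n) \sum_(j < N.+1) wt j)).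
  apply: (@sum_box_prod N (fun=> wt)); rewrite ?fset_uniq//.
    by move=> _ k; rewrite ltW// wt_gt0.
  move=> a aA i; apply: leq_trans (coord_le_mdeg a i) _.
  by apply: (@leq_bigmax_seq _ _ xpredT (@mdeg n)).
rewrite -[n in 2 ^+ n]card_ord -prodr_const; apply: ler_prod => i _.
by rewrite sum_wt andbT sumr_ge0// => j _; rewrite ltW// wt_gt0.
Qed.

Lemma mwt_conv a : \sum_(p <- splits a) mwt p.1 * mwt p.2 <= 8 ^+ n * mwt a.
Proof.
(* Cut off beyond [a i], so that one box of side [mdeg a] serves all coordinates while each factor
   remains the one-variable convolution. *)
pose F i k : R := if (k <= a i)%N then wt k * wt (a i - k) else 0.
have F0 i k : 0 <= F i k.
  by rewrite /F; case: ifP => // _; rewrite mulr_ge0 ?ltW ?wt_gt0.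
have le p i : p \in splits a -> (p.1 i <= a i)%N.
  by rewrite mem_splits => /eqP <-; rewrite ffunE leq_addr.
have -> : \sum_(p <- splits a) mwt p.1 * mwt p.2 =
    \sum_(b <- [seq p.1 | p <- splits a]) \prod_(i < n) F i (b i).
  rewrite [RHS]big_map big_seq [RHS]big_seq; apply: eq_bigr => p pa.
  rewrite /mwt -big_split/=; apply: eq_bigr => i _; rewrite /F le//.
  move: pa; rewrite mem_splits => /eqP <-; rewrite ffunE.
  by rewrite addKn.
apply: (@le_trans _ _ (\prod_(i < n) \sum_(j < (mdeg a).+1) F i j)).
  apply: sum_box_prod => //.
    rewrite map_inj_in_uniq ?splits_uniq// => -[b c] [b' c'].
    rewrite !mem_splits /= => /eqP h /eqP h' bb'; rewrite -bb' in h' *.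
    congr pair; apply/ffunP => i; have := congr1 (fun m : multi_index n => m i) (etrans h (esym h')).
    by rewrite !ffunE => /addnI.
  move=> b /mapP[p pa ->] i; apply: leq_trans (coord_le_mdeg a i); exact: le.
rewrite -[n in 8 ^+ n]card_ord -prodr_const -big_split/=; apply: ler_prod => i _.
apply/andP; split; first by apply: sumr_ge0 => j _; exact: F0.
apply: le_trans (wt_conv (a i)).
rewrite (big_ord_widen (mdeg a).+1 (fun j => wt j * wt (a i - j))) ?ltnS ?coord_le_mdeg//.
rewrite [leRHS]big_mkcond/=; apply: ler_sum => j _.
by rewrite /F ltnS.
Qed.

(* Scaled so that [maj * maj <= eta maj] for the Cauchy product; see [maj_conv]. *)
Definition maj (eta rho : R) a : R := eta / 8 ^+ n * rho ^+ mdeg a * mwt a.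

Lemma maj_gt0 eta rho a : 0 < eta -> 0 < rho -> 0 < maj eta rho a.
Proof.
by move=> e0 r0; rewrite !mulr_gt0 ?mwt_gt0 ?invr_gt0 ?exprn_gt0.
Qed.

Lemma maj_conv eta rho a : 0 < eta -> 0 < rho ->
  \sum_(p <- splits a) maj eta rho p.1 * maj eta rho p.2 <= eta * maj eta rho a.
Proof.
move=> e0 r0.
have -> : \sum_(p <- splits a) maj eta rho p.1 * maj eta rho p.2 =
    (eta / 8 ^+ n) ^+ 2 * rho ^+ mdeg a * \sum_(p <- splits a) mwt p.1 * mwt p.2.
  rewrite mulr_sumr big_seq [RHS]big_seq; apply: eq_bigr => p pa.
  by rewrite /maj (splits_mdeg pa) exprD; ring.
apply: le_trans (ler_wpM2l _ (mwt_conv a)) _.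
  by rewrite mulr_ge0 ?sqr_ge0// exprn_ge0// ltW.
rewrite le_eqVlt; apply/orP; left; apply/eqP; rewrite /maj.
by field; rewrite expf_neq0// pnatr_eq0.
Qed.

(** The condition on [t] absorbs the powers of [rho]; what remains is at most eta (2/8)^n. *)
Lemma maj_sum eta rho (t : 'rV[R]_n) (A : set (multi_index n)) :
  0 < eta -> 0 < rho -> (forall i, rho * `|t ord0 i| <= 1) -> finite_set A ->
  \sum_(a \in A) maj eta rho a * `|mpow t a| <= eta.
Proof.
move=> e0 r0 ht fA.
apply: (@le_trans _ _ (\sum_(a \in A) eta / 8 ^+ n * mwt a)).
  rewrite !fsbig_finite//; apply: ler_sum => a _.
  rewrite /maj -!mulrA ler_pM2l// ler_pM2l ?invr_gt0 ?exprn_gt0//.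
  rewrite mulrCA -[leRHS]mulr1 ler_pM2l ?mwt_gt0//.
  rewrite /mpow normr_prod /mdeg -prodrXr -big_split/=.
  apply: (@le_trans _ _ (\prod_(i < n) (1 : R))); last by rewrite big1.
  apply: ler_prod => i _; rewrite normrX -exprMn.
  by rewrite exprn_ge0 ?exprn_ile1 ?mulr_ge0// ltW.
rewrite -mulr_fsumr -mulrA ler_piMr ?(ltW e0)//.
apply: le_trans (ler_wpM2l _ (sum_mwt fA)) _; first by rewrite invr_ge0 exprn_ge0.
by rewrite mulrC ler_pdivrMr ?exprn_gt0// mul1r lerXn2r ?nnegrE// ler_nat.
Qed.

End majorant.

(** * Degree-by-degree construction of the coefficients *)

Section formal_deformation.
Variables (R : realType) (G : groupType) (S : seq G).
Hypothesis fgS : forall g, exists n, g \in word_ball S n.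
Hypothesis H2 : cohomology_zero (ell2_lambda R G) 2.
Implicit Types (T : HS R G) (g h : G).

Let hsN := @hsnorm_is_norm R G.

Let half_norm T : hsnorm ((2^-1 : R)%:C%C *: T) = 2^-1 * hsnorm T.
Proof. by rewrite hsnormZ normc_real ger0_norm ?invr_ge0. Qed.

Let half_star T : hs_star ((2^-1 : R)%:C%C *: T) = (2^-1 : R)%:C%C *: hs_star T.
Proof. by rewrite hs_starZ conjc_real. Qed.

Let half_twice T : (2^-1 : R)%:C%C *: T + (2^-1 : R)%:C%C *: T = T.
Proof.
rewrite -scalerDl -rmorphD/= -[RHS]scale1r; congr (_ *: _).
by rewrite [2^-1 + _](_ : _ = 1)//; lra.
Qed.

(** Taking skew parts commutes with the coboundary and does not increase norms, so the skew part of
    a primitive of a skew cocycle is again a primitive. The bound on generators is then carried to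
    the whole ball without leaving it. *)
Lemma HS_skew_primitive : exists L (Q : R), [/\ (0 < L)%N, 0 < Q &
  forall e : G -> G -> HS R G,
    (forall g h k, ad_lambda g (e h k) + e g (h * k)%g = e (g * h)%g k + e g h) ->
    (forall g h, hs_star (e g h) = - e g h) -> forall r, 0 < r ->
    (forall g h, g \in word_ball S L -> h \in word_ball S L ->
       (g * h)%g \in word_ball S L -> hsnorm (e g h) <= r) ->
  exists b : G -> HS R G, [/\ forall g, hs_star (b g) = - b g,
    forall g h, e g h = b g + ad_lambda g (b h) - b (g * h)%g &
    forall g, g \in word_ball S L -> hsnorm (b g) <= Q * r]].
Proof.
have [K [m [K0 hK]]] := HS_bounded_primitive fgS H2.
(* Radius 2m contains the products of elements of the ball of radius m; the successor puts the
   generators in the ball even when m = 0. In [Q], the identity costs r, and each further letter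
   costs K r for the generator and r for the cocycle. *)
pose L := (m + m).+1; pose Q : R := L%:R * (K + 1) + 1.
exists L, Q; split => //.
  by rewrite ltr_wpDl// mulr_ge0// addr_ge0// ltW.
move=> e ce se r r0 er.
have mL g : g \in word_ball S m -> g \in word_ball S L.
  by apply: word_ball_le; rewrite leqW// leq_addr.
have [|b0 hb0 b0S] := hK e ce r r0.
  move=> g h gm hm; apply: er; [exact: mL|exact: mL|].
  by apply: word_ball_le (word_ballM gm hm); exact: leqnSn.
pose b g := (2^-1 : R)%:C%C *: (b0 g - hs_star (b0 g)).
have nb g : hsnorm (b g) <= hsnorm (b0 g).
  rewrite half_norm; have := is_normB hsN (b0 g) (hs_star (b0 g)).
  by rewrite hsnorm_star; set A := hsnorm _; set B := hsnorm _ => *; lra.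
exists b; split => [g|g h|g gL].
- by rewrite half_star hs_starD hs_starN hs_starK -scalerN opprB addrC.
- rewrite -[LHS]half_twice -{2}[e g h]opprK -se -scalerDr hb0 /b ad_lambdaZ.
  rewrite -scalerDr -scalerBr ad_lambdaD ad_lambdaN.
  rewrite hs_starD hs_starN hs_starD ad_lambda_star.
  by rewrite -sub_combine opprD opprK.
- apply: le_trans (nb g) _.
  (* Induction on word length inside the ball: every cocycle value used has both arguments and their
     product in the ball of radius [L]. *)
  suff h j k : (j <= L)%N -> k \in word_ball S j ->
      hsnorm (b0 k) <= (j%:R * (K + 1) + 1) * r by exact: (h L g (leqnn L) gL).
  have one_ball i : 1%g \in word_ball S i.
    by apply: (@word_ball_le _ S 0) => //; rewrite inE.
  elim: j k => [|j IH] k jL.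
    rewrite inE => /eqP ->; rewrite mul0r add0r mul1r.
    have := er 1%g 1%g (one_ball L) (one_ball L); rewrite mulg1 => /(_ (one_ball L)).
    by rewrite hb0 mulg1 addrAC subrr add0r hsnorm_ad.
  rewrite [X in k \in X]/= mem_cat => /orP[kj|/allpairsP[[s l]/= [sS lj ->]]].
    apply: le_trans (IH _ (ltnW jL) kj) _; rewrite ler_wpM2r ?(ltW r0)// lerD2r.
    by rewrite ler_wpM2r ?ler_nat// addr_ge0// ltW.
  have -> : b0 (s * l)%g = b0 s + ad_lambda s (b0 l) - e s l.
    by rewrite hb0 opprB addrC subrK.
  have sL : s \in word_ball S L.
    rewrite -[s]mulg1; apply: (@word_ball_le _ S 1) => //.
    by apply: word_ballS; rewrite ?inE.
  have h1 : hsnorm (e s l) <= r.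
    apply: er => //; first exact: word_ball_le (ltnW jL) _ lj.
    by apply: word_ball_le jL _ _; exact: word_ballS.
  have h2 := IH l (ltnW jL) lj; have h3 := b0S s sS.
  apply: le_trans (is_normB hsN _ _) _.
  apply: le_trans (lerD (is_normD hsN _ _) (lexx _)) _.
  rewrite hsnorm_ad -natr1; move: h1 h2 h3.
  by set A := hsnorm _; set B := hsnorm _; set C := hsnorm _ => *; nra.
Qed.

Variable n : nat.
Implicit Types a : multi_index n.

Local Notation cdef := (cop_defect (@hs_mul R G) (@ad_lambda R G)).
Local Notation sdef := (star_defect (@hs_mul R G) (@hs_star R G)).

Lemma munit_inj : injective (@munit n).
Proof.
by move=> i j /ffunP/(_ i); rewrite !ffunE eqxx; case: eqVneq.
Qed.

Lemma mdeg_munit i : mdeg (@munit n i) = 1%N.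
Proof.
rewrite /mdeg (bigD1 i)//= ffunE eqxx big1// => j ji.
by rewrite ffunE (negbTE ji).
Qed.

Lemma mdeg_le1 a : (mdeg a <= 1)%N -> a = mzero \/ exists i, a = munit i.
Proof.
rewrite leq_eqVlt ltnS leqn0 mdeg_eq0 => /orP[/eqP a1|/eqP ->]; last by left.
right; have [i ai] : exists i, (0 < a i)%N.
  apply: contrapT => h; have : mdeg a = 0%N.
    rewrite /mdeg big1// => i _; apply/eqP; rewrite -leqn0 leqNgt; apply/negP => ai.
    by apply: h; exists i.
  by rewrite a1.
exists i; apply/ffunP => j; rewrite ffunE.
have := a1; rewrite /mdeg (bigD1 i)//=; case: (eqVneq j i) => [->|ji].
  by move: ai; case: (a i) => [//|[//|k]] _; rewrite !addSn.
by rewrite (bigD1 j)//=; move: ai; case: (a i) => [//|k] _; case: (a j) => [//|l]; rewrite !addSn addnS.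
Qed.

Variable c : 'I_n -> G -> HS R G.
Hypothesis c_cocycle : forall i g h, c i (g * h)%g = c i g + ad_lambda g (c i h).
Hypothesis c_skew : forall i g, hs_star (c i g) = - c i g.

Variables (L : nat) (eta rho : R).

(** The norm estimate is kept only on the finite ball, where primitives are bounded uniformly; the
    algebraic identities hold on all of G. *)
Record partial_deformation (k : nat) (x : G -> multi_index n -> HS R G) : Prop :=
  PartialDeformation {
  pd0 : forall g, x g mzero = 0;
  pd1 : forall i g, x g (munit i) = c i g;
  pd_cop : forall a g h, (mdeg a <= k)%N -> cdef x g h a = 0;
  pd_star : forall a g, (mdeg a <= k)%N -> sdef x g a = 0;
  pd_maj : forall a g, (mdeg a <= k)%N -> g \in word_ball S L ->
    hsnorm (x g a) <= maj eta rho a }.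

Lemma conv_norm_le (f f' : multi_index n -> HS R G) (m : multi_index n -> R) a :
  f mzero = 0 -> f' mzero = 0 -> (forall b, 0 <= m b) ->
  (forall b, (mdeg b < mdeg a)%N -> hsnorm (f b) <= m b) ->
  (forall b, (mdeg b < mdeg a)%N -> hsnorm (f' b) <= m b) ->
  hsnorm (conv (@hs_mul R G) f f' a) <= \sum_(p <- splits a) m p.1 * m p.2.
Proof.
move=> f0 f'0 m0 fm fm'; apply: le_trans (is_norm_sum hsN _ _ _) _.
rewrite big_seq [leRHS]big_seq; apply: ler_sum => p /splits_mdeg pa.
have [p1|p1] := posnP (mdeg p.1).
  move/eqP: p1; rewrite mdeg_eq0 => /eqP ->.
  by rewrite f0 hs_mul0l (is_norm0 hsN) mulr_ge0.
have [p2|p2] := posnP (mdeg p.2).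
  move/eqP: p2; rewrite mdeg_eq0 => /eqP ->.
  by rewrite f'0 hs_mul0r (is_norm0 hsN) mulr_ge0.
apply: le_trans (hsnormM _ _) _.
apply: ler_pM; [exact: hsnorm_ge0|exact: hsnorm_ge0|apply: fm|apply: fm'].
  by rewrite pa -[X in (X < _)%N]addn0 ltn_add2l.
by rewrite pa -[X in (X < _)%N]add0n ltn_add2r.
Qed.

Hypothesis eta0 : 0 < eta.
Hypothesis rho0 : 0 < rho.
Variable Q : R.
Hypothesis etaQ : eta * (2^-1 + Q * (1 + 3 / 2)) <= 1.
Hypothesis prim : forall e : G -> G -> HS R G,
    (forall g h k, ad_lambda g (e h k) + e g (h * k)%g = e (g * h)%g k + e g h) ->
    (forall g h, hs_star (e g h) = - e g h) -> forall r, 0 < r ->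
    (forall g h, g \in word_ball S L -> h \in word_ball S L ->
       (g * h)%g \in word_ball S L -> hsnorm (e g h) <= r) ->
  exists b : G -> HS R G, [/\ forall g, hs_star (b g) = - b g,
    forall g h, e g h = b g + ad_lambda g (b h) - b (g * h)%g &
    forall g, g \in word_ball S L -> hsnorm (b g) <= Q * r].

Let cdefE x g h a : cdef x g h a =
  x g a + ad_lambda g (x h a) - x (g * h)%g a
  + conv (@hs_mul R G) (x g) (ad_lambda g \o x h) a.
Proof. by rewrite /cop_defect /cop addrAC. Qed.

(** The two corrections are compatible: subtracting a skew primitive changes the unitarity defect by
    d + d^* = 0. Positivity of [k] keeps the prescribed degree-one coefficients untouched. *)
Lemma partial_deformation_step k x : (0 < k)%N -> partial_deformation k x ->
  exists y, partial_deformation k.+1 y /\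
    forall a g, (mdeg a <= k)%N -> y g a = x g a.
Proof.
move=> k0 [x0 x1 xc xs xm].
have sD := @hs_starD R G; have sM := @hs_starM R G; have sK := @hs_starK R G.
have mDl := @hs_mulDl R G; have mDr := @hs_mulDr R G; have mA := @hs_mulA R G.
have aD := @ad_lambdaD R G; have aM := @ad_lambda_mul R G.
have aA := @ad_lambdaM R G; have aS := @ad_lambda_star R G.
(* half of the obstruction to unitarity restores it *)
pose w g a := conv (@hs_mul R G) (@hs_star R G \o x g) (x g) a.
pose r g a : HS R G := - ((2^-1 : R)%:C%C *: w g a).
(* The previous coefficient in degree k+1 satisfies no constraint and is discarded. *)
pose x' g a := if mdeg a == k.+1 then x g a + (r g a - x g a) else x g a.
have x'lo a g : (mdeg a <= k)%N -> x' g a = x g a.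
  by rewrite /x' => ak; case: eqVneq ak => // ->; rewrite ltnn.
have x'hi a g : mdeg a = k.+1 -> x' g a = r g a.
  by rewrite /x' => ->; rewrite eqxx addrC subrK.
have x'0 g : x' g mzero = 0 by rewrite x'lo ?mdeg0.
(* Self-adjointness of the obstruction is what makes r = -w/2 a solution of r + r^* + w = 0. *)
have w_star g a : hs_star (w g a) = w g a.
  rewrite /w (conv_star sD sM); congr (conv _ _ _ _).
  by apply/funext => b /=; rewrite sK.
have x's a g : (mdeg a <= k.+1)%N -> sdef x' g a = 0.
  rewrite leq_eqVlt ltnS => /orP[/eqP ak|ak]; last first.
    rewrite -(xs a g ak); apply: eq_star_defect => b u ba.
    by apply: x'lo; exact: leq_trans ba ak.
  rewrite /star_defect /cop.
  have -> : conv (@hs_mul R G) (@hs_star R G \o x' g) (x' g) a = w g a.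
    apply: (eq_conv_lt mDl mDr); rewrite /= ?x'0 ?x0 ?hs_star0// => b; rewrite ak ltnS => bk.
      by rewrite x'lo.
    by rewrite x'lo.
  rewrite /= !x'hi// /r hs_starN half_star w_star -opprD half_twice.
  by rewrite addNr.
have x'c a g h : (mdeg a <= k)%N -> cdef x' g h a = 0.
  move=> ak; rewrite -(xc a g h ak); apply: eq_cop_defect => b u ba.
  by apply: x'lo; exact: leq_trans ba ak.
have maj0 a : 0 <= maj eta rho a by apply/ltW/maj_gt0.
have conv_maj a f f' : mdeg a = k.+1 -> f mzero = 0 -> f' mzero = 0 ->
    (forall b, (mdeg b <= k)%N -> hsnorm (f b) <= maj eta rho b) ->
    (forall b, (mdeg b <= k)%N -> hsnorm (f' b) <= maj eta rho b) ->
    hsnorm (conv (@hs_mul R G) f f' a) <= eta * maj eta rho a.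
  move=> ak f0 f'0 fm fm'; apply: le_trans (maj_conv a eta0 rho0).
  by apply: conv_norm_le => // b; rewrite ak ltnS; [exact: fm|exact: fm'].
have hr a g : mdeg a = k.+1 -> g \in word_ball S L ->
    hsnorm (r g a) <= 2^-1 * (eta * maj eta rho a).
  move=> ak gL; rewrite (is_normN hsN) half_norm ler_pM2l ?invr_gt0//.
  apply: conv_maj => //=; first by rewrite x0 hs_star0.
    by move=> b bk; rewrite hsnorm_star; exact: xm.
  by move=> b bk; exact: xm.
have /choice[b hb] : forall a, exists b : G -> HS R G, mdeg a = k.+1 ->
    [/\ forall g, hs_star (b g) = - b g,
    forall g h, cdef x' g h a = b g + ad_lambda g (b h) - b (g * h)%g &
    forall g, g \in word_ball S L ->
      hsnorm (b g) <= Q * ((1 + 3 / 2) * (eta * maj eta rho a))].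
  move=> a; have [ak|ak] := eqVneq (mdeg a) k.+1; last by exists (fun=> 0) => /eqP; rewrite (negbTE ak).
  have em : 0 < eta * maj eta rho a by rewrite mulr_gt0// maj_gt0.
  have [|||g h gL hL ghL|b [b1 b2 b3]] := prim (e := fun g h => cdef x' g h a) _ _
    (r := (1 + 3 / 2) * (eta * maj eta rho a)).
  - apply: (cop_defect_cocycle mDl mDr mA aD aM aA x'0) => b u v.
    by rewrite ak ltnS; exact: x'c.
  - move=> g h; apply: (cop_defect_skew mDl mDr mA sD sM aD aM aS x'0) => [b u v|b u].
      by rewrite ak ltnS; exact: x'c.
    by rewrite ak; exact: x's.
  - by rewrite mulr_gt0//; lra.
  - rewrite cdefE !x'hi//.
    (* Three new coefficients of norm at most (eta/2) M, at g, h and gh, and one convolution of norm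
       at most eta M: this is the factor 1 + 3/2. *)
    apply: le_trans (is_normD hsN _ _) _.
    apply: le_trans (lerD (is_normB hsN _ _) (lexx _)) _.
    apply: le_trans (lerD (lerD (is_normD hsN _ _) (lexx _)) (lexx _)) _.
    rewrite hsnorm_ad.
    have h1 := hr a g ak gL; have h2 := hr a h ak hL; have h3 := hr a _ ak ghL.
    have h4 : hsnorm (conv (@hs_mul R G) (x' g) (ad_lambda g \o x' h) a) <=
        eta * maj eta rho a.
      apply: conv_maj => //=; first by rewrite x'0 ad_lambda0.
        by move=> b bk; rewrite x'lo// xm.
      by move=> b bk; rewrite hsnorm_ad x'lo// xm.
    move: h1 h2 h3 h4; set A := hsnorm _; set B := hsnorm _; set C := hsnorm _.
    by set D := hsnorm _ => *; lra.
  - by exists b.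
pose y g a := if mdeg a == k.+1 then x' g a + - b a g else x' g a.
have ylo a g : (mdeg a <= k)%N -> y g a = x' g a.
  by rewrite /y => ak; case: eqVneq ak => // ->; rewrite ltnn.
have yhi a g : mdeg a = k.+1 -> y g a = x' g a + - b a g.
  by rewrite /y => ->; rewrite eqxx.
have y0 g : y g mzero = 0 by rewrite ylo ?mdeg0.
exists y; split; last by move=> a g ak; rewrite ylo// x'lo.
split => //.
- by move=> i g; rewrite ylo ?mdeg_munit// x'lo ?mdeg_munit.
- move=> a g h; rewrite leq_eqVlt ltnS => /orP[/eqP ak|ak]; last first.
    rewrite -(x'c a g h ak); apply: eq_cop_defect => d u da.
    by apply: ylo; exact: leq_trans da ak.
  rewrite (cop_defect_perturb mDl mDr aD x'0 y0 (d := fun g => - b a g)).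
  + have [_ hb2 _] := hb a ak; rewrite hb2 ad_lambdaN opprK.
    by rewrite -opprD addrA [X in X + b a _]addrAC subrr sub0r addNr.
  + by move=> d u; rewrite ak ltnS; exact: ylo.
  + by move=> u; exact: yhi.
- move=> a g; rewrite leq_eqVlt ltnS => /orP[/eqP ak|ak]; last first.
    rewrite -(x's a g (leqW ak)); apply: eq_star_defect => d u da.
    by apply: ylo; exact: leq_trans da ak.
  rewrite (star_defect_perturb mDl mDr sD x'0 y0 (d := fun g => - b a g)).
  + have [hb1 _ _] := hb a ak; rewrite x's ?ak// add0r hs_starN hb1.
    by rewrite opprK subrr.
  + by move=> d u; rewrite ak ltnS; exact: ylo.
  + by move=> u; exact: yhi.
- move=> a g; rewrite leq_eqVlt ltnS => /orP[/eqP ak|ak] gL; last first.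
    by rewrite ylo// x'lo// xm.
  rewrite yhi// x'hi//; have [_ _ hb3] := hb a ak.
  apply: le_trans (is_normB hsN _ _) _.
  have h1 := hr a g ak gL; have h2 := hb3 g gL.
  apply: le_trans (lerD h1 h2) _.
  set M := maj _ _ _; have M0 : 0 <= M := maj0 a.
  (* The unitarity correction contributes 1/2 and the primitive Q (1 + 3/2); [etaQ] makes the total
     at most M, so the majorant is reproduced with no loss. *)
  have -> : 2^-1 * (eta * M) + Q * ((1 + 3 / 2) * (eta * M)) =
    eta * (2^-1 + Q * (1 + 3 / 2)) * M by ring.
  by rewrite -[leRHS]mul1r ler_wpM2r.
Qed.

Hypothesis c_maj : forall i g, g \in word_ball S L ->
  hsnorm (c i g) <= maj eta rho (munit i).

(** In degree one convolutions vanish, so multiplicativity is the 1-cocycle relation and unitarity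
    is skew-adjointness. *)
Lemma partial_deformation1 : exists x, partial_deformation 1 x.
Proof.
pose x g a := \sum_(i < n) if a == munit i then c i g else 0.
have x0 g : x g mzero = 0.
  rewrite /x big1// => i _; case: eqP => // /(congr1 (@mdeg n)).
  by rewrite mdeg0 mdeg_munit.
have x1 g i : x g (munit i) = c i g.
  rewrite /x (bigD1 i)//= eqxx big1 ?addr0// => j ji.
  by case: eqP => // /munit_inj ij; rewrite ij eqxx in ji.
have conv0 f f' a : f mzero = 0 -> f' mzero = 0 -> (mdeg a <= 1)%N ->
    conv (@hs_mul R G) f f' a = 0.
  by apply: conv_mdeg_le1; [exact: hs_mulDl|exact: hs_mulDr].
exists x; split => //.
- move=> a g h a1; rewrite cdefE conv0//=; last by rewrite x0 ad_lambda0.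
  rewrite addr0; case: (mdeg_le1 a1) => [->|[i ->]]; first by rewrite !x0 ad_lambda0 oppr0 !addr0.
  by rewrite !x1 c_cocycle subrr.
- move=> a g a1; rewrite /star_defect /cop conv0//=; last by rewrite x0 hs_star0.
  rewrite addr0; case: (mdeg_le1 a1) => [->|[i ->]]; first by rewrite x0 hs_star0 addr0.
  by rewrite !x1 c_skew addNr.
- move=> a g a1 gL; case: (mdeg_le1 a1) => [->|[i ->]]; last by rewrite x1 c_maj.
  by rewrite x0 (is_norm0 hsN) ltW// maj_gt0.
Qed.

Lemma full_deformation : exists x, forall k, partial_deformation k x.
Proof.
have [x1 hx1] := partial_deformation1.
have /choice[f hf] : forall q : nat * (G -> multi_index n -> HS R G),
    exists y, partial_deformation q.1.+1 q.2 -> partial_deformation q.1.+2 y /\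
      forall a g, (mdeg a <= q.1.+1)%N -> y g a = q.2 g a.
  move=> [k x] /=; have [hx|hx] := pselect (partial_deformation k.+1 x).
    by have [y hy] := @partial_deformation_step k.+1 x isT hx; exists y.
  by exists x.
pose X := fix X k := if k is j.+1 then f (j, X j) else x1.
have XP k : partial_deformation k.+1 (X k).
  by elim: k => [//|k IH]; case: (hf (k, X k) IH).
have XS k a g : (mdeg a <= k.+1)%N -> X k.+1 g a = X k g a.
  by have [_] := hf (k, X k) (XP k); apply.
have XE j k a g : (j <= k)%N -> (mdeg a <= j)%N -> X k g a = X j g a.
  elim: k => [|k IH]; first by rewrite leqn0 => /eqP ->.
  rewrite leq_eqVlt => /orP[/eqP <- //|]; rewrite ltnS => jk aj.
  by rewrite XS ?IH// (leq_trans aj)// leqW.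
(* Each coefficient is final once its degree has been treated; the diagonal choice collects the
   final values. *)
pose x g a := X (mdeg a) g a.
have xX a b g : (mdeg b <= mdeg a)%N -> x g b = X (mdeg a) g b.
  by move=> ba; rewrite /x -(XE _ (mdeg a)).
exists x => k; split.
- by move=> g; exact: (pd0 (XP _)).
- by move=> i g; exact: (pd1 (XP _)).
- move=> a g h _; rewrite (eq_cop_defect _ _ _ _ (y := X (mdeg a))).
    exact: (pd_cop (XP _)).
  by move=> b w; exact: xX.
- move=> a g _; rewrite (eq_star_defect _ _ _ (y := X (mdeg a))).
    exact: (pd_star (XP _)).
  by move=> b w; exact: xX.
- by move=> a g _ gL; apply: (pd_maj (XP (mdeg a))).
Qed.

End formal_deformation.

(** * Summation of the series *)

Section cauchy_product.
Variables (R : realType) (n : nat).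
Implicit Types (a b : multi_index n) (E : set (multi_index n)).

Let diag E : set (multi_index n * multi_index n) := [set p | E (madd p.1 p.2)].

Lemma fsum_splits (V : zmodType) (F : multi_index n * multi_index n -> V) E :
  finite_set E -> finite_set (diag E) /\
  \sum_(a \in E) \sum_(p <- splits a) F p = \sum_(p \in diag E) F p.
Proof.
move=> fE; pose l := [seq p | a <- fset_set E, p <- splits a].
have ul : uniq l.
  apply: allpairs_uniq_dep => [|a _|]; [exact: fset_uniq|exact: splits_uniq|].
  move=> [a p] [b q] /allpairsPdep[a1 [p1 [_ + [-> ->]]]] /allpairsPdep[a2 [p2 [_ + [-> ->]]]].
  by rewrite !mem_splits /= => /eqP + /eqP + pq; subst p2 => -> ->.
have lE : [set` l] = diag E.
  apply/seteqP; split => p /=.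
    move=> /allpairsPdep[a [q [aE qa ->]]]; rewrite /diag /=.
    by move: qa aE; rewrite mem_splits in_fset_set// inE => /eqP ->.
  move=> pE; apply/allpairsPdep; exists (madd p.1 p.2), p.
  by rewrite in_fset_set// mem_splits eqxx; split => //; rewrite inE.
rewrite -lE; split; first exact: finite_seq.
by rewrite -(@fsbig_seq _ _ _ _ l F ul) big_allpairs_dep fsbig_finite.
Qed.

Lemma fsum_pairs_le (I J : choiceType) (f : I -> R) (g : J -> R) (B C : R) :
  (forall i, 0 <= f i) -> (forall j, 0 <= g j) ->
  (forall A, finite_set A -> \sum_(i \in A) f i <= B) ->
  (forall A, finite_set A -> \sum_(j \in A) g j <= C) ->
  forall A : set (I * J), finite_set A -> \sum_(p \in A) f p.1 * g p.2 <= B * C.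
Proof.
move=> f0 g0 fB gC A fA.
have f1 : finite_set (fst @` A) by exact: finite_image.
have f2 : finite_set (snd @` A) by exact: finite_image.
apply: (@le_trans _ _ (\sum_(p \in (fst @` A) `*` (snd @` A)) f p.1 * g p.2)).
  apply: ler_fsum_subset; [by move=> p; rewrite mulr_ge0|exact: finite_setX|].
  by move=> p Ap; split; exists p.
rewrite -(pair_fsbig _ (fun i j => f i * g j))//=.
under eq_fsbigr do rewrite -mulr_fsumr.
rewrite -mulr_fsuml; apply: ler_pM; [|exact: fsumr_ge0|exact: fB|exact: gC].
exact: fsumr_ge0.
Qed.

Lemma conv_abs_le (f g : multi_index n -> R) (B C : R) :
  (forall a, 0 <= f a) -> (forall a, 0 <= g a) ->
  (forall E, finite_set E -> \sum_(a \in E) f a <= B) ->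
  (forall E, finite_set E -> \sum_(a \in E) g a <= C) ->
  forall E, finite_set E ->
    \sum_(a \in E) \sum_(p <- splits a) f p.1 * g p.2 <= B * C.
Proof.
move=> f0 g0 fB gC E fE; have [fd ->] := fsum_splits (fun p => f p.1 * g p.2) fE.
exact: fsum_pairs_le.
Qed.

Variable G : groupType.
Implicit Types F : multi_index n -> HS R G.
Let hsN := @hsnorm_is_norm R G.

Let mulBl (S T U : HS R G) : hs_mul (S - T) U = hs_mul S U - hs_mul T U.
Proof. exact: HSP. Qed.

Let mulBr (S T U : HS R G) : hs_mul S (T - U) = hs_mul S T - hs_mul S U.
Proof. by apply: HSP => x; rewrite HSDE HSNE !hs_mulE HSDE HSNE HS_D HS_N. Qed.

Let mul_sum F F' (A B : set (multi_index n)) : finite_set A -> finite_set B ->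
  \sum_(p \in A `*` B) hs_mul (F p.1) (F' p.2) =
  hs_mul (\sum_(a \in A) F a) (\sum_(b \in B) F' b).
Proof.
move=> fA fB; rewrite -(pair_fsbig _ (fun a b => hs_mul (F a) (F' b)))//=.
rewrite !fsbig_finite//= (big_morph (@hs_mul R G ^~ _) (fun S T => hs_mulDl S T _) (hs_mul0l _)).
apply: eq_bigr => a _; rewrite fsbig_finite//=.
by rewrite (big_morph (hs_mul (F a)) (hs_mulDr (F a)) (hs_mul0r _)).
Qed.

(** The double family is absolutely summable. Large rectangles identify its sum with the product of
    the sums, and grouping its terms by total index gives the convolution. *)
Lemma has_sum_conv F F' s s' (B C : R) :
  (forall E, finite_set E -> \sum_(a \in E) hsnorm (F a) <= B) ->
  (forall E, finite_set E -> \sum_(a \in E) hsnorm (F' a) <= C) ->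
  has_sum (@hsnorm R G) setT F s -> has_sum (@hsnorm R G) setT F' s' ->
  has_sum (@hsnorm R G) setT (conv (@hs_mul R G) F F') (hs_mul s s').
Proof.
move=> FB FC hs hs'.
pose P (p : multi_index n * multi_index n) := hs_mul (F p.1) (F' p.2).
have [v hv] : exists v, has_sum (@hsnorm R G) setT P v.
  apply: has_sum_exists; [exact: hsN|exact: hsnorm_complete|].
  apply: (@esum_bound_lty _ _ _ _ (B * C)) => A [fA _].
  apply: le_trans (fsum_pairs_le (fun=> hsnorm_ge0 _) (fun=> hsnorm_ge0 _) FB FC fA).
  by rewrite !fsbig_finite//; apply: ler_sum => p _; exact: hsnormM.
have -> : hs_mul s s' = v.
  apply/subr0_eq/(is_norm_small hsN) => e e0.
  (* With d <= 1 the three errors are below d |s'|, (|s| + d) d and d, in total at most d K <= e. *)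
  pose K := hsnorm s + hsnorm s' + 2.
  have K0 : 0 < K.
    by have := hsnorm_ge0 s; have := hsnorm_ge0 s'; rewrite /K; set X := hsnorm _; set Y := hsnorm _ => *; lra.
  pose d := Num.min (e / K) 1.
  have d0 : 0 < d by rewrite lt_min ltr01 divr_gt0.
  have d1 : d <= 1 by rewrite ge_min lexx orbT.
  have dK : d * K <= e by rewrite -ler_pdivlMr// ge_min lexx.
  have [P0 [fP0 _] hP0] := hv _ d0.
  have [A0 [fA0 _] hA0] := hs _ d0; have [B0 [fB0 _] hB0] := hs' _ d0.
  pose A1 := A0 `|` (fst @` P0); pose B1 := B0 `|` (snd @` P0).
  have fA1 : finite_set A1 by rewrite finite_setU; split => //; exact: finite_image.
  have fB1 : finite_set B1 by rewrite finite_setU; split => //; exact: finite_image.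
  have h1 := hA0 A1 (conj fA1 (@subsetT _ _)) (@subsetUl _ _ _).
  have h2 := hB0 B1 (conj fB1 (@subsetT _ _)) (@subsetUl _ _ _).
  have h3 := hP0 (A1 `*` B1) (conj (finite_setX fA1 fB1) (@subsetT _ _)) _.
  rewrite mul_sum// in h3.
  have {}h3 := h3 (fun p Pp => conj (or_intror (ex_intro2 _ _ p Pp erefl))
    (or_intror (ex_intro2 _ _ p Pp erefl))).
  set sA := \sum_(a \in A1) F a in h1 h3; set sB := \sum_(b \in B1) F' b in h2 h3.
  have E : hs_mul s s' - v = hs_mul (s - sA) s' + hs_mul sA (s' - sB)
      - (v - hs_mul sA sB).
    rewrite mulBl mulBr opprB.
    by rewrite !subrKA.
  have nA : hsnorm sA <= hsnorm s + d.
    rewrite -[sA](subKr s); apply: le_trans (is_normB hsN _ _) _.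
    by rewrite lerD2l ltW.
  rewrite E; apply: le_lt_trans (is_normB hsN _ _) _.
  apply: le_lt_trans (lerD (is_normD hsN _ _) (lexx _)) _.
  apply: le_lt_trans (lerD (lerD (hsnormM _ _) (hsnormM _ _)) (lexx _)) _.
  have := hsnorm_ge0 s; have := hsnorm_ge0 s'; have := hsnorm_ge0 sA.
  move: h1 h2 h3 nA dK; rewrite /K.
  set X1 := hsnorm (s - sA); set X2 := hsnorm (s' - sB); set X3 := hsnorm (v - _).
  set X4 := hsnorm s; set X5 := hsnorm s'; set X6 := hsnorm sA.
  move=> h1 h2 h3 nA dK p6 p5 p4.
  have q1 : X1 * X5 <= d * X5 by rewrite ler_wpM2r// ltW.
  have q2 : X6 * X2 <= (X4 + d) * d.
    by apply: ler_pM => //; [exact: hsnorm_ge0 | exact: ltW].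
  have q3 : d * d <= d by rewrite ler_piMr// ltW.
  nra.
move=> e e0; have [P0 [fP0 _] hP0] := hv _ e0.
(* A set of indices containing the sums of the pairs in [P0] has a set of decompositions containing
   [P0]. *)
exists ((fun p => madd p.1 p.2) @` P0); first by split => //; exact: finite_image.
move=> E [fE _] PE; have [fd ->] := fsum_splits P fE.
apply: hP0 => // p Pp; apply: PE; by exists p.
Qed.

End cauchy_product.

Lemma ler_fsum_pointwise (R : realType) (I : choiceType) (A : set I) (f g : I -> R) :
  finite_set A -> (forall i, f i <= g i) -> \sum_(i \in A) f i <= \sum_(i \in A) g i.
Proof. by move=> fA fg; rewrite !fsbig_finite//; apply: ler_sum => i _. Qed.

(** * The unitary representation at a fixed parameter *)

Section evaluation.
Variables (R : realType) (G : groupType) (n : nat).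
Variables (x : G -> multi_index n -> HS R G) (t : 'rV[R]_n).
Hypothesis x0 : forall g, x g mzero = 0.
Hypothesis x_cop : forall g h a, cop_defect (@hs_mul R G) (@ad_lambda R G) x g h a = 0.
Hypothesis x_star : forall g a, star_defect (@hs_mul R G) (@hs_star R G) x g a = 0.
Implicit Types (g h : G) (a b : multi_index n).

Let hsN := @hsnorm_is_norm R G.

Let F g a := (mpow t a)%:C%C *: x g a.

Let mpowD a b : mpow t (madd a b) = mpow t a * mpow t b.
Proof. by rewrite /mpow -big_split/=; apply: eq_bigr => i _; rewrite ffunE exprD. Qed.

Let F_conv (f f' : multi_index n -> HS R G) a :
  (mpow t a)%:C%C *: conv (@hs_mul R G) f f' a =
  conv (@hs_mul R G) (fun b => (mpow t b)%:C%C *: f b) (fun b => (mpow t b)%:C%C *: f' b) a.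
Proof.
rewrite /conv scaler_sumr big_seq [RHS]big_seq; apply: eq_bigr => p.
rewrite mem_splits => /eqP <-; rewrite hs_mulZl hs_mulZr scalerA.
by rewrite mpowD rmorphM.
Qed.

Let F_norm g a : hsnorm (F g a) = hsnorm (x g a) * `|mpow t a|.
Proof. by rewrite hsnormZ normc_real mulrC. Qed.

Let F_mul g h a :
  F (g * h)%g a = F g a + ad_lambda g (F h a) + conv (@hs_mul R G) (F g) (ad_lambda g \o F h) a.
Proof.
have /eqP := x_cop g h a; rewrite subr_eq0 => /eqP E.
rewrite {1}/F -E /cop !scalerDr -ad_lambdaZ F_conv; congr (_ + conv _ _ _ _).
by apply/funext => b /=; rewrite ad_lambdaZ.
Qed.

Let F_star g a :
  hs_star (F g a) + F g a + conv (@hs_mul R G) (@hs_star R G \o F g) (F g) a = 0.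
Proof.
have := congr1 (fun T : HS R G => (mpow t a)%:C%C *: T) (x_star g a).
rewrite scaler0 /star_defect /cop !scalerDr F_conv => E; rewrite -[RHS]E /F /=.
rewrite hs_starZ conjc_real; congr (_ + _).
by rewrite /conv; apply: eq_bigr => p _; rewrite /= hs_starZ conjc_real.
Qed.

Definition abs_bounded g := exists B, forall E, finite_set E ->
  \sum_(a \in E) hsnorm (x g a) * `|mpow t a| <= B.

Let F_bounded g : abs_bounded g -> exists B, forall E, finite_set E ->
  \sum_(a \in E) hsnorm (F g a) <= B.
Proof.
move=> [B hB]; exists B => E fE; apply: le_trans (hB E fE).
by apply: ler_fsum_pointwise => // a; rewrite F_norm.
Qed.

(** The coefficients for gh are those of the product of two series, and conjugation is isometric:
    bounds B and C give B + C + BC at the same [t]. *)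
Lemma abs_boundedM g h : abs_bounded g -> abs_bounded h -> abs_bounded (g * h)%g.
Proof.
move=> /F_bounded[B hB] /F_bounded[C hC]; exists (B + C + B * C) => E fE.
have h3 := conv_abs_le (fun=> hsnorm_ge0 _) (fun=> hsnorm_ge0 _) hB hC fE.
have h1 := hC E fE; have h2 := hB E fE.
rewrite fsbig_finite// in h1; rewrite fsbig_finite// in h2.
rewrite fsbig_finite// in h3; rewrite fsbig_finite//.
apply: le_trans (lerD (lerD h2 h1) h3); rewrite -!big_split/=.
apply: ler_sum => a _; rewrite -F_norm F_mul.
apply: le_trans (is_normD hsN _ _) _; apply: lerD.
  by apply: le_trans (is_normD hsN _ _) _; rewrite hsnorm_ad.
apply: le_trans (is_norm_sum hsN _ _ _) _; apply: ler_sum => p _.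
by apply: le_trans (hsnormM _ _) _; rewrite /= hsnorm_ad.
Qed.

Hypothesis x_bounded : forall g, abs_bounded g.

Definition eval_at g : HS R G :=
  xget 0 [set s | has_sum (@hsnorm R G) setT (F g) s].

Lemma has_sum_eval g : has_sum (@hsnorm R G) setT (F g) (eval_at g).
Proof.
have [B hB] := F_bounded (x_bounded g).
have [|s hs] := @has_sum_exists R _ (@hsnorm R G) _ setT (F g) hsN (@hsnorm_complete R G).
  by apply: (@esum_bound_lty _ _ _ _ B) => E [fE _]; exact: hB.
exact: (@xgetPex _ 0 _ (ex_intro _ s hs)).
Qed.

Let has_sum_ad g h :
  has_sum (@hsnorm R G) setT (ad_lambda g \o F h) (ad_lambda g (eval_at h)).
Proof.
apply: (has_sum_map (M := 1) hsN (ad_lambda0 _ g) (ad_lambdaD g)) (has_sum_eval h).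
by move=> T; rewrite mul1r hsnorm_ad.
Qed.

Let has_sum_star g :
  has_sum (@hsnorm R G) setT (@hs_star R G \o F g) (hs_star (eval_at g)).
Proof.
apply: (has_sum_map (M := 1) hsN (hs_star0 R G) (@hs_starD R G)) (has_sum_eval g).
by move=> T; rewrite mul1r hsnorm_star.
Qed.

Lemma eval_atM g h : eval_at (g * h)%g = eval_at g + ad_lambda g (eval_at h) +
  hs_mul (eval_at g) (ad_lambda g (eval_at h)).
Proof.
have [B hB] := F_bounded (x_bounded g); have [C hC] := F_bounded (x_bounded h).
apply: (has_sum_uniq hsN (has_sum_eval _)).
apply: (has_sum_eq (F := fun a => F g a + (ad_lambda g \o F h) a +
  conv (@hs_mul R G) (F g) (ad_lambda g \o F h) a)) => [a _|]; first by rewrite F_mul.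
apply: (has_sumD hsN); first exact: (has_sumD hsN (has_sum_eval g) (has_sum_ad g h)).
apply: (has_sum_conv hB (C := C) _ (has_sum_eval g) (has_sum_ad g h)) => E fE.
by apply: le_trans (hC E fE); apply: ler_fsum_pointwise => // a; rewrite /= hsnorm_ad.
Qed.

Lemma eval_at_star g : hs_star (eval_at g) + eval_at g +
  hs_mul (hs_star (eval_at g)) (eval_at g) = 0.
Proof.
have [B hB] := F_bounded (x_bounded g).
have zero : has_sum (@hsnorm R G) (setT : set (multi_index n)) (fun=> 0) 0.
  move=> e e0; exists set0; first exact: fsets_set0.
  by move=> A _ _; rewrite fsbig1// subrr (is_norm0 hsN).
apply: (has_sum_uniq hsN _ zero).
apply: (has_sum_eq (F := fun a => (@hs_star R G \o F g) a + F g a +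
  conv (@hs_mul R G) (@hs_star R G \o F g) (F g) a)) => [a _|]; first exact: F_star.
apply: (has_sumD hsN); first exact: (has_sumD hsN (has_sum_star g) (has_sum_eval g)).
apply: (has_sum_conv (B := B) _ hB (has_sum_star g) (has_sum_eval g)) => E fE.
by apply: le_trans (hB E fE); apply: ler_fsum_pointwise => // a; rewrite /= hsnorm_star.
Qed.

Definition deformed g (y : ell2 R G) : ell2 R G := lambda g y + eval_at g (lambda g y).

Let deformedM g h y : deformed (g * h)%g y = deformed g (deformed h y).
Proof.
rewrite /deformed lambdaM eval_atM.
move: (eval_at g) (eval_at h) (lambda h y) => S T z.
have E : ad_lambda g T (lambda g z) = lambda g (T z) by rewrite ad_lambdaE lambdaK.
rewrite 2!HSDE hs_mulE E (lambdaD g z (T z)) HS_D !addrA.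
by rewrite [LHS](ACl (1*3*2*4)%AC).
Qed.

Let deformed_inner g y z : inner (deformed g y) (deformed g z) = inner y z.
Proof.
rewrite -(inner_lambda g y z) /deformed; move: (lambda g y) (lambda g z) => u v.
have := eval_at_star g; move: (eval_at g) => S SS.
rewrite innerDl (hs_star_adjoint S u) -innerDr; congr (inner u _).
have := congr1 (fun T : HS R G => T v) SS.
rewrite 2!HSDE hs_mulE HS0E HS_D => E.
rewrite -[RHS]addr0 -E -addrA; congr (v + _).
by rewrite addrA [S v + _]addrC.
Qed.

Let deformedD g y z : deformed g (y + z) = deformed g y + deformed g z.
Proof. by rewrite /deformed lambdaD HS_D addrACA. Qed.

Let deformedZ g (k : R[i]) y : deformed g (k *: y) = k *: deformed g y.
Proof.
have E : lambda g (k *: y) = k *: lambda g y by apply: ell2P.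
by rewrite /deformed E HS_Z scalerDr.
Qed.

(** Multiplicativity makes [deformed 1%g] idempotent, so it kills the difference between
    [deformed 1%g y] and [y]; being isometric, it kills only 0. Invertibility of every [deformed g]
    follows. *)
Let deformed1 y : deformed 1%g y = y.
Proof.
apply/subr0_eq; set u := _ - y.
have u0 : deformed 1%g u = 0.
  have Dn z : deformed 1%g (- z) = - deformed 1%g z by rewrite -scaleN1r deformedZ scaleN1r.
  by rewrite deformedD Dn -deformedM mulg1 subrr.
have := inner_xx u; rewrite -(deformed_inner 1%g) u0.
have -> : inner (0 : ell2 R G) (0 : ell2 R G) = 0.
  by rewrite -(scale0r (0 : ell2 R G)) innerZl mul0r.
move=> [/esym/eqP]; rewrite sqrf_eq0 => /eqP; exact: (is_norm_eq0 (@l2norm_is_norm R G)).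
Qed.

Lemma deformed_unitary_rep : unitary_rep deformed.
Proof.
split.
- move=> g; split.
  + by move=> k y z; rewrite deformedD deformedZ.
  + exists (deformed g^-1%g) => y; rewrite -deformedM; first by rewrite mulVg deformed1.
    by rewrite mulgV deformed1.
  + exact: deformed_inner.
- by apply/funext => y; exact: deformed1.
- by move=> g h; apply/funext => y; exact: deformedM.
Qed.

End evaluation.

Theorem corollary6p1 (R : realType) (G : groupType) :
  finitely_generated G ->
  cohomology_zero (ell2_lambda R G) 2 ->
  forall n : nat, (1 <= n)%N ->
  forall c : 'I_n -> cochain (HS_Ad_lambda R G) 1,
    (forall i, cocycles (HS_Ad_lambda R G) 1 (c i)) ->
    (forall i, skew_adjoint (c i)) ->
    integrates c.
Proof.
move=> fgG H2 n _ c Zc skc.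
have [S fgS] := finitely_generated_ball fgG.
have [L [Q [L0 Q0 prim]]] := HS_skew_primitive fgS H2.
pose c' i g : HS R G := c i [tuple g].
have c'1 i g h : c' i (g * h)%g = c' i g + ad_lambda g (c' i h).
  exact: (cocycles1P (Zc i) g h).
have c'2 i g : hs_star (c' i g) = - c' i g by apply: hs_star_eq; exact: skc.
have K0 : 0 < 2^-1 + Q * (1 + 3 / 2) by lra.
(* The inverse of the factor by which one inductive step would enlarge the majorant. *)
pose eta : R := (2^-1 + Q * (1 + 3 / 2))^-1.
have eta0 : 0 < eta by rewrite invr_gt0.
have etaQ : eta * (2^-1 + Q * (1 + 3 / 2)) <= 1 by rewrite mulVf// gt_eqF.
pose w i := eta / 8 ^+ n * mwt R (@munit n i).
have w0 i : 0 < w i by rewrite !mulr_gt0 ?mwt_gt0 ?invr_gt0 ?exprn_gt0.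
(* The majorant at a unit index is [w i * rho], so a large [rho] dominates the given cocycles on the
   finite ball; the final 1 ensures positivity. *)
pose rho : R := \sum_(i < n) \sum_(g <- word_ball S L) hsnorm (c' i g) / w i + 1.
have sum0 i : 0 <= \sum_(g <- word_ball S L) hsnorm (c' i g) / w i.
  by apply: sumr_ge0 => g _; rewrite divr_ge0 ?(ltW (w0 i))//; exact: hsnorm_ge0.
have rho0 : 0 < rho by rewrite ltr_wpDl// sumr_ge0.
have c'maj i g : g \in word_ball S L -> hsnorm (c' i g) <= maj eta rho (@munit n i).
  move=> gL; rewrite /maj mdeg_munit expr1 mulrAC -/(w i) mulrC -ler_pdivrMr//.
  rewrite /rho (bigD1 i)//= -addrA.
  apply: (@le_trans _ _ (\sum_(g <- word_ball S L) hsnorm (c' i g) / w i)).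
    apply: (ler_sum_mem (F := fun g => hsnorm (c' i g) / w i) gL) => h.
    by rewrite divr_ge0 ?(ltW (w0 i))//; exact: hsnorm_ge0.
  by rewrite lerDl addr_ge0// sumr_ge0.
have [x hx] := full_deformation c'1 c'2 eta0 rho0 etaQ prim c'maj.
have x0 := pd0 (hx 0%N).
have x_cop g h a : cop_defect (@hs_mul R G) (@ad_lambda R G) x g h a = 0.
  exact: (pd_cop (hx (mdeg a))).
have x_star g a : star_defect (@hs_mul R G) (@hs_star R G) x g a = 0.
  exact: (pd_star (hx (mdeg a))).
have x_maj g a : g \in word_ball S L -> hsnorm (x g a) <= maj eta rho a.
  exact: (pd_maj (hx (mdeg a))).
(* The norm on row vectors is the maximum norm, so membership in this ball bounds every
   [rho * |t_i|] by 1. *)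
pose U : set 'rV[R]_n := ball (0 : 'rV[R]_n) rho^-1.
have x_bd t : U t -> forall g, abs_bounded x t g.
  move=> Ut.
  have bL g : g \in word_ball S L -> abs_bounded x t g.
    move=> gL; exists eta => E fE.
    have ht i : rho * `|t ord0 i| <= 1.
      have := Ut.2 ord0 i; rewrite /ball /= mxE sub0r normrN => h.
      by rewrite mulrC -ler_pdivlMr// mul1r ltW.
    apply: le_trans (maj_sum eta0 rho0 ht fE).
    by apply: ler_fsum_pointwise => // a; rewrite ler_wpM2r// x_maj.
  (* Word induction reaches every [g] without changing [t], so the neighbourhood does not depend on
     [g]. *)
  move=> g; have [m] := fgS g; move: m g; apply: word_ball_ind.
    by apply: bL; apply: (@word_ball_le _ S 0) => //; rewrite inE.
  move=> s g sS; apply: abs_boundedM => //; apply: bL.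
  rewrite -[s]mulg1; apply: (@word_ball_le _ S 1) => //.
  by apply: word_ballS; rewrite ?inE.
exists U, (fun a g => x g a), (fun t => deformed x t); split.
- exact: ball_open.
- by apply: ballxx; rewrite invr_gt0.
- by move=> t Ut; apply: deformed_unitary_rep => //; exact: x_bd.
- move=> t g Ut; split.
    have [B hB] := x_bd t Ut g.
    by apply: (@esum_bound_lty _ _ _ _ B) => A [fA _]; exact: hB.
  exists (eval_at x t g) => // e e0.
  have hs := has_sum_eval (x_bd t Ut) g.
  have [A [fA _] hA] := hs e e0.
  pose D := [set a : multi_index n | (0 < mdeg a)%N].
  exists (A `&` D); first by split; [exact: finite_setIl|exact: subIsetr].
  move=> E [fE ED] AE.
  (* The evaluation sums over all multi-indices, the required sum only over those of positive
     degree; adjoining the zero index to [E] costs nothing since its coefficient is 0. *)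
  have fE0 : finite_set (E `|` [set mzero]) by rewrite finite_setU; split.
  have := hA _ (conj fE0 (@subsetT _ _)) _.
  rewrite fsbigU0//=; last first.
    by move=> a [/ED + /= a0]; rewrite /= a0 mdeg0.
  rewrite fsbig_set1 x0 scaler0 addr0; apply => a Aa.
  have [/eqP|a0] := posnP (mdeg a); first by rewrite mdeg_eq0 => /eqP ->; right.
  by left; apply: AE.
- by move=> i g; exact: (pd1 (hx 1%N)).
Qed.
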